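(* Let $C\subseteq X$ be a proper convex cone, and let $\chi(C)$ be a generating set of $C$. (i) If the minimal operator system $C^{\mathrm{min}}$ admits a $P^d$-lift, then there exists a complex vector space $W$ spanned by real-valued semialgebraic functions on $\chi(C)$, with $\dim(W)\leqslant d^2$, such that for every $t\geqslant 1$ and every $\phi\in\mathrm{Pos}(C,\mathrm{Psd}_t(\mathbb{C}))$ there exist finitely many $P_k\in\mathrm{Mat}_{d,t}(W)$ with $$\phi(c)=\sum_k P_k(c)^*P_k(c)\quad\text{for all } c\in\chi(C).$$ (ii) Conversely, if there exists a $d$-dimensional complex vector space $W$ of arbitrary complex-valued functions on $\chi(C)$ such that for every $t\geqslant 1$ and every $\phi\in\mathrm{Pos}(C,\mathrm{Psd}_t(\mathbb{C}))$ there exist finitely many $P_k\in\mathrm{Mat}_{d,t}(W)$ with $\phi(c)=\sum_k P_k(c)^*P_k(c)$ for all $c\in\chi(C)$, then $C^{\mathrm{min}}$ admits a $P^d$-lift.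
   Context: All vector spaces of operator systems and cones are real and equipped with the finest locally convex topology. $\mathrm{Her}_s(\mathbb{C})$ is the real vector space of complex Hermitian $s\times s$ matrices and $\mathrm{Psd}_s(\mathbb{C})$ its cone of positive semidefinite matrices. A convex cone $C\subseteq X$ is proper if it is pointed ($C\cap -C=\{0\}$), closed and has non-empty interior. A generating set $\chi(C)$ of $C$ is a subset of $C$ whose conic hull is $C$. $\mathrm{Pos}(C,\mathrm{Psd}_t(\mathbb{C}))$ is the set of linear maps $\phi\colon X\to\mathrm{Her}_t(\mathbb{C})$ with $\phi(C)\subseteq\mathrm{Psd}_t(\mathbb{C})$. $\mathrm{Mat}_{d,t}(W)$ is the set of $d\times t$ matrices with entries in $W$. If $\chi(C)$ is not itself a semialgebraic set, a semialgebraic function on $\chi(C)$ means the restriction to $\chi(C)$ of a semialgebraic function on $C$. An (abstract) operator system $S$ on a vector space $X$ consists of a proper convex cone $S_s\subseteq X\otimes\mathrm{Her}_s(\mathbb{C})$ for each $s\geqslant 1$, such that for all $s,t$ and all $V\in\mathrm{Mat}_{s,t}(\mathbb{C})$ the map $\mathrm{id}_X\otimes(V^*\cdot V)\colon X\otimes\mathrm{Her}_s(\mathbb{C})\to X\otimes\mathrm{Her}_t(\mathbb{C})$ maps $S_s$ into $S_t$. The operator system $P^d$ on $\mathrm{Her}_d(\mathbb{C})$ is given by $(P^d)_s=\mathrm{Psd}_{ds}(\mathbb{C})\subseteq \mathrm{Her}_d(\mathbb{C})\otimes\mathrm{Her}_s(\mathbb{C})=\mathrm{Her}_{ds}(\mathbb{C})$.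 For a proper cone $C\subseteq X$, $C^{\mathrm{min}}$ denotes the smallest operator system $S$ on $X$ with base cone $S_1=C$. For a linear map $\phi\colon X\to Y$ and $a\in X\otimes\mathrm{Her}_s(\mathbb{C})$ write $\phi[a]:=(\phi\otimes\mathrm{id}_{\mathrm{Her}_s(\mathbb{C})})(a)$. For operator systems $S$ on $X$ and $T$ on $Y$, a $T$-lift of $S$ is a pair $(\pi,\gamma)$ of linear maps $\pi\colon Z\to X$, $\gamma\colon Z\to Y$, for some vector space $Z$, with $\gamma$ injective and $S=\pi[\gamma^{-1}[T]]$ levelwise, i.e. for all $s\geqslant 1$: $S_s=\{\pi[c] : c\in Z\otimes\mathrm{Her}_s(\mathbb{C}),\ \gamma[c]\in T_s\}$. *)

(* Defs.v *)
From HB Require Import structures.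
From mathcomp Require Import all_boot all_order all_algebra.
From mathcomp Require Import sesquilinear spectral.
From mathcomp Require Import complex mxtens.
From mathcomp Require Import interval_inference.
From mathcomp Require Import boolp classical_sets functions.
From mathcomp Require Import reals convex topology tvs.
From mathcomp Require Import ring.

Set Implicit Arguments.
Unset Strict Implicit.
Unset Printing Implicit Defensive.

Import Order.TTheory GRing.Theory Num.Theory.

Local Open Scope classical_set_scope.
Local Open Scope ring_scope.
Local Open Scope complex_scope.
Local Open Scope sesquilinear_scope.

Section FinestLocallyConvex.
Variable R : realType.

Definition balanced (V : lmodType R) (A : set V) :=
  forall (r : R) a, `|r| <= 1 -> A a -> A (r *: a).

Definition absorbing (V : lmodType R) (A : set V) :=
  forall v : V, exists2 r : R, 0 < r & A (r *: v).

(* The absolutely convex absorbing sets are the basic neighbourhoods of 0   *)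
(* in the finest locally convex topology.                                   *)
Definition flc_base (V : lmodType R) (A : set V) :=
  [/\ convex_set A, balanced A & absorbing A].

(* [flc V] is the vector space [V] with its finest locally convex topology. *)
Definition flc (V : lmodType R) : Type := V.

HB.instance Definition _ (V : lmodType R) := GRing.Lmodule.on (flc V).

Definition flc_open (V : lmodType R) (U : set (flc V)) :=
  forall x, U x ->
    exists2 A : set V, flc_base A & forall a, A a -> U (x + a).

Section Topology.
Variable V : lmodType R.

Lemma convex_setE (A : set V) : convex_set A <->
  forall (r : R) a b, 0 <= r -> r <= 1 -> A a -> A b ->
    A (r *: a + (1 - r) *: b).
Proof.
split=> [cA r a b r0 r1 Aa Ab|cA a b l /set_mem Aa /set_mem Ab].
  have := cA a b (Itv01 r0 r1) (mem_set Aa) (mem_set Ab).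
  by move=> /set_mem; rewrite /conv /=.
by apply: mem_set; rewrite /conv /=; exact: cA.
Qed.

Lemma flc_base0 (A : set V) : flc_base A -> A 0.
Proof.
move=> [_ bA aA]; have [r r0 Ar] := aA 0.
by rewrite -(scaler0 V r).
Qed.

Lemma flc_baseI (A B : set V) :
  flc_base A -> flc_base B -> flc_base (A `&` B).
Proof.
move=> [cA bA aA] [cB bB aB]; split.
- apply/convex_setE => r a b r0 r1 [Aa Ba] [Ab Bb].
  by split; [move/convex_setE: cA|move/convex_setE: cB]; exact.
- by move=> r a r1 [Aa Ba]; split; [exact: bA|exact: bB].
- have shrink (D : set V) (v : V) (p q : R) : balanced D ->
      0 < p -> 0 < q -> p <= q -> D (q *: v) -> D (p *: v).
    move=> bD p0 q0 pq Dq.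
    have -> : p *: v = (p / q) *: (q *: v).
      by rewrite scalerA divfK ?gt_eqF.
    apply: bD => //; rewrite ger0_norm; last by rewrite divr_ge0 ?ltW.
    by rewrite ler_pdivrMr ?mul1r.
  move=> v; have [p p0 Ap] := aA v; have [q q0 Bq] := aB v.
  have [pq|qp] := leP p q.
    by exists p => //; split=> //; exact: shrink pq Bq.
  by exists q => //; split=> //; exact: shrink (ltW qp) Ap.
Qed.

Lemma flc_baseZ (A : set V) (r : R) :
  0 < r -> flc_base A -> flc_base [set v | A (r *: v)].
Proof.
move=> r0 [cA bA aA]; split=> /=.
- apply/convex_setE => t a b t0 t1 /= Aa Ab; move/convex_setE in cA.
  have -> : r *: (t *: a + (1 - t) *: b) = t *: (r *: a) + (1 - t) *: (r *: b).
    by rewrite scalerDr !scalerA mulrC [r * (1 - t)]mulrC.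
  exact: cA.
- by move=> t a t1 /= Aa; rewrite scalerA mulrC -scalerA; exact: bA.
- move=> v; have [p p0 Ap] := aA v; exists (r^-1 * p).
    by rewrite mulr_gt0 ?invr_gt0.
  by rewrite /= scalerA mulrA divff ?gt_eqF// mul1r.
Qed.

Lemma flc_base_half (A : set V) (a b : V) :
  flc_base A -> A (2 *: a) -> A (2 *: b) -> A (a + b).
Proof.
move=> [/convex_setE cA _ _] Aa Ab.
have := cA 2^-1 _ _ _ _ Aa Ab; rewrite (_ : 1 - 2^-1 = 2^-1 :> R); last first.
  by rewrite [X in X - _](splitr 1) !mul1r addrK.
rewrite !scalerA mulVf// !scale1r; apply.
  by rewrite invr_ge0.
by rewrite invf_le1// ler1n.
Qed.

Let flc_openT : flc_open (setT : set (flc V)).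
Proof.
move=> x _; exists setT => //; split=> // v.
by exists 1.
Qed.

Let flc_openI : setI_closed (@flc_open V).
Proof.
move=> A B oA oB x [/oA[A' fA sA] /oB[B' fB sB]].
exists (A' `&` B'); first exact: flc_baseI.
by move=> a [Aa Ba]; split; [exact: sA|exact: sB].
Qed.

Let flc_open_bigU (I : Type) (f : I -> set (flc V)) :
  (forall i, flc_open (f i)) -> flc_open (\bigcup_i f i).
Proof.
move=> of_ x [i _ fx]; have [A fA sA] := of_ i x fx.
by exists A => // a Aa; exists i => //; exact: sA.
Qed.

HB.instance Definition _ := Choice.on (flc V).
HB.instance Definition _ :=
  isOpenTopological.Build (flc V) flc_openT flc_openI flc_open_bigU.

Lemma flc_nbhsP (x : flc V) (U : set (flc V)) :
  nbhs x U <-> exists2 A : set V, flc_base A & forall a, A a -> U (x + a).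
Proof.
split=> [[O [oO Ox OU]]|[A fA AU]].
  have [A fA AO] := oO _ Ox.
  by exists A => // a Aa; apply: OU; exact: AO.
exists [set y | exists2 B : set V, flc_base B & forall b, B b -> U (y + b)].
split; last 2 first.
- by exists A.
- move=> y [B fB BU]; rewrite -[y]addr0; apply: BU; exact: flc_base0.
move=> y [B fB BU]; exists [set v : V | B (2 *: v)]; first exact: flc_baseZ.
move=> b /= Bb; exists [set v : V | B (2 *: v)]; first exact: flc_baseZ.
move=> c /= Bc; rewrite -addrA; apply: BU; exact: flc_base_half.
Qed.

End Topology.
End FinestLocallyConvex.

Section FlcTvs.
Variables (R : realType) (V : lmodType R).

Fact flc_add_continuous : continuous (fun x : flc V * flc V => x.1 + x.2).
Proof.
move=> [x y] U /flc_nbhsP[A fA AU] /=.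
exists ([set x + a | a in [set v : V | A (2 *: v)]],
        [set y + a | a in [set v : V | A (2 *: v)]]) => /=.
  by split; apply/flc_nbhsP; exists [set v : V | A (2 *: v)];
    [exact: flc_baseZ|move=> a Aa; exists a|exact: flc_baseZ|move=> a Aa; exists a].
move=> [_ _] /= [[a Aa <-] [b Ab <-]]; rewrite addrACA; apply: AU.
exact: flc_base_half.
Qed.

Fact flc_scale_continuous : continuous (fun z : R^o * flc V => z.1 *: z.2).
Proof.
move=> [r x] U /flc_nbhsP[A fA AU] /=; have [_ bA aA] := fA.
have [p p0 Ap] := aA (2 *: x); set q := `|r| + p.
have q0 : 0 < q by rewrite ltr_wpDl.
exists (ball r p, [set x + a | a in [set v : V | A (2 * q *: v)]]) => /=.
  split; first exact: nbhsx_ballx.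
  apply/flc_nbhsP; exists [set v : V | A (2 * q *: v)].
    by apply: flc_baseZ => //; rewrite mulr_gt0.
  by move=> a Aa; exists a.
move=> [t _] /= [rt [a Aa <-]].
have -> : t *: (x + a) = r *: x + ((t - r) *: x + t *: a).
  by rewrite scalerDr addrA -scalerDl addrCA subrr addr0.
apply: AU; apply: flc_base_half => //.
  have -> : 2 *: ((t - r) *: x) = ((t - r) / p) *: (p *: (2 *: x)).
    by rewrite !scalerA mulrC divfK ?gt_eqF.
  apply: bA => //; rewrite normrM normfV (gtr0_norm p0) ler_pdivrMr// mul1r.
  by rewrite distrC ltW.
have -> : 2 *: (t *: a) = (t / q) *: (2 * q *: a).
  rewrite !scalerA; congr (_ *: _).
  by rewrite [2 * q]mulrC mulrA divfK ?gt_eqF// mulrC.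
apply: bA => //; rewrite normrM normfV (gtr0_norm q0) ler_pdivrMr// mul1r.
rewrite -[t](subrK r) addrC (le_trans (ler_normD _ _))// lerD2l distrC ltW//.
Qed.

Fact flc_locally_convex : exists2 B : set_system (flc V),
  (forall b, b \in B -> convex_set b) & basis B.
Proof.
exists [set U : set (flc V) | convex_set U /\ open U].
  by move=> b /set_mem[].
split=> [U [_ //]|x U /flc_nbhsP[A fA AU]].
exists [set y : flc V | exists2 B : set V, flc_base B &
  forall b, B b -> A (y - x + b)]; last first.
  move=> y [B fB BA]; have := AU (y - x) ; rewrite subrKC; apply.
  by rewrite -[y - x]addr0; apply: BA; exact: flc_base0.
split; last by exists A => // b Ab; rewrite subrr add0r.
split.
  apply/convex_setE => r y z r0 r1 [B fB By] [D fD Dz].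
  exists (B `&` D); first exact: flc_baseI.
  move=> b [Bb Db]; have [/convex_setE cA _ _] := fA.
  have := cA r _ _ r0 r1 (By b Bb) (Dz b Db); congr A.
  rewrite !scalerDr addrACA -scalerDl subrKC scale1r; congr (_ + _).
  by rewrite addrACA !scalerN -opprD -scalerDl subrKC scale1r.
move=> y [B fB By].
exists [set v : V | B (2 *: v)]; first exact: flc_baseZ.
move=> b /= Bb; exists [set v : V | B (2 *: v)]; first exact: flc_baseZ.
move=> c /= Bc; rewrite [y + b - x]addrAC -[_ + b + c]addrA; apply: By.
exact: flc_base_half.
Qed.

HB.instance Definition _ := PreTopologicalLmod_isTvs.Build R (flc V)
  flc_add_continuous flc_scale_continuous flc_locally_convex.

Lemma flc_finest (E : tvsType R) (f : {linear V -> E}) :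
  continuous (f : flc V -> E).
Proof.
have [B cB [oB bB]] := @locally_convex R E.
move=> x U /= fxU; have [W [BW Wfx] WU] := bB _ _ fxU.
have Wc : convex_set W by apply: cB; exact: mem_set.
have Wn : nbhs (f x) W by apply: open_nbhs_nbhs; split => //; exact: oB.
apply/flc_nbhsP.
exists [set v : V | W (f x + f v) /\ W (f x - f v)]; last first.
  by move=> a [Wa _]; apply: WU; rewrite linearD.
have f0 : W (f x + f 0) by rewrite linear0 addr0.
have cW r a b : 0 <= r -> r <= 1 -> W (f x + f a) -> W (f x + f b) ->
    W (f x + f (r *: a + (1 - r) *: b)).
  move=> r0 r1 Wa Wb; move/convex_setE in Wc; have := Wc _ _ _ r0 r1 Wa Wb.
  congr W; rewrite !scalerDr addrACA -scalerDl subrKC scale1r.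
  by rewrite linearD !linearZ.
split.
- apply/convex_setE => r a b r0 r1 [Wa Wa'] [Wb Wb']; split; first exact: cW.
  rewrite -linearN opprD -!scalerN; apply: cW => //; by rewrite linearN.
- have scl r a : 0 <= r -> r <= 1 -> W (f x + f a) -> W (f x + f (r *: a)).
    move=> r0 r1 Wa; have := cW r a 0 r0 r1 Wa f0.
    by rewrite scaler0 addr0.
  move=> r a r1 [Wa Wa'].
  have [r0|r0] := leP 0 r.
    rewrite (ger0_norm r0) in r1; split; first exact: scl.
    by rewrite -linearN -scalerN; apply: scl => //; rewrite linearN.
  rewrite (ltr0_norm r0) in r1; have nr0 : 0 <= - r by rewrite oppr_ge0 ltW.
  split.
    by rewrite -[r]opprK scaleNr -scalerN; apply: scl => //; rewrite linearN.
  by rewrite -linearN -scaleNr; apply: scl.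
- move=> v.
  have cont (w : E) : \forall t \near (0 : R^o), W (f x + t *: w).
    have Wn0 : nbhs (f x + 0 *: w) W by rewrite scale0r addr0.
    have /= [[P Q] /= [Pn Qn] PQ] := @add_continuous E (f x, 0 *: w) W Wn0.
    have /= [[P' Q'] /= [Pn' Qn'] PQ'] := @scale_continuous R E (0, w) Q Qn.
    apply: filterS Pn' => t Pt; apply: (PQ (f x, t *: w)); split => /=.
      exact: nbhs_singleton.
    by apply: (PQ' (t, w)); split=> //=; exact: nbhs_singleton.
  have [e /= e0 He] := (nbhs_ballP _ _).1 (filterI (cont (f v)) (cont (- f v))).
  exists (e / 2); first by rewrite divr_gt0.
  have [] := He (e / 2).
    by rewrite /ball /= sub0r normrN gtr0_norm ?divr_gt0// gtr_pMr//
       invf_lt1// ltr1n.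
  by move=> /= W1; rewrite scalerN => W2; rewrite linearZ_LR.
Qed.

End FlcTvs.

Section Cones.
Variables (R : realType) (V : lmodType R).

Definition convex_cone (C : set V) :=
  [/\ C 0,
      forall x y, C x -> C y -> C (x + y) &
      forall (r : R) x, 0 <= r -> C x -> C (r *: x)].

Definition pointed_cone (C : set V) := C `&` [set - x | x in C] = [set 0].

Definition proper_cone (C : set V) :=
  [/\ convex_cone C, pointed_cone C, closed (C : set (flc V)) &
      interior (C : set (flc V)) !=set0].

Definition conic_hull (A : set V) : set V :=
  [set x | exists n (r : 'I_n -> R) (a : 'I_n -> V),
    (forall i, 0 <= r i /\ A (a i)) /\ x = \sum_(i < n) r i *: a i].

Definition generating_set (C chi : set V) :=
  chi `<=` C /\ conic_hull chi = C.

End Cones.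

Section Hermitian.
Variables (R : realType) (n : nat).

Record herm := Herm { herm_val :> 'M[R[i]]_n ; _ : herm_val^t* == herm_val }.

HB.instance Definition _ := [isSub for herm_val].
HB.instance Definition _ := [Choice of herm by <:].

Lemma hermP (A : herm) : (A : 'M[R[i]]_n)^t* = A.
Proof. by apply/eqP; case: A. Qed.

Fact herm_zmod_closed :
  zmod_closed [pred A : 'M[R[i]]_n | A^t* == A].
Proof.
split=> [|A B]; rewrite !inE; first by rewrite trmx0 map_mx0.
by move=> /eqP hA /eqP hB; rewrite linearB/= map_mxB hA hB.
Qed.

HB.instance Definition _ := GRing.SubChoice_isSubZmodule.Build
  _ _ herm herm_zmod_closed.

Fact herm_scale_subproof (r : R) (A : herm) :
  ((r%:C *: (A : 'M[R[i]]_n))^t*) == r%:C *: (A : 'M[R[i]]_n).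
Proof.
by rewrite linearZ/= map_mxZ hermP /= conj_Creal// complex_real.
Qed.

Definition herm_scale (r : R) (A : herm) : herm := Herm (herm_scale_subproof r A).

Fact herm_scaleA a b v : herm_scale a (herm_scale b v) = herm_scale (a * b) v.
Proof. by apply: val_inj => /=; rewrite scalerA rmorphM. Qed.
Fact herm_scale1 : left_id 1 herm_scale.
Proof. by move=> v; apply: val_inj => /=; rewrite scale1r. Qed.
Fact herm_scaleDr : right_distributive herm_scale +%R.
Proof. by move=> a u v; apply: val_inj => /=; rewrite scalerDr. Qed.
Fact herm_scaleDl v : {morph herm_scale^~ v : a b / a + b}.
Proof. by move=> a b; apply: val_inj => /=; rewrite rmorphD scalerDl. Qed.

HB.instance Definition _ := GRing.Zmodule_isLmodule.Build R herm
  herm_scaleA herm_scale1 herm_scaleDr herm_scaleDl.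

Definition psd : set herm :=
  [set A | forall v : 'cV[R[i]]_n, 0 <= (v^t* *m A *m v) 0 0].

End Hermitian.

Section Complexification.
Variables (R : realType) (X : lmodType R).

(* [X * X] is the complexification of [X]: the pair [(x, y)] is x + i y.    *)
Definition cscale (w : R[i]) (z : X * X) : X * X :=
  (complex.Re w *: z.1 - complex.Im w *: z.2,
   complex.Re w *: z.2 + complex.Im w *: z.1).

Definition cconj (z : X * X) : X * X := (z.1, - z.2).

End Complexification.

Section Tensor.
Variables (R : realType) (X : lmodType R) (s : nat).

(* The tensor product of [X] with Her_s(C) is modelled as the real vector   *)
(* space of Hermitian s x s matrices over the complexification of [X];      *)
(* [tens_universal] below is its universal property.                        *)
Definition tens_pred : pred {ffun 'I_s * 'I_s -> X * X} :=
  [pred a : {ffun 'I_s * 'I_s -> X * X} |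
    [forall i, forall j, a (j, i) == cconj (a (i, j))]].

Record tens := Tens {
  tens_val :> {ffun 'I_s * 'I_s -> X * X} ;
  _ : tens_pred tens_val }.

HB.instance Definition _ := [isSub for tens_val].
HB.instance Definition _ := [Choice of tens by <:].

Lemma tens_predP (a : {ffun 'I_s * 'I_s -> X * X}) :
  reflect (forall i j, a (j, i) = cconj (a (i, j))) (tens_pred a).
Proof.
by apply: (iffP forallP) => [h i j|h i]; [exact/eqP/(forallP (h i))
                                        |apply/forallP => j; apply/eqP].
Qed.

Fact tens_submod_closed : subsemimod_closed tens_pred.
Proof.
split; first split.
- by apply/tens_predP => i j; rewrite !ffunE /cconj /= oppr0.
- move=> a b /tens_predP ha /tens_predP hb; apply/tens_predP => i j.
  by rewrite !ffunE ha hb /cconj /= opprD.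
- move=> r a /tens_predP ha; apply/tens_predP => i j.
  by rewrite !ffunE ha /cconj; congr pair; rewrite /= scalerN.
Qed.

HB.instance Definition _ := GRing.SubChoice_isSubLmodule.Build
  R _ _ tens tens_submod_closed.

End Tensor.

Section PureTensor.
Variables (R : realType) (X : lmodType R) (s : nat).

Fact tens_pure_subproof (x : X) (A : herm R s) :
  tens_pred [ffun p => (complex.Re (A p.1 p.2) *: x, complex.Im (A p.1 p.2) *: x)].
Proof.
apply/tens_predP => i j; rewrite !ffunE /cconj /= -{1 2}(hermP A) !mxE.
by case: (A i j) => a b /=; rewrite scaleNr.
Qed.

Definition tens_pure (x : X) (A : herm R s) : tens X s :=
  Tens (tens_pure_subproof x A).

End PureTensor.

Section Amplification.
Variables (R : realType) (X Y : lmodType R) (s : nat) (phi : {linear X -> Y}).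

Fact amplify_subproof (a : tens X s) :
  tens_pred [ffun p => (phi (a p).1, phi (a p).2)].
Proof.
apply/tens_predP => i j; rewrite !ffunE /cconj /=.
by have /tens_predP -> := valP a; rewrite /= linearN.
Qed.

Definition amplify (a : tens X s) : tens Y s := Tens (amplify_subproof a).

Lemma amplify_pure x A : amplify (tens_pure x A) = tens_pure (phi x) A.
Proof. by apply: val_inj; apply/ffunP => p; rewrite /= !ffunE/= !linearZ. Qed.

End Amplification.

Section Compression.
Variables (R : realType) (X : lmodType R) (s t : nat) (V : 'M[R[i]]_(s, t)).

Let compress_val (a : tens X s) : {ffun 'I_t * 'I_t -> X * X} :=
  [ffun p => \sum_(i < s) \sum_(j < s)
               cscale (Num.conj (V i p.1) * V j p.2) (a (i, j))].

Fact compress_subproof (a : tens X s) : tens_pred (compress_val a).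
Proof.
apply/tens_predP => k l; rewrite !ffunE /= exchange_big /=.
have cconj_sum (I : Type) (r : seq I) (F : I -> X * X) :
    cconj (\sum_(i <- r) F i) = \sum_(i <- r) cconj (F i).
  elim/big_rec2: _ => [|i x y _ <-]; first by rewrite /cconj oppr0.
  by rewrite /cconj /= opprD.
rewrite cconj_sum; apply: eq_bigr => i _; rewrite cconj_sum.
apply: eq_bigr => j _; have /tens_predP -> := valP a.
rewrite mulrC -{1}[V i k]conjCK -rmorphM/=.
case: (Num.conj (V i k) * V j l) (a (i, j)) => u v [x y].
by rewrite /cscale /cconj /= !scaleNr !scalerN !opprK opprD.
Qed.

(* id_X (x) (V^* . V), computed entrywise; see [compress_pure].             *)
Definition compress (a : tens X s) : tens X t := Tens (compress_subproof a).

Fact conj_herm_subproof (A : herm R s) :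
  (V^t* *m A *m V)^t* == V^t* *m A *m V.
Proof. by rewrite !trmx_mul !map_mxM /= hermP trmxCK mulmxA. Qed.

Lemma compress_pure x A :
  compress (tens_pure x A) = tens_pure x (Herm (conj_herm_subproof A)).
Proof.
apply: val_inj; apply/ffunP => -[k l]; rewrite /= !ffunE /=.
pose e (z : R[i]) : X * X := (complex.Re z *: x, complex.Im z *: x).
have e0 : e 0 = 0 by rewrite /e /= !scale0r.
have eD : {morph e : y z / y + z}.
  by move=> [a b] [c d]; rewrite /e /= !scalerDl.
rewrite -[RHS]/(e _) mxE (big_morph e eD e0) exchange_big /=.
apply: eq_bigr => j _; rewrite mxE mulr_suml (big_morph e eD e0).
apply: eq_bigr => i _; rewrite ffunE /= !mxE mulrAC.
case: (_ * V j l) (A i j) => [u v] [a b].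
rewrite /cscale /e /= !scalerA -scalerBl -scalerDl.
by congr (_ *: _, _ *: _); rewrite addrC.
Qed.

End Compression.

Section PureTensorTheory.
Variables (R : realType) (X : lmodType R) (s : nat).

Lemma tens_pureDl (x y : X) (A : herm R s) :
  tens_pure (x + y) A = tens_pure x A + tens_pure y A.
Proof.
by apply: val_inj; apply/ffunP => p; rewrite !ffunE/= !scalerDr.
Qed.

Lemma tens_pureZl (r : R) (x : X) (A : herm R s) :
  tens_pure (r *: x) A = r *: tens_pure x A.
Proof.
apply: val_inj; apply/ffunP => p; rewrite !ffunE/=.
by congr pair; rewrite /= !scalerA mulrC.
Qed.

Lemma tens_pureDr (x : X) (A B : herm R s) :
  tens_pure x (A + B) = tens_pure x A + tens_pure x B.
Proof.
apply: val_inj; apply/ffunP => p; rewrite !ffunE/= mxE.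
by case: (A _ _) (B _ _) => a b [c d]; rewrite /= !scalerDl.
Qed.

Lemma tens_pureZr (r : R) (x : X) (A : herm R s) :
  tens_pure x (r *: A) = r *: tens_pure x A.
Proof.
apply: val_inj; apply/ffunP => p; rewrite !ffunE/= mxE.
case: (A _ _) => a b /=; rewrite !mul0r subr0 addr0.
by congr pair; rewrite /= scalerA.
Qed.

End PureTensorTheory.

(* The Hermitian matrices (E_ij + E_ji) / 2 and i (E_ij - E_ji) / 2.        *)
Section HermitianUnits.
Variables (R : realType) (s : nat).

Let swap_mx (i j : 'I_s) (c d : R[i]) : 'M[R[i]]_s :=
  \matrix_(k, l) (c *+ ((k == i) && (l == j)) + d *+ ((k == j) && (l == i))).

Let swap_herm i j c d : Num.conj c = d -> (swap_mx i j c d)^t* == swap_mx i j c d.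
Proof.
move=> <-; apply/eqP/matrixP => k l; rewrite !mxE rmorphD !rmorphMn /= conjCK.
by rewrite addrC andbC [in X in _ + X]andbC.
Qed.

Let conj_half : Num.conj (2^-1%:C : R[i]) = 2^-1%:C.
Proof. by rewrite conj_Creal// complex_real. Qed.

Let conj_ihalf : Num.conj (Complex 0 2^-1 : R[i]) = Complex 0 (- 2^-1).
Proof. by []. Qed.

Definition re_basis (i j : 'I_s) : herm R s := Herm (swap_herm i j conj_half).
Definition im_basis (i j : 'I_s) : herm R s := Herm (swap_herm i j conj_ihalf).

End HermitianUnits.

Section UniversalProperty.
Variables (R : realType) (s : nat).

Let sum_delta (M : lmodType R) (F : 'I_s -> 'I_s -> M) k l :
  \sum_i \sum_j ((k == i) && (l == j))%:R *: F i j = F k l.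
Proof.
rewrite (bigD1 k)//= (bigD1 l)//= !eqxx scale1r !big1 ?addr0//.
  by move=> i ik; apply: big1 => j _; rewrite eq_sym (negPf ik) scale0r.
by move=> j jl; rewrite eq_sym (negPf jl) andbF scale0r.
Qed.

Lemma tens_decomp (X : lmodType R) (a : tens X s) : a =
  \sum_i \sum_j (tens_pure (a (i, j)).1 (re_basis R i j) +
                 tens_pure (a (i, j)).2 (im_basis R i j)).
Proof.
have half_sum (M : lmodType R) (F : 'I_s -> 'I_s -> M) (r : R) k l :
    \sum_i \sum_j (2^-1 * (((k == i) && (l == j))%:R
      + r * ((k == j) && (l == i))%:R)) *: F i j
    = 2^-1 *: (F k l + r *: F l k).
  rewrite -(sum_delta F k l) -(sum_delta F l k) !scaler_sumr -big_split/=.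
  rewrite scaler_sumr; apply: eq_bigr => i _.
  rewrite !scaler_sumr -big_split scaler_sumr; apply: eq_bigr => j _ /=.
  by rewrite !scalerA -scalerDl scalerA [(k == j) && _]andbC.
have cMn (u v : R) m : Complex u v *+ m = Complex (u *+ m) (v *+ m).
  by elim: m => [|m IHm]; rewrite ?mulr0n// !mulrS IHm.
have reS (b1 b2 : bool) : 2^-1%:C *+ b1 + 2^-1%:C *+ b2 =
    Complex (2^-1 * (b1%:R + 1 * b2%:R)) 0 :> R[i].
  by rewrite !cMn !mul0rn mul1r mulrDr !mulr_natr; apply/eqP;
     rewrite eq_complex /= addr0 !eqxx.
have imT (b1 b2 : bool) : (Complex 0 2^-1) *+ b1 + (Complex 0 (- 2^-1)) *+ b2 =
    Complex 0 (2^-1 * (b1%:R + (-1) * b2%:R)) :> R[i].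
  by rewrite !cMn !mul0rn mulN1r mulrBr !mulr_natr; apply/eqP;
     rewrite eq_complex /= addr0 mulNrn !eqxx.
have half2 (x : X) : 2^-1 *: (x + x) = x.
  by rewrite -mulr2n -scaler_nat scalerA mulVf ?pnatr_eq0// scale1r.
apply: val_inj; apply/ffunP => -[k l]; have /tens_predP ha := valP a.
pose ev (b : tens X s) := b (k, l).
have ev0 : ev 0 = 0 by rewrite /ev ffunE.
have evD : {morph ev : b c / b + c} by move=> b c; rewrite /ev ffunE.
rewrite -[RHS]/(ev _) (big_morph ev evD ev0).
have sum_pair (I : finType) (F G : I -> X) :
    \sum_i (F i, G i) = (\sum_i F i, \sum_i G i) :> X * X.
  by elim/big_rec3: _ => // i x y _ _ ->.
rewrite (eq_bigr (fun i => (
  \sum_j (2^-1 * (((k == i) && (l == j))%:R + 1 * ((k == j) && (l == i))%:R))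
    *: (a (i, j)).1,
  \sum_j (2^-1 * (((k == i) && (l == j))%:R + (-1) * ((k == j) && (l == i))%:R))
    *: (a (i, j)).2))); last first.
  move=> i _; rewrite (big_morph ev evD ev0) -sum_pair.
  apply: eq_bigr => j _; rewrite evD /ev !ffunE /= !mxE reS imT /=.
  by rewrite !scale0r; congr pair; rewrite /= ?addr0 ?add0r.
rewrite sum_pair !half_sum (ha k l) /cconj /= scaleN1r opprK scale1r !half2.
by rewrite -surjective_pairing.
Qed.

Lemma herm_decomp (A : herm R s) : A =
  \sum_i \sum_j (complex.Re (A i j) *: re_basis R i j +
                 complex.Im (A i j) *: im_basis R i j).
Proof.
pose p (B : herm R s) : tens R^o s := tens_pure 1 B.
have p0 : p 0 = 0.
  by rewrite /p -(scale0r (0 : herm R s)) tens_pureZr scale0r.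
have pD : {morph p : B C / B + C} by move=> B C; exact: tens_pureDr.
have p_inj : injective p.
  move=> B C /(congr1 val) /ffunP BC; apply: val_inj; apply/matrixP => k l.
  have := BC (k, l); rewrite /= !ffunE /= /GRing.scale /= !mulr1.
  by case: (B k l) (C k l) => [u v] [x y] [-> ->].
apply: p_inj; rewrite [LHS]tens_decomp (big_morph p pD p0).
apply: eq_bigr => i _; rewrite (big_morph p pD p0); apply: eq_bigr => j _.
rewrite pD /p !tens_pureZr !ffunE /= -!tens_pureZl.
by rewrite /GRing.scale /=.
Qed.

Lemma tens_universal (X Y : lmodType R) (f : X -> herm R s -> Y) :
  (forall x, linear (f x)) -> (forall A, linear (f^~ A)) ->
  exists2 g : {linear tens X s -> Y},
    forall x A, g (tens_pure x A) = f x A &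
    forall h : {linear tens X s -> Y},
      (forall x A, h (tens_pure x A) = f x A) -> h =1 g.
Proof.
move=> fr fl.
pose fl' A := GRing.isLinear.Build R X Y _ (f^~ A) (fl A).
pose FL A : {linear X -> Y} := HB.pack (f^~ A) (fl' A).
pose fr' x := GRing.isLinear.Build R (herm R s) Y _ (f x) (fr x).
pose FR x : {linear herm R s -> Y} := HB.pack (f x) (fr' x).
pose g (a : tens X s) := \sum_i \sum_j
  (f (a (i, j)).1 (re_basis R i j) + f (a (i, j)).2 (im_basis R i j)).
have g_lin : linear g.
  move=> r a b; rewrite /g scaler_sumr -big_split; apply: eq_bigr => i _ /=.
  rewrite scaler_sumr -big_split; apply: eq_bigr => j _ /=.
  by rewrite !ffunE /= (fl (re_basis R i j)) (fl (im_basis R i j)) scalerDr addrACA.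
pose g' := GRing.isLinear.Build R (tens X s) Y _ g g_lin.
pose G : {linear tens X s -> Y} := HB.pack g g'.
have hG (h : {linear tens X s -> Y}) :
    (forall x A, h (tens_pure x A) = f x A) -> h =1 g.
  move=> hf a; rewrite [in LHS](tens_decomp a) /g linear_sum.
  apply: eq_bigr => i _; rewrite linear_sum; apply: eq_bigr => j _.
  by rewrite linearD !hf.
exists G; last exact: hG.
move=> x A; rewrite /= /g.
rewrite -[RHS]/(FR x A) [in RHS](herm_decomp A) linear_sum.
apply: eq_bigr => i _; rewrite linear_sum; apply: eq_bigr => j _.
rewrite linearD !linearZ /= !ffunE /=.
by congr (_ + _); [exact: (linearZ_LR (FL (re_basis R i j)) _ x)|
                   exact: (linearZ_LR (FL (im_basis R i j)) _ x)].
Qed.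

End UniversalProperty.

Section OperatorSystems.
Variable R : realType.

(* Only the levels s >= 1 are meaningful.                                   *)
Definition cone_family (X : lmodType R) := forall s, set (tens X s).

Definition operator_system (X : lmodType R) (S : cone_family X) :=
  (forall s, (0 < s)%N -> proper_cone (S s)) /\
  (forall s t (V : 'M[R[i]]_(s, t)), (0 < s)%N -> (0 < t)%N ->
     forall a, S s a -> S t (compress V a)).

Fact herm1_subproof n : (1%:M : 'M[R[i]]_n)^t* == 1%:M.
Proof. by rewrite trmx1 map_mx1. Qed.

Definition herm1 n : herm R n := Herm (herm1_subproof n).

(* X is identified with its tensor product with Her_1(C) through x (x) 1.   *)
Definition has_base_cone (X : lmodType R) (S : cone_family X) (C : set X) :=
  S 1%N = [set tens_pure x (herm1 1) | x in C].

Definition minimal_operator_system (X : lmodType R) (C : set X)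
    (S : cone_family X) :=
  [/\ operator_system S, has_base_cone S C &
      forall T : cone_family X, operator_system T -> has_base_cone T C ->
        forall s, (0 < s)%N -> S s `<=` T s].

Section Flatten.
Variables d s : nat.

Let flatten_val (a : tens (herm R d) s) : 'M[R[i]]_(d * s) :=
  \matrix_(p, q)
    let (i, k) := mxtens_unindex p in let (j, l) := mxtens_unindex q in
    (a (k, l)).1 i j + Complex 0 1 * (a (k, l)).2 i j.

Fact flatten_subproof a : (flatten_val a)^t* == flatten_val a.
Proof.
apply/eqP/matrixP => p q; rewrite !mxE.
case: (mxtens_unindex p) (mxtens_unindex q) => [i k] [j l].
have /tens_predP -> := valP a; rewrite /= rmorphD rmorphM /=.
rewrite -{2}(hermP (a (k, l)).1) -{2}(hermP (a (k, l)).2) !mxE.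
congr (_ + _); rewrite rmorphN mulrN -mulNr; congr (_ * _).
by apply/eqP; rewrite eq_complex /= oppr0 opprK !eqxx.
Qed.

(* The identification of Her_d (x) Her_s with Her_ds by the Kronecker       *)
(* product, see [flatten_pure].                                             *)
Definition flatten (a : tens (herm R d) s) : herm R (d * s) :=
  Herm (flatten_subproof a).

Lemma flatten_pure (A : herm R d) (B : herm R s) :
  flatten (tens_pure A B) = tensmx A B :> 'M[R[i]]_(d * s).
Proof.
apply/matrixP => p q; rewrite !mxE.
case: (mxtens_unindex p) (mxtens_unindex q) => [i k] [j l].
rewrite !ffunE /= !mxE.
case: (A i j) (B k l) => [u v] [x y].
by apply/eqP; rewrite eq_complex; apply/andP; split; apply/eqP => /=; ring.
Qed.

End Flatten.

Definition psd_system (d : nat) : cone_family (herm R d) :=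
  fun s => [set a | psd (flatten a)].

Definition has_lift (X Y : lmodType R) (S : cone_family X)
    (T : cone_family Y) :=
  exists (Z : lmodType R) (pi : {linear Z -> X}) (gamma : {linear Z -> Y}),
    injective gamma /\
    forall s, (0 < s)%N ->
      S s = [set amplify pi c | c in [set c | T s (amplify gamma c)]].

End OperatorSystems.

Arguments psd_system : clear implicits.

Section Semialgebraic.
Variable R : realType.

(* Coordinate-free: polynomial functions are generated as an algebra by the *)
(* linear functionals.                                                      *)
Inductive polynomial_fun (V : lmodType R) : (V -> R) -> Prop :=
| PolyConst (k : R) : polynomial_fun (fun=> k)
| PolyLin (l : {linear V -> R^o}) : polynomial_fun l
| PolyAdd p q : polynomial_fun p -> polynomial_fun q ->
    polynomial_fun (fun x => p x + q x)
| PolyMul p q : polynomial_fun p -> polynomial_fun q ->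
    polynomial_fun (fun x => p x * q x).

(* The Boolean algebra generated by polynomial inequalities; p >= 0 and     *)
(* p = 0 are obtained by complementation.                                   *)
Inductive semialgebraic (V : lmodType R) : set V -> Prop :=
| SemialgPos p : polynomial_fun p -> semialgebraic [set x | 0 < p x]
| SemialgC A : semialgebraic A -> semialgebraic (~` A)
| SemialgI A B : semialgebraic A -> semialgebraic B -> semialgebraic (A `&` B).

Definition semialgebraic_fun_on (V : lmodType R) (A : set V) (f : A -> R) :=
  semialgebraic
    ([set (val c, f c) | c in [set: A]] : set (V * R^o)%type).

(* When [chi] is not semialgebraic, the semialgebraic functions on [chi]    *)
(* are by convention the restrictions of the ones on the cone [C].          *)
Definition semialgebraic_on_generators (V : lmodType R) (C chi : set V)
    (f : chi -> R) :=
  (semialgebraic chi /\ semialgebraic_fun_on f) \/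
  (~ semialgebraic chi /\
   exists g : C -> R, semialgebraic_fun_on g /\
     forall (c : chi) (c' : C), val c = val c' -> f c = g c').

End Semialgebraic.

Section Span.
Variables (K : pzRingType) (V : lmodType K).

Definition lin_span (F : set V) : set V :=
  [set v | exists n (k : 'I_n -> K) (f : 'I_n -> V),
    (forall i, F (f i)) /\ v = \sum_(i < n) k i *: f i].

Definition has_dim (W : set V) (n : nat) :=
  exists b : 'I_n -> V,
    (forall k : 'I_n -> K, \sum_(i < n) k i *: b i = 0 -> forall i, k i = 0) /\
    W = lin_span (range b).

End Span.

Section Factorization.
Variables (R : realType) (X : lmodType R).

Definition positive_map (C : set X) t (phi : {linear X -> herm R t}) :=
  forall c, C c -> psd (phi c).

Definition eval_mx (T : Type) d t (P : 'M[T -> R[i]^o]_(d, t)) (c : T) :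
  'M[R[i]]_(d, t) := map_mx (fun f => f c) P.

Definition factors_through (C chi : set X) (d : nat)
    (W : set (chi -> R[i]^o)) :=
  forall t, (0 < t)%N -> forall phi : {linear X -> herm R t},
    positive_map C phi ->
    exists m (P : 'I_m -> 'M[chi -> R[i]^o]_(d, t)),
      (forall k i j, W (P k i j)) /\
      forall c : chi, phi (val c) =
        \sum_(k < m) (eval_mx (P k) c)^t* *m eval_mx (P k) c :> 'M[R[i]]_t.

End Factorization.

(* Main.v *)
(** By the bipolar theorem, [C^min_s] consists of the [a] on which every
    functional that is nonnegative on the tensors [c (x) B] ([c] in [C], [B] psd)
    is nonnegative; such functionals are the positive maps [phi : X -> Her_s].

    (i) Given a lift, [phi o pi] is positive at level [t] on the psd part of the
    range of [gamma], so M. Riesz' extension theorem gives Kraus operators [V_k]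
    with [phi (pi z) = sum_k V_k^* gamma z V_k] whenever [gamma z] is psd. The
    Hermitian matrices [B] with [B^2 = gamma z] and [pi z = c] form a real
    algebraic set depending polynomially on [c]; quantifier elimination makes the
    choice of its lexicographically least point of minimal norm semialgebraic, and
    [phi c = sum_k (B V_k)^* (B V_k)]. The [d^2] real entries of [B] span [W].

    (ii) Given [W] with basis [w], put [A c = conj (w c) (w c)^T]; each [phi] is
    [c |-> sum_k M_k^* (A c) M_k]. The lift is [gamma], the inclusion of the span
    [Z] of the [A c], with [pi (A c) = c]. If [a = pi [c0]] lies in [C^min_s], the
    functional [M |-> tr (M c0)] is positive on the annihilator of the kernel of
    [pi] and extends to [M |-> tr (M Y)] with [Y] psd and [Y - c0] in that kernel.
    The extension needs a positive definite element in the annihilator, which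
    exists once [A] is compressed to the support of a suitable psd matrix [Q]. *)

Require Import Defs.
From HB Require Import structures.
From mathcomp Require Import all_boot all_order all_algebra.
From mathcomp Require Import sesquilinear spectral complex mxtens.
From mathcomp Require Import boolp classical_sets functions reals.
From mathcomp Require Import topology normedtype derive.
From mathcomp Require Import qe_rcf ordered_qelim.
From mathcomp Require Import ring lra.

Set Implicit Arguments.
Unset Strict Implicit.
Unset Printing Implicit Defensive.

Import Order.TTheory GRing.Theory Num.Theory numFieldNormedType.Exports.

Local Open Scope classical_set_scope.
Local Open Scope ring_scope.
Local Open Scope complex_scope.
Local Open Scope sesquilinear_scope.

(** * Positive extensions and separation *)

(** Strict feasibility is the obstacle in both directions. A positive functional extends from a
    subspace that majorizes every vector, so the subspace should contain a positive definite matrix,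
    and neither the range of [gamma] nor the annihilator of the kernel of [pi] has to contain one.
    The remedy is the same twice: take a psd element of largest range, compress to its support [P],
    and add the complement [1 - P] to the domain.

    In (i) the root [B] is only asked to be Hermitian. The equation [B^2 = gamma z] already forces
    [gamma z] to be psd, so no inequality enters the polynomial system and its solvability describes
    [C] exactly. The root depends on [c] alone and the Kraus operators on [phi] alone, which is why
    one space [W] serves all [t].

    No finiteness of [X] is assumed: [Z] is finite-dimensional, as it embeds into Hermitian matrices
    or is spanned by finitely many of the [A c], and [pi] is onto because [C] contains an order
    unit. *)

Section PositiveExtension.
Variables (R : realType) (V : lmodType R) (P : set V).
Hypothesis cP : convex_cone P.

Definition positive_graph (G : set (V * R)) :=
  (forall r p q, G p -> G q -> G (r *: p.1 + q.1, r * p.2 + q.2)) /\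
  (forall v a, G (v, a) -> P v -> 0 <= a).

Lemma positive_graph_fun G v a b :
  positive_graph G -> G (v, a) -> G (v, b) -> a = b.
Proof.
move=> [lG pG] Ga Gb; have [P0 _ _] := cP.
have := pG _ _ (lG (-1) _ _ Ga Gb); have := pG _ _ (lG (-1) _ _ Gb Ga) => /=.
rewrite scaleN1r addNr => /(_ P0) h1 /(_ P0) h2; lra.
Qed.

(** The value at [v0] has to lie above the values at all [u] with [v0 - u] in [P] and below those at
    all [u] with [u - v0] in [P]. Majorization by the domain makes both families nonempty, so the
    supremum of the first fits in between. *)
Lemma positive_graph_extend G v0 :
  positive_graph G -> (forall v, exists u a, G (u, a) /\ P (u - v)) ->
  exists2 G', positive_graph G' & G `<=` G' /\ exists s, G' (v0, s).
Proof.
move=> [lG pG] domG; have [P0 PD PZ] := cP.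
have G0 : G (0, 0).
  have [u [a [Ga _]]] := domG 0.
  by have := lG (-1) _ _ Ga Ga; rewrite /= scaleN1r addNr mulN1r addNr.
have GN u a : G (u, a) -> G (- u, - a).
  by move=> Ga; have := lG (-1) _ _ Ga G0; rewrite /= scaleN1r mulN1r !addr0.
pose low := [set a | exists u, G (u, a) /\ P (v0 - u)].
have low0 : low !=set0.
  have [u [a [Ga Pu]]] := domG (- v0); exists (- a), (- u); split; first exact: GN.
  by rewrite opprK addrC; rewrite opprK in Pu.
have lowub u a : G (u, a) -> P (u - v0) -> ubound low a.
  move=> Ga Pu b [w [Gb Pw]].
  have := pG _ _ (lG (-1) _ _ Gb Ga); rewrite /= scaleN1r mulN1r => h.
  suff : 0 <= - b + a by lra.
  by apply: h; have := PD _ _ Pu Pw; congr P; rewrite addrA subrK addrC.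
have [u1 [a1 [Ga1 Pu1]]] := domG v0.
have hs : has_sup low by split => //; exists a1; exact: (lowub u1).
pose s := sup low.
exists [set p | exists u a t, G (u, a) /\ p = (u + t *: v0, a + t * s)]; last first.
  split; last by exists s, 0, 0, 1; rewrite !add0r scale1r mul1r.
  by move=> [u a] Ga; exists u, a, 0; rewrite scale0r mul0r !addr0.
split.
  move=> r _ _ [u [a [t [Ga ->]]]] [w [b [t' [Gb ->]]]] /=.
  exists (r *: u + w), (r * a + b), (r * t + t'); split; first exact: (lG _ _ _ Ga Gb).
  congr pair; last by ring.
  by rewrite scalerDr scalerDl scalerA addrACA.
move=> _ _ [u [a [t [Ga [-> ->]]]]] Pu.
(* After scaling by the inverse of [|t|], the case [t < 0] provides an upper bound of [low] and the
   case [t > 0] an element of [low]. *)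
have [t0|t0|t0] := ltgtP t 0.
- have ti : 0 < (- t)^-1 by rewrite invr_gt0 oppr_gt0.
  have Gu : G ((- t)^-1 *: u, (- t)^-1 * a).
    by have := lG (- t)^-1 _ _ Ga G0; rewrite /= !addr0.
  have : s <= (- t)^-1 * a.
    apply: ge_sup => //; apply: lowub Gu _.
    have := PZ _ _ (ltW ti) Pu; congr P.
    by rewrite scalerDr scalerA invrN mulNr mulVf ?lt_eqF// scaleN1r.
  rewrite mulrC ler_pdivlMr ?oppr_gt0//; lra.
- have ti : 0 < t^-1 by rewrite invr_gt0.
  have Gu : G (- (t^-1 *: u), - (t^-1 * a)).
    by apply: GN; have := lG t^-1 _ _ Ga G0; rewrite /= !addr0.
  have : - (t^-1 * a) <= s.
    apply: ub_le_sup; first by case: hs.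
    exists (- (t^-1 *: u)); split => //.
    have := PZ _ _ (ltW ti) Pu; congr P.
    by rewrite scalerDr scalerA mulVf ?gt_eqF// scale1r opprK addrC.
  rewrite lerNl mulrC ler_pdivlMr//; lra.
- by rewrite t0 mul0r addr0; apply: (pG u) => //; move: Pu; rewrite t0 scale0r addr0.
Qed.

(* M. Riesz' extension theorem, for a functional given by its graph. *)
Lemma positive_extension (G : set (V * R)) :
  positive_graph G -> (forall v, exists u a, G (u, a) /\ P (u - v)) ->
  exists f : {linear V -> R^o},
    (forall v, P v -> 0 <= f v) /\ (forall v a, G (v, a) -> f v = a).
Proof.
move=> gG domG.
(* [G] is joined to every member because the property must also hold for the union of the empty
   chain. *)
pose Q (A : set (V * R)) := positive_graph (A `|` G).
have [A [QA Amax]] : exists A, Q A /\ forall B, A `<` B -> ~ Q B.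
  apply: Zorn_bigcup => F FQ Ftot.
  rewrite /Q; split.
    move=> r p q.
    have cov p' : (\bigcup_(X in F) X `|` G) p' -> G p' \/ exists2 X, F X & X p'.
      by move=> [[X FX Xp]|]; [right; exists X|left].
    have incl X p' : F X -> (X `|` G) p' -> (\bigcup_(X in F) X `|` G) p'.
      by move=> FX [Xp|]; [left; exists X|right].
    move=> /cov[Gp|[X FX Xp]] /cov[Gq|[Y FY Yq]].
    - by right; apply: (gG.1).
    - by apply: (incl Y) => //; apply: (FQ _ FY).1; [right|left].
    - by apply: (incl X) => //; apply: (FQ _ FX).1; [left|right].
    - have [XY|YX] := Ftot _ _ FX FY.
        by apply: (incl Y) => //; apply: (FQ _ FY).1; left => //; exact: XY.
      by apply: (incl X) => //; apply: (FQ _ FX).1; left => //; exact: YX.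
  move=> v a [[X FX Xp]|Gp]; first by apply: (FQ _ FX).2; left.
  exact: gG.2.
have domAG v : exists u a, (A `|` G) (u, a) /\ P (u - v).
  by have [u [a [Ga Pu]]] := domG v; exists u, a; split => //; right.
have tot v : exists a, (A `|` G) (v, a).
  apply: contrapT => nv.
  have [G' gG' [AGG' [s Gs]]] := positive_graph_extend v QA domAG.
  apply: (Amax G').
    split; first by move=> p Ap; apply: AGG'; left.
    by move=> G'A; apply: nv; exists s; left; exact: G'A.
  by rewrite /Q setUidl// => p Gp; apply: AGG'; right.
pose f v : R^o := projT1 (cid (tot v)).
have fP v : (A `|` G) (v, f v) by exact: (projT2 (cid (tot v))).
have f_lin : linear f.
  move=> r u v; apply: (positive_graph_fun QA (fP _)).
  exact: (QA.1 r _ _ (fP u) (fP v)).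
pose F : {linear V -> R^o} := HB.pack f (GRing.isLinear.Build R V R^o _ f f_lin).
exists F; split=> [v Pv|v a Ga]; first exact: (QA.2 v _ (fP v)).
by apply: (positive_graph_fun QA (fP _)); right.
Qed.

End PositiveExtension.

(** * Order units, interior points and separation *)

Section OrderUnits.
Variables (R : realType) (V : lmodType R).

(** For a convex cone, the order units in it are its interior points in the finest locally convex
    topology. The next two lemmas thus trade the topology for an algebraic condition. *)
Definition order_unit (C : set V) (e : V) :=
  forall v, exists2 r : R, 0 < r & C (r *: e + v).

Lemma interior_order_unit (C : set V) (e : V) :
  convex_cone C -> interior (C : set (flc V)) e -> order_unit C e.
Proof.
move=> [C0 CD CZ] /flc_nbhsP[A [_ _ aA] AC] v.
have [r r0 Ar] := aA v; exists r^-1; first by rewrite invr_gt0.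
have ri : 0 <= r^-1 by rewrite invr_ge0 ltW.
have := CZ _ _ ri (AC _ Ar).
by rewrite scalerDr scalerA mulVf ?gt_eqF// scale1r.
Qed.

(** The [v] with both [e + v] and [e - v] in [C] form a convex balanced set, which is absorbing
    since [e] is an order unit. *)
Lemma order_unit_interior (C : set V) (e : V) :
  convex_cone C -> C e -> order_unit C e -> interior (C : set (flc V)) e.
Proof.
move=> [C0 CD CZ] Ce Ce1; apply/flc_nbhsP.
have mix r (x y : V) : 0 <= r -> r <= 1 -> C (e + x) -> C (e + y) ->
    C (e + (r *: x + (1 - r) *: y)).
  move=> r0 r1 Cx Cy; have r1' : 0 <= 1 - r by rewrite subr_ge0.
  have := CD _ _ (CZ _ _ r0 Cx) (CZ _ _ r1' Cy); congr C.
  by rewrite !scalerDr addrACA -scalerDl subrKC scale1r.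
have scl (t : R) v : 0 <= t -> t <= 1 -> C (e + v) -> C (e + t *: v).
  move=> t0 t1 Cv; have := mix t v 0 t0 t1 Cv.
  by rewrite addr0 scaler0 addr0; exact.
exists [set v | C (e + v) /\ C (e - v)]; last by move=> a [].
split.
- apply/convex_setE => r a b r0 r1 [Ca Ca'] [Cb Cb']; split; first exact: mix.
  by rewrite opprD -!scalerN; exact: mix.
- move=> r a r1 [Ca Ca']; have [r0|r0] := leP 0 r.
    rewrite ger0_norm// in r1.
    by split; [|rewrite -scalerN]; exact: scl.
  rewrite ltr0_norm// in r1; have nr0 : 0 <= - r by rewrite oppr_ge0 ltW.
  split; last by rewrite -scaleNr; exact: scl.
  by rewrite -[r]opprK scaleNr -scalerN; exact: scl.
- move=> v; have [r r0 Cr] := Ce1 v; have [s s0 Cs] := Ce1 (- v).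
  have rs0 : 0 < r + s by rewrite addr_gt0.
  have big (t : R) (x : V) : t <= r + s -> C (t *: e + x) -> C (e + (r + s)^-1 *: x).
    move=> tle Ct; have t'0 : 0 <= r + s - t by rewrite subr_ge0.
    have rsi : 0 <= (r + s)^-1 by rewrite invr_ge0 ltW.
    have := CZ _ _ rsi (CD _ _ (CZ _ _ t'0 Ce) Ct).
    rewrite addrA -scalerDl subrK scalerDr scalerA mulVf ?gt_eqF// scale1r.
    exact.
  exists (r + s)^-1; first by rewrite invr_gt0.
  by split; [apply: big Cr; lra|rewrite -scalerN; apply: big Cs; lra].
Qed.

Lemma proper_cone_order_unit (C : set V) :
  proper_cone C -> exists2 e, C e & order_unit C e.
Proof.
move=> [cC _ _ [e Ce]]; exists e; last exact: interior_order_unit.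
exact: (@interior_subset (flc V)).
Qed.

(* Extending [a e |-> a] positively to the cone spanned by [C] and [- y], for
   [y = x + r e] still outside of [C], makes [f x <= - r]. *)
Lemma proper_cone_separation (C : set V) (x : V) : proper_cone C -> ~ C x ->
  exists2 f : {linear V -> R^o}, (forall c, C c -> 0 <= f c) & f x < 0.
Proof.
move=> pC nCx; have [e Ce Ce1] := proper_cone_order_unit pC.
have [[C0 CD CZ] _ cC _] := pC.
have [A [_ _ aA] AC] : exists2 A : set V, flc_base A & forall a, A a -> ~ C (x + a).
  by apply/(@flc_nbhsP R V x (~` C)); apply: open_nbhs_nbhs; split => //; exact: closed_openC.
have [r r0 /AC nCy] := aA e; set y := x + r *: e in nCy.
pose P := [set v | exists c t, [/\ C c, 0 <= t & v = c - t *: y]].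
have cP : convex_cone P.
  split.
  - by exists 0, 0; split=> //; rewrite scale0r subr0.
  - move=> _ _ [c [t [Cc t0 ->]]] [c' [t' [Cc' t'0 ->]]].
    exists (c + c'), (t + t'); split; [exact: CD|exact: addr_ge0|].
    by rewrite scalerDl opprD addrACA.
  - move=> s _ s0 [c [t [Cc t0 ->]]].
    exists (s *: c), (s * t); split; [exact: CZ|exact: mulr_ge0|].
    by rewrite scalerBr scalerA.
have CP c : C c -> P c by move=> Cc; exists c, 0; split=> //; rewrite scale0r subr0.
pose G := [set p : V * R | p.1 = p.2 *: e].
have gG : positive_graph P G.
  split=> [s [u a] [w b]|u a]; rewrite /G /=.
    by move=> -> ->; rewrite scalerDl scalerA.
  move=> -> [c [t [Cc t0 ae]]].
  (* If [a < 0], then [t y = c + (- a) e] lies in [C]. For [t > 0] this puts [y] in [C]. For [t = 0]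
     it puts [- e] in [C], and again [y], because some [s e + y] lies in [C]. *)
  have [//|a0] := leP 0 a; exfalso.
  have ty : t *: y = c + (- a) *: e by rewrite scaleNr ae opprB addrCA subrr addr0.
  have Cty : C (t *: y).
    by rewrite ty; apply: CD => //; apply: CZ => //; rewrite oppr_ge0 ltW.
  have [t0'|t0'] := eqVneq t 0; last first.
    have ti : 0 <= t^-1 by rewrite invr_ge0.
    by apply: nCy; have := CZ _ _ ti Cty; rewrite scalerA mulVf// scale1r.
  have CNe : C (- e).
    have ai : 0 <= (- a)^-1 by rewrite invr_ge0 oppr_ge0 ltW.
    move: ae; rewrite t0' scale0r subr0 => ae.
    have := CZ _ _ ai Cc.
    by rewrite -ae scalerA invrN mulNr mulVf ?lt_eqF// scaleN1r.
  have [s s0 Cs] := Ce1 y; apply: nCy.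
  by have := CD _ _ Cs (CZ _ _ (ltW s0) CNe); rewrite scalerN addrAC subrr add0r.
have [v|f [fP fG]] := positive_extension cP gG.
  have [s s0 Cs] := Ce1 (- v).
  by exists (s *: e), s; split=> //; exact: CP.
exists f; first by move=> c /CP; exact: fP.
have : 0 <= f (- y) by apply: fP; exists 0, 1; split=> //; rewrite scale1r add0r.
have fe : f (r *: e) = r by exact: fG.
rewrite linearN linearD fe.
set z := f x; move: z => z; rewrite oppr_ge0 => h.
by rewrite -(ltrD2r r) add0r (le_lt_trans h).
Qed.

(** Separation puts both [x] and [- x] in [C], which is pointed. *)
Lemma proper_cone_separates_points (C : set V) (x : V) : proper_cone C ->
  (forall f : {linear V -> R^o}, (forall c, C c -> 0 <= f c) -> f x = 0) ->
  x = 0.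
Proof.
move=> pC fx.
have Cx y : (forall f : {linear V -> R^o}, (forall c, C c -> 0 <= f c) -> f y = 0) -> C y.
  move=> fy; apply: contrapT => /(proper_cone_separation pC)[f fC].
  by rewrite fy// ltxx.
have [_ ptC _ _] := pC.
have : (C `&` [set - z | z in C]) x.
  split; first exact: Cx.
  exists (- x); last by rewrite opprK.
  by apply: Cx => f fC; rewrite linearN fx// oppr0.
by rewrite ptC.
Qed.

End OrderUnits.

(** * Independent families and their maximal length *)

Section Independence.
Variables (K : fieldType) (V : lmodType K).

Definition indep n (b : 'I_n -> V) :=
  forall k : 'I_n -> K, \sum_(i < n) k i *: b i = 0 -> forall i, k i = 0.

Lemma indep_leq n N (b : 'I_n -> V) (u : 'I_N -> V) :
  indep b -> (forall i, exists a : 'I_N -> K, b i = \sum_(j < N) a j *: u j) ->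
  (n <= N)%N.
Proof.
move=> ib /choice[a ab]; pose A := \matrix_(i, j) a i j.
suff /eqP <- : row_free A by exact: rank_leq_col.
rewrite -kermx_eq0; apply/eqP/matrixP => i j; rewrite [RHS]mxE.
apply: (ib (kermx A i)).
transitivity (\sum_j (kermx A *m A) i j *: u j); last first.
  by rewrite mulmx_ker big1// => k _; rewrite mxE scale0r.
rewrite (eq_bigr (fun l => \sum_k (kermx A i l * A l k) *: u k)); last first.
  move=> l _; rewrite ab scaler_sumr; apply: eq_bigr => k _.
  by rewrite scalerA [A l k]mxE.
rewrite exchange_big; apply: eq_bigr => k _ /=.
by rewrite mxE scaler_suml.
Qed.

(** The family is drawn from [S] itself, so its members inherit properties such as being psd or
    being a value of a given map. The bound [N] makes the maximal length exist. *)
Lemma maximal_indep (S : set V) N :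
  (forall n (b : 'I_n -> V), (forall i, S (b i)) -> indep b -> (n <= N)%N) ->
  exists n (b : 'I_n -> V), [/\ (n <= N)%N, forall i, S (b i), indep b &
    forall v, S v -> exists k : 'I_n -> K, v = \sum_(i < n) k i *: b i].
Proof.
move=> bnd.
pose p n := `[< exists b : 'I_n -> V, (forall i, S (b i)) /\ indep b >].
have p0 : exists n, p n.
  by exists 0%N; apply/asboolP; exists (fun=> 0); split=> [[]//|k _ []].
have pN n : p n -> (n <= N)%N by move=> /asboolP[b [Sb ib]]; exact: bnd ib.
have [n /asboolP[b [Sb ib]] nmax] := ex_maxnP p0 pN.
exists n, b; split => //; first exact: bnd ib.
move=> v Sv; pose b' (i : 'I_n.+1) := oapp b v (unlift ord_max i).
have b'max : b' ord_max = v by rewrite /b' unlift_none.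
have b'w i : b' (widen_ord (leqnSn n) i) = b i.
  have -> : widen_ord (leqnSn n) i = lift ord_max i.
    by apply: val_inj; rewrite /= /bump leqNgt ltn_ord.
  by rewrite /b' liftK.
have Sb' i : S (b' i) by rewrite /b'; case: unliftP => /=.
have /existsNP[k /not_implyP[kb' /existsNP[i ki]]] : ~ indep b'.
  by move=> ib'; have := nmax n.+1; rewrite ltnn => /(_ _)/negP; apply; [apply/asboolP; exists b'|].
move: kb'; rewrite big_ord_recr /= b'max => kb'.
have kmax : k ord_max != 0.
  apply: contra_notN ki => /eqP k0.
  case: (unliftP ord_max i) => [j ->|->//].
  have -> : lift ord_max j = widen_ord (leqnSn n) j.
    by apply: val_inj; rewrite /= /bump leqNgt ltn_ord.
  apply: (ib (fun j => k (widen_ord (leqnSn n) j))).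
  rewrite k0 scale0r addr0 in kb'; rewrite -[RHS]kb'.
  by apply: eq_bigr => l _; rewrite b'w.
exists (fun j => - (k ord_max)^-1 * k (widen_ord (leqnSn n) j)).
have -> : v = (k ord_max)^-1 *: (k ord_max *: v) by rewrite scalerA mulVf// scale1r.
move/eqP: kb'; rewrite addrC addr_eq0 => /eqP ->.
rewrite scalerN scaler_sumr -sumrN; apply: eq_bigr => l _.
by rewrite b'w scalerA mulNr scaleNr.
Qed.

End Independence.

(** * Hermitian matrices *)

Section QuadraticForm.
Variables (R : realType).
Local Notation C := R[i].

Definition quad n (A : 'M[C]_n) (v : 'cV[C]_n) : C := (v^t* *m A *m v) 0 0.

Lemma quadD n (A B : 'M[C]_n) v : quad (A + B) v = quad A v + quad B v.
Proof. by rewrite /quad mulmxDr mulmxDl mxE. Qed.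

Lemma quadZ n (a : C) (A : 'M[C]_n) v : quad (a *: A) v = a * quad A v.
Proof. by rewrite /quad -scalemxAr -scalemxAl mxE. Qed.

Lemma quadM m n (V : 'M[C]_(n, m)) (A : 'M[C]_n) v :
  quad (V^t* *m A *m V) v = quad A (V *m v).
Proof. by rewrite /quad trmx_mul map_mxM !mulmxA. Qed.

Lemma quadE n (A : 'M[C]_n) v :
  quad A v = \sum_i \sum_j Num.conj (v i 0) * A i j * v j 0.
Proof.
rewrite /quad mxE exchange_big; apply: eq_bigr => j _ /=.
by rewrite mxE mulr_suml; apply: eq_bigr => i _; rewrite !mxE.
Qed.

Lemma quad1_ge0 n (v : 'cV[C]_n) : 0 <= (v^t* *m v) 0 0.
Proof.
by rewrite mxE sumr_ge0// => i _; rewrite !mxE mulrC mul_conjC_ge0.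
Qed.

Lemma quad1_eq0 n (v : 'cV[C]_n) : (v^t* *m v) 0 0 = 0 -> v = 0.
Proof.
rewrite mxE => /eqP; rewrite psumr_eq0; last first.
  by move=> i _; rewrite !mxE mulrC mul_conjC_ge0.
move=> /allP h; apply/matrixP => i j; rewrite ord1 mxE; apply/eqP.
by have := h i (mem_index_enum _); rewrite !mxE mulrC /= mul_conjC_eq0.
Qed.

Lemma psd_cone n : convex_cone (@psd R n).
Proof.
split=> [v|A B hA hB v|r A r0 hA v].
- by rewrite /= mulmx0 mul0mx mxE.
- by have := addr_ge0 (hA v) (hB v); rewrite -quadD.
- rewrite -[X in 0 <= X]/(quad (r%:C *: (A : 'M_n)) v) quadZ.
  by rewrite mulr_ge0 ?ler0c//; exact: hA.
Qed.

Lemma quad_real n (A : herm R n) v : quad A v = (complex.Re (quad A v))%:C.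
Proof.
have : Num.conj (quad A v) = quad A v.
  rewrite !quadE rmorph_sum exchange_big /=; apply: eq_bigr => k _.
  rewrite rmorph_sum; apply: eq_bigr => l _.
  rewrite !rmorphM /= conjCK -{1}[herm_val A]hermP !mxE conjCK; ring.
case: (quad A v) => a b /eqP; rewrite eq_complex /= => /andP[_ /eqP bb].
by apply/eqP; rewrite eq_complex /= eqxx /=; apply/eqP; lra.
Qed.

Fact outer_subproof n (v : 'cV[C]_n) : (v *m v^t*)^t* == v *m v^t*.
Proof. by rewrite trmx_mul map_mxM trmxCK. Qed.

Definition outer n (v : 'cV[C]_n) : herm R n := Herm (outer_subproof v).

Lemma psd_gram m n (A : herm R n) (B : 'M[C]_(m, n)) :
  A = B^t* *m B :> 'M_n -> psd A.
Proof.
move=> AB v; rewrite AB mulmxA -mulmxA.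
by have := quad1_ge0 (B *m v); rewrite trmx_mul map_mxM.
Qed.

Lemma psd_outer n (v : 'cV[C]_n) : psd (outer v).
Proof. by apply: (@psd_gram 1 n _ (v^t*)); rewrite /= trmxCK. Qed.

End QuadraticForm.

Section FunctionalCalculus.
Variables (R : realType) (n : nat) (U : 'M[R[i]]_n).
Hypothesis uU : U \is unitarymx.
Local Notation C := R[i].

(** For fixed [U] this is an algebra map in [E], so identities between functions of one Hermitian
    matrix become pointwise identities of eigenvalues. *)
Definition spec_mx (E : 'I_n -> R) : 'M[C]_n :=
  U^t* *m diag_mx (\row_j (E j)%:C) *m U.

Lemma spec_mxE E : spec_mx E = U^t* *m diag_mx (\row_j (E j)%:C) *m U.
Proof. by []. Qed.

Lemma spec_mxM E F : spec_mx E *m spec_mx F = spec_mx (fun j => E j * F j).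
Proof.
rewrite /spec_mx (_ : \row_j (E j * F j)%:C = \row_j ((\row_j (E j)%:C) 0 j * (\row_j (F j)%:C) 0 j)).
  by rewrite -mulmx_diag !mulmxA -[_ *m U *m U^t*]mulmxA (unitarymxP uU) mulmx1.
by apply/rowP => j; rewrite !mxE rmorphM.
Qed.

Lemma spec_mxD E F : spec_mx E + spec_mx F = spec_mx (fun j => E j + F j).
Proof.
rewrite /spec_mx (_ : \row_j (E j + F j)%:C = \row_j (E j)%:C + \row_j (F j)%:C).
  by rewrite (linearD (@diag_mx C n)) mulmxDr mulmxDl.
by apply/rowP => j; rewrite !mxE rmorphD.
Qed.

Lemma spec_mxZ r E : r%:C *: spec_mx E = spec_mx (fun j => r * E j).
Proof.
rewrite /spec_mx (_ : \row_j (r * E j)%:C = r%:C *: \row_j (E j)%:C).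
  by rewrite (linearZ_LR (@diag_mx C n)) -scalemxAr -scalemxAl.
by apply/rowP => j; rewrite !mxE rmorphM.
Qed.

Lemma spec_mx1 : spec_mx (fun=> 1) = 1%:M.
Proof.
rewrite /spec_mx (_ : \row_j _ = const_mx 1); last by apply/rowP => j; rewrite !mxE.
by rewrite diag_const_mx mulmx1 -invmx_unitary// mulVmx// unitarymx_unit.
Qed.

Lemma spec_mx_herm E : (spec_mx E)^t* == spec_mx E.
Proof.
rewrite /spec_mx !trmx_mul !map_mxM /= trmxCK mulmxA; apply/eqP.
rewrite tr_diag_mx map_diag_mx (_ : _ ^ _ = \row_j (E j)%:C)//.
by apply/rowP => j; rewrite !mxE /=; apply/eqP; rewrite eq_complex /= oppr0 !eqxx.
Qed.

Definition spec_herm E : herm R n := Herm (spec_mx_herm E).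

Lemma spec_sqrt (E : 'I_n -> R) : (forall j, 0 <= E j) ->
  spec_mx (fun j => Num.sqrt (E j)) *m spec_mx (fun j => Num.sqrt (E j)) = spec_mx E.
Proof.
move=> E0; rewrite spec_mxM; congr spec_mx; apply/funext => j.
by rewrite -expr2 sqr_sqrtr.
Qed.

Lemma psd_spec E : (forall j, 0 <= E j) -> psd (spec_herm E).
Proof.
move=> E0; apply: (@psd_gram _ _ _ _ (spec_mx (fun j => Num.sqrt (E j)))).
by rewrite (eqP (spec_mx_herm _)) spec_sqrt.
Qed.

End FunctionalCalculus.

Opaque spec_mx.

Section Spectral.
Variables (R : realType) (n : nat).
Local Notation C := R[i].

(** The eigenvalues of a normal matrix are a priori complex. Here each is the value of the quadratic
    form of [A] at an eigenvector [v j], hence real, and nonnegative when [A] is psd. *)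
Lemma herm_spectral (A : herm R n) : exists (U : 'M[C]_n) (D : 'I_n -> R),
  [/\ U \is unitarymx, A = spec_mx U D :> 'M_n &
      psd A -> forall j, 0 <= D j].
Proof.
have nA : (A : 'M[C]_n) \is normalmx by apply/normalmxP; rewrite hermP.
have /orthomx_spectralP := nA.
set U := spectralmx A; set d := spectral_diag A.
have uU : U \is unitarymx := spectral_unitarymx A.
rewrite invmx_unitary// => AE.
pose v j : 'cV[C]_n := U^t* *m delta_mx j 0.
have dq j : d 0 j = quad A (v j).
  rewrite AE quadM /v mulmxA (unitarymxP uU) mul1mx quadE.
  rewrite (bigD1 j)//= (bigD1 j)//= !mxE !eqxx /= !mulr1n rmorph1 mul1r mulr1.
  rewrite !big1 ?addr0// => i /negPf ij.
    by apply: big1 => k _; rewrite !mxE ij /= rmorph0 !mul0r.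
  by rewrite !mxE ij /= mulr0.
have dR j : (complex.Re (d 0 j))%:C = d 0 j by rewrite dq -quad_real.
exists U, (fun j => complex.Re (d 0 j)); split=> //.
  rewrite {1}AE spec_mxE (_ : \row_j _ = d)//.
  by apply/rowP => j; rewrite mxE dR.
by move=> pA j; rewrite -ler0c dR dq; exact: pA.
Qed.

Lemma psd_sqrt (A : herm R n) : psd A ->
  exists B : herm R n, B *m B = A :> 'M_n.
Proof.
move=> pA; have [U [D [uU AE D0]]] := herm_spectral A.
exists (spec_herm U (fun j => Num.sqrt (D j))).
by rewrite /= spec_sqrt//; exact: D0.
Qed.

Lemma gram_outer m (B : 'M[C]_(n, m)) : B *m B^t* = \sum_j outer (col j B) :> 'M_n.
Proof.
have -> : (\sum_j outer (col j B) : herm R n) = \sum_j (outer (col j B) : 'M_n) :> 'M_n.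
  by elim/big_rec2: _ => // i x y _ <-.
apply/matrixP => k l; rewrite summxE !mxE; apply: eq_bigr => j _.
by rewrite !mxE big_ord1 !mxE.
Qed.

Lemma psd_sum_outer (A : herm R n) : psd A ->
  exists b : 'I_n -> 'cV[C]_n, A = \sum_j outer (b j).
Proof.
move=> /psd_sqrt[B BA]; exists (fun j => col j B); apply: val_inj.
by transitivity ((B : 'M_n) *m B^t*); [rewrite hermP BA|exact: gram_outer].
Qed.

Lemma psd_order_unit : order_unit (@psd R n) (herm1 R n).
Proof.
move=> A; have [U [D [uU AE _]]] := herm_spectral A.
exists (1 + \sum_j `|D j|); first by rewrite ltr_pwDl// sumr_ge0.
set r := 1 + _.
have -> : r *: herm1 R n + A = spec_herm U (fun j => r * 1 + D j).
  by apply: val_inj; rewrite /= AE -(spec_mx1 uU) spec_mxZ spec_mxD.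
apply: (psd_spec uU) => j; rewrite mulr1 /r (bigD1 j)//= -addrA.
have h0 : 0 <= \sum_(i < n | i != j) `|D i| by rewrite sumr_ge0.
have := ler_norm (- D j); rewrite normrN; lra.
Qed.

(* [P] is the projection onto the range of [Q]. *)
Lemma psd_support (Q : herm R n) : psd Q -> exists P : herm R n,
  [/\ P *m P = P :> 'M_n, P *m Q = Q :> 'M_n,
      exists2 e : R, 0 < e & psd (Q + (herm1 R n - P) - e *: herm1 R n) &
      forall m (M : 'M[C]_(n, m)),
        (forall v : 'cV_n, Q *m v = 0 -> M^t* *m v = 0) -> P *m M = M].
Proof.
move=> pQ; have [U [D [uU QE /(_ pQ) D0]]] := herm_spectral Q.
pose p j : R := (D j != 0)%:R.
exists (spec_herm U p).
have pp : (fun j => p j * p j) = p.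
  by apply/funext => j; rewrite /p; case: eqP => _ /=; rewrite ?mul0r ?mul1r.
have pD : (fun j => p j * D j) = D.
  by apply/funext => j; rewrite /p; case: eqP => [->|_]; rewrite /= ?mul0r ?mul1r.
split.
- rewrite [LHS](spec_mxM uU) pp; reflexivity.
- rewrite QE [LHS](spec_mxM uU) pD; reflexivity.
- pose E j := D j + (1 - p j).
  have E0 j : 0 < E j.
    rewrite /E /p; case: eqP => /= [->|/eqP Dj]; first by rewrite subr0 add0r.
    by rewrite subrr addr0 lt_def Dj D0.
  (* A positive number below every eigenvalue [E j] of [Q + (1 - P)], since each [(E j)^-1] is at
     most [e^-1]; the summand 1 covers [n = 0]. *)
  pose e := (1 + \sum_j (E j)^-1)^-1.
  have s0 : 0 < 1 + \sum_j (E j)^-1.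
    by rewrite ltr_pwDl// sumr_ge0// => j _; rewrite invr_ge0 ltW.
  exists e; first by rewrite invr_gt0.
  have -> : Q + (herm1 R n - spec_herm U p) - e *: herm1 R n =
      spec_herm U (fun j => D j + (1 + -1 * p j) + - e * 1).
    apply: val_inj; rewrite /= QE -(spec_mx1 uU).
    rewrite -scaleNr -[- (e%:C)]rmorphN spec_mxZ -[- spec_mx U p]scaleN1r.
    have -> : -1 = (-1)%:C :> C by rewrite rmorphN1.
    rewrite spec_mxZ !spec_mxD; reflexivity.
  apply: (psd_spec uU) => j; rewrite mulr1 mulN1r -[D j + _]/(E j) subr_ge0.
  rewrite /e invf_ple ?posrE// (bigD1 j)//= addrCA lerDl addr_ge0//.
  by rewrite sumr_ge0// => i _; rewrite invr_ge0 ltW.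
- move=> m M QM.
  (* [N] is the projection [1 - P] onto the kernel of [Q]; the hypothesis on [M] yields
     [N M = 0]. *)
  pose N := spec_mx U (fun j => 1 + -1 * p j).
  have PN : spec_mx U p + N = 1%:M.
    rewrite /N spec_mxD -(spec_mx1 uU); congr spec_mx.
    by apply/funext => j; rewrite mulN1r addrC subrK.
  have QN : Q *m N = 0.
    rewrite QE (spec_mxM uU) (_ : (fun j => _) = (fun j => 0 * 1)).
      by rewrite -spec_mxZ scale0r.
    apply/funext => j; rewrite mul0r /p; case: eqP => [->|_] /=; first by rewrite mul0r.
    by rewrite mulN1r subrr mulr0.
  have NM : M^t* *m N = 0.
    apply/matrixP => i j; rewrite [RHS]mxE.
    have := QM (N *m delta_mx j (0 : 'I_1)).
    rewrite mulmxA QN mul0mx => /(_ erefl) /matrixP/(_ i 0).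
    by rewrite mulmxA -colE !mxE.
  have NM' : N *m M = 0.
    rewrite -[N]trmxCK -[M]trmxCK -map_mxM -trmx_mul.
    by rewrite (eqP (spec_mx_herm _ _)) NM trmx0 map_mx0.
  by rewrite -[RHS]mul1mx -PN mulmxDl NM' addr0.
Qed.

End Spectral.

(** * Pairings and tensors *)

Lemma psd_herm1 (R : realType) n : psd (herm1 R n).
Proof. by apply: (@psd_gram _ n n _ 1%:M); rewrite trmx1 map_mx1 mulmx1. Qed.

Section Pairing.
Variables (R : realType) (n : nat).
Local Notation C := R[i].
Implicit Types A B M N : herm R n.

(* The transpose in [tr (A B^T)] makes [hpair] compatible with the Kronecker
   product and with the entrywise description of tensors. *)
Definition hpair A B : R := \sum_i \sum_j complex.Re (A i j * B i j).

Lemma hpairC A B : hpair A B = hpair B A.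
Proof. by apply: eq_bigr => i _; apply: eq_bigr => j _; rewrite mulrC. Qed.

Lemma hpair_linear A : linear (hpair A : herm R n -> R^o).
Proof.
move=> r M N; rewrite /hpair scaler_sumr -big_split; apply: eq_bigr => i _ /=.
rewrite scaler_sumr -big_split; apply: eq_bigr => j _ /=; rewrite !mxE.
case: (A i j) (M i j) (N i j) => a b [c d] [e f] /=.
by rewrite /GRing.scale /=; ring.
Qed.

HB.instance Definition _ A :=
  GRing.isLinear.Build R (herm R n) R^o _ (hpair A) (hpair_linear A).

Lemma psdP A : psd A <-> forall v, 0 <= complex.Re (quad A v).
Proof.
split=> [pA v|pA v]; first by rewrite -ler0c -quad_real; exact: pA.
by rewrite -[X in 0 <= X]/(quad A v) quad_real ler0c.
Qed.

Lemma hpair_outer A v : hpair A (outer (map_mx Num.conj v)) = complex.Re (quad A v).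
Proof.
rewrite quadE raddf_sum; apply: eq_bigr => i _; rewrite raddf_sum.
apply: eq_bigr => j _; rewrite !mxE big_ord1 !mxE conjCK; congr complex.Re.
by ring.
Qed.

(** Self-duality of the psd cone: psd matrices are sums of outer products, and pairing [A] with an
    outer product evaluates its quadratic form at a conjugate vector. *)
Lemma psd_hpairP A : psd A <-> forall B, psd B -> 0 <= hpair A B.
Proof.
split=> [/psdP pA B /psd_sum_outer[b ->]|pA].
  rewrite linear_sum sumr_ge0// => j _.
  have -> : b j = map_mx Num.conj (map_mx Num.conj (b j)).
    by apply/matrixP => k l; rewrite !mxE conjCK.
  by rewrite /= hpair_outer.
by apply/psdP => v; rewrite -hpair_outer; apply: pA; exact: psd_outer.
Qed.

Fact htr_subproof A : (A : 'M[C]_n)^T^t* == (A : 'M[C]_n)^T.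
Proof. by apply/eqP; rewrite -{2}[herm_val A]hermP; apply/matrixP => i j; rewrite !mxE. Qed.

Definition htr A : herm R n := Herm (htr_subproof A).

Lemma htrK : involutive htr.
Proof. by move=> A; apply: val_inj; rewrite /= trmxK. Qed.

(** [hpair A (htr A)] is the squared Frobenius norm of [A]. *)
Lemma hpair_self_htr_eq0 A : hpair A (htr A) = 0 -> A = 0.
Proof.
have sq i j : complex.Re (A i j * htr A i j) =
    complex.Re (A i j) ^+ 2 + complex.Im (A i j) ^+ 2.
  have -> : htr A i j = Num.conj (A i j) by rewrite /= mxE -{1}[herm_val A]hermP !mxE.
  by case: (A i j) => a b /=; ring.
have sq0 i j : 0 <= complex.Re (A i j * htr A i j).
  by rewrite sq addr_ge0 ?sqr_ge0.
move=> /eqP; rewrite /hpair psumr_eq0 => [/allP h|i _]; last exact: sumr_ge0.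
apply: val_inj; apply/matrixP => i j; rewrite [RHS]mxE.
have := h i (mem_index_enum _); rewrite /= psumr_eq0// => /allP/(_ j (mem_index_enum _)).
rewrite /= sq paddr_eq0 ?sqr_ge0// !sqrf_eq0.
by case: (A i j) => a b /= /andP[/eqP -> /eqP ->].
Qed.

Lemma hpair_nondegenerate A : (forall B, psd B -> hpair A B = 0) -> A = 0.
Proof.
move=> A0.
have A0' B : hpair A B = 0.
  have [r r0 pB] := psd_order_unit B.
  by have := A0 _ pB; rewrite linearD linearZ /= (A0 _ (@psd_herm1 R n)) scaler0 add0r.
exact/hpair_self_htr_eq0/A0'.
Qed.

Lemma hpair_riesz (G : {linear herm R n -> R^o}) :
  exists N, forall M, G M = hpair M N.
Proof.
(* The sign compensates for the product of imaginary parts being subtracted in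
   [Re (M i j * N i j)]. *)
pose N := \matrix_(i, j) Complex (G (re_basis R i j)) (- G (im_basis R i j)).
have reC (i j : 'I_n) : re_basis R i j = re_basis R j i.
  by apply: val_inj; apply/matrixP => k l; rewrite !mxE addrC.
have imC (i j : 'I_n) : im_basis R i j = - im_basis R j i.
  apply: val_inj; apply/matrixP => k l; rewrite !mxE.
  have -> : Complex 0 (- 2^-1) = - Complex 0 2^-1 :> C.
    by apply/eqP; rewrite eq_complex /= oppr0 ?eqxx.
  by rewrite opprD !mulNrn opprK addrC.
have hN : N^t* == N.
  apply/eqP/matrixP => i j; rewrite !mxE; apply/eqP; rewrite eq_complex /=.
  by apply/andP; split; apply/eqP; [rewrite reC|rewrite (imC i j) (linearN G)].
exists (Herm hN) => M; rewrite [in LHS](herm_decomp M) linear_sum.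
apply: eq_bigr => i _; rewrite linear_sum; apply: eq_bigr => j _.
rewrite linearD !linearZ /= mxE /GRing.scale /=.
by case: (M i j) => a b /=; ring.
Qed.

Lemma positive_functional_quad (G : {linear herm R n -> R^o}) :
  (forall M, psd M -> 0 <= G M) ->
  exists y : 'I_n -> 'cV[C]_n, forall M, G M = \sum_k complex.Re (quad M (y k)).
Proof.
move=> G0; have [N GN] := hpair_riesz G.
have /psd_sum_outer[b Nb] : psd N.
  by apply/psd_hpairP => B pB; rewrite hpairC -GN; exact: G0.
exists (fun k => map_mx Num.conj (b k)) => M; rewrite GN Nb linear_sum.
apply: eq_bigr => k _; rewrite -hpair_outer; congr (hpair _ (outer _)).
by apply/matrixP => i j; rewrite !mxE conjCK.
Qed.

End Pairing.

Section TensorMaps.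
Variables (R : realType).
Implicit Types X Y : lmodType R.

Lemma tens_ext X (Y : lmodType R) s (f g : {linear tens X s -> Y}) :
  (forall x A, f (tens_pure x A) = g (tens_pure x A)) -> f =1 g.
Proof.
move=> fg a; rewrite (tens_decomp a) !linear_sum; apply: eq_bigr => i _.
by rewrite !linear_sum; apply: eq_bigr => j _; rewrite !linearD !fg.
Qed.

Lemma amplify_linear X Y s (phi : {linear X -> Y}) :
  linear (@amplify R X Y s phi).
Proof.
move=> r a b; apply: val_inj; apply/ffunP => p; rewrite !ffunE /=.
by congr pair; rewrite /= linearP.
Qed.

HB.instance Definition _ X Y s (phi : {linear X -> Y}) :=
  GRing.isLinear.Build R (tens X s) (tens Y s) _ (amplify phi) (amplify_linear phi).

Lemma compress_linear X s t (V : 'M[R[i]]_(s, t)) :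
  linear (@compress R X s t V).
Proof.
move=> r a b; apply: val_inj; apply/ffunP => p; rewrite !ffunE /=.
rewrite scaler_sumr -big_split; apply: eq_bigr => i _ /=.
rewrite scaler_sumr -big_split; apply: eq_bigr => j _ /=.
rewrite !ffunE /cscale; case: (_ * _) => u v.
congr pair; rewrite /= !scalerDr.
  by rewrite opprD addrACA scalerN !scalerA ![_ * r]mulrC.
by rewrite addrACA !scalerA ![_ * r]mulrC.
Qed.

HB.instance Definition _ X s t (V : 'M[R[i]]_(s, t)) :=
  GRing.isLinear.Build R (tens X s) (tens X t) _ (compress V) (compress_linear V).

Lemma flatten_linear d s : linear (@Defs.flatten R d s).
Proof.
move=> r a b; apply: val_inj; apply/matrixP => p q; rewrite !mxE.
case: (mxtens_unindex p) (mxtens_unindex q) => [i k] [j l].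
rewrite !ffunE /= !mxE.
case: ((a (k, l)).1 i j) ((a (k, l)).2 i j) => [u v] [x y].
case: ((b (k, l)).1 i j) ((b (k, l)).2 i j) => [u' v'] [x' y'].
by apply/eqP; rewrite eq_complex; apply/andP; split; apply/eqP => /=; ring.
Qed.

HB.instance Definition _ d s :=
  GRing.isLinear.Build R (tens (herm R d) s) (herm R (d * s)) _
    (@Defs.flatten R d s) (@flatten_linear d s).

(** The bilinear extension of [hpair B (phi c)] from pure tensors. Each summand is the real part of
    the [(i, j)] entry of [phi], extended complex-linearly and applied to the entry [a (i, j)]. *)
Definition tens_pair X s (phi : {linear X -> herm R s}) (a : tens X s) : R^o :=
  \sum_i \sum_j (complex.Re (phi (a (i, j)).1 i j) -
                 complex.Im (phi (a (i, j)).2 i j)).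

Lemma tens_pair_linear X s (phi : {linear X -> herm R s}) : linear (tens_pair phi).
Proof.
move=> r a b; rewrite /tens_pair scaler_sumr -big_split; apply: eq_bigr => i _ /=.
rewrite scaler_sumr -big_split; apply: eq_bigr => j _ /=.
rewrite !ffunE /= !linearP /= !mxE.
case: (phi (a (i, j)).1 i j) (phi (a (i, j)).2 i j) => [u v] [x y].
case: (phi (b (i, j)).1 i j) (phi (b (i, j)).2 i j) => [u' v'] [x' y'].
by rewrite /GRing.scale /=; ring.
Qed.

HB.instance Definition _ X s (phi : {linear X -> herm R s}) :=
  GRing.isLinear.Build R (tens X s) R^o _ (tens_pair phi) (tens_pair_linear phi).

Lemma tens_pair_pure X s (phi : {linear X -> herm R s}) x A :
  tens_pair phi (tens_pure x A) = hpair A (phi x).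
Proof.
apply: eq_bigr => i _; apply: eq_bigr => j _; rewrite !ffunE /= !linearZ /= !mxE.
case: (A i j) (phi x i j) => [u v] [z y] /=; ring.
Qed.

(** For fixed [x], the functional [F (x (x) A)] of [A] has a representing matrix; its uniqueness
    makes it linear in [x]. *)
Lemma tens_pair_riesz X s (F : {linear tens X s -> R^o}) :
  exists phi : {linear X -> herm R s}, F =1 tens_pair phi.
Proof.
have Fl x : linear (fun A => F (tens_pure x A) : R^o).
  by move=> r A B; rewrite tens_pureDr tens_pureZr linearP.
pose L x : {linear herm R s -> R^o} :=
  HB.pack (fun A => F (tens_pure x A) : R^o) (GRing.isLinear.Build R (herm R s) R^o _ _ (Fl x)).
have /choice[p pE] : forall x, exists N, forall M, L x M = hpair M N.
  by move=> x; exact: hpair_riesz.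
have p_lin : linear p.
  move=> r x y; apply/eqP; rewrite -subr_eq0; apply/eqP.
  apply: hpair_nondegenerate => B _; rewrite hpairC linearB linearP /= -!pE /=.
  by rewrite tens_pureDl tens_pureZl linearP subrr.
pose phi : {linear X -> herm R s} := HB.pack p (GRing.isLinear.Build R X (herm R s) _ p p_lin).
by exists phi; apply: tens_ext => x A; rewrite /= tens_pair_pure; exact: (pE x A).
Qed.

End TensorMaps.

(** * Minimal operator systems as bipolars *)

Section ScaleMap.
Variables (R : realType) (X V : lmodType R) (f : {linear X -> R^o}) (v : V).

(** With [f] nonnegative on [C] and [v] psd this is a positive map; in this way scalar functionals
    are tested through positive maps. *)
Definition scale_map (x : X) : V := f x *: v.

Lemma scale_map_linear : linear scale_map.
Proof. by move=> r x y; rewrite /scale_map linearP scalerDl scalerA. Qed.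

HB.instance Definition _ :=
  GRing.isLinear.Build R X V _ scale_map scale_map_linear.

End ScaleMap.

Lemma tens1E (R : realType) (Y : lmodType R) (a : tens Y 1) : a = tens_pure (a (0, 0)).1 (herm1 R 1).
Proof.
apply: val_inj; apply/ffunP => -[i j]; rewrite !ord1 !ffunE /= mxE eqxx /=.
have /tens_predP/(_ 0 0) := valP a.
case: (a (0, 0)) => x y /= [] yN; rewrite scale1r scale0r; congr pair.
have : (2 : R) *: y = 0 by rewrite scaler_nat mulr2n {1}yN addNr.
by move/eqP; rewrite scaler_eq0 pnatr_eq0 /= => /eqP.
Qed.

Section Bipolar.
Variables (R : realType) (X : lmodType R).

Definition bipolar (C : set X) : cone_family X := fun s =>
  [set a | forall phi : {linear X -> herm R s}, positive_map C phi ->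
     0 <= tens_pair phi a].

Variable C : set X.
Hypothesis pC : proper_cone C.

Lemma bipolar_pure s c (B : herm R s) : C c -> psd B -> bipolar C (tens_pure c B).
Proof.
move=> Cc pB phi pphi; rewrite tens_pair_pure; apply: (psd_hpairP B).1; [exact: pB|exact: pphi].
Qed.

(** Since every functional is some [tens_pair phi], nonnegativity on the pure tensors says that
    [phi] is positive, by self-duality of the psd cone. *)
Lemma bipolar_ge0 s (F : {linear tens X s -> R^o}) (a : tens X s) :
  (forall c B, C c -> psd B -> 0 <= F (tens_pure c B)) -> bipolar C a -> 0 <= F a.
Proof.
have [phi Fphi] := tens_pair_riesz F => F0 Ta.
rewrite Fphi; apply: Ta => c Cc; apply/psd_hpairP => B pB.
by have := F0 c B Cc pB; rewrite Fphi /= tens_pair_pure hpairC.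
Qed.

Lemma bipolar_cone s : convex_cone (@bipolar C s).
Proof.
split=> [phi _|a b Ta Tb phi pphi|r a r0 Ta phi pphi]; first by rewrite linear0.
  by rewrite linearD addr_ge0//; [exact: Ta|exact: Tb].
by rewrite linearZ /= mulr_ge0//; exact: Ta.
Qed.

Lemma bipolar_order_unit s e : C e -> order_unit C e ->
  order_unit (@bipolar C s) (tens_pure e (herm1 R s)).
Proof.
move=> Ce Ce1; set u := tens_pure e _; have [T0 TD TZ] := bipolar_cone s.
have Tu : bipolar C u by apply: bipolar_pure => //; exact: psd_herm1.
pose Pr (a : tens X s) := exists2 r : R, 0 < r & bipolar C (r *: u + a).
have Pr0 : Pr 0 by exists 1; rewrite // addr0 scale1r.
have PrD a b : Pr a -> Pr b -> Pr (a + b).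
  move=> [r r0 Ta] [r' r'0 Tb]; exists (r + r'); first exact: addr_gt0.
  by rewrite scalerDl addrACA; exact: TD.
have both (V : lmodType R) (D : set V) (w v : V) : convex_cone D -> D w ->
    order_unit D w -> exists2 r, 0 < r & D (r *: w + v) /\ D (r *: w - v).
  move=> [D0 DD DZ] Dw Dw1; have [r r0 Dv] := Dw1 v; have [r' r'0 Dv'] := Dw1 (- v).
  exists (r + r'); first exact: addr_gt0.
  split; first by rewrite scalerDl addrAC; apply: DD => //; exact/DZ/Dw/ltW.
  by rewrite scalerDl -addrA; apply: DD => //; exact/DZ/Dw/ltW.
have Prpure x B : Pr (tens_pure x B).
  have [cC _ _ _] := pC.
  have [r r0 [Cx Cx']] := both _ _ _ x cC Ce Ce1.
  have [t t0 [pB pB']] := both _ _ _ B (psd_cone R s) (@psd_herm1 R s) (@psd_order_unit R s).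
  exists (r * t); first exact: mulr_gt0.
  have h0 : 0 <= 2^-1 :> R by rewrite invr_ge0.
  (* The sum of [(r e + x) (x) (t + B)] and [(r e - x) (x) (t - B)] is twice [r t u + x (x) B]. *)
  have := TZ _ _ h0 (TD _ _ (bipolar_pure Cx pB) (bipolar_pure Cx' pB')).
  congr bipolar.
  rewrite 2!tens_pureDl !tens_pureDr.
  have nl y M : tens_pure (- y) M = - tens_pure y M :> tens X s.
    by rewrite -scaleN1r tens_pureZl scaleN1r.
  have nr y M : tens_pure y (- M) = - tens_pure y M :> tens X s.
    by rewrite -scaleN1r tens_pureZr scaleN1r.
  rewrite !nl !nr !tens_pureZl !tens_pureZr -/u opprK.
  set p := r *: (t *: u); set q := r *: tens_pure e B; set l := t *: tens_pure x _.
  set z := tens_pure x B.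
  have -> : p + q + (l + z) + (p - q + (- l + z)) = 2 *: (p + z).
    rewrite addrACA [p + q + _]addrACA subrr addr0 [l + z + _]addrACA subrr add0r.
    by rewrite addrACA scaler_nat mulr2n.
  by rewrite scalerA mulVf ?pnatr_eq0// scale1r /p scalerA.
move=> a; rewrite -/(Pr a) (tens_decomp a).
elim/big_ind: _ => // i _; elim/big_ind: _ => // j _.
by apply: PrD; exact: Prpure.
Qed.

(** For [f] nonnegative on [C], the maps [scale_map f B] with [B] psd show that the matrix obtained
    by applying [f] to the entries of [a] pairs to 0 with all psd [B]. So [f] kills the entries, and
    such [f] separate points. *)
Lemma bipolar_pointed s : pointed_cone (@bipolar C s).
Proof.
apply/seteqP; split=> [a [Ta [b Tb ba]]|a ->]; last first.
  have [T0 _ _] := bipolar_cone s.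
  by split=> //; exists 0; rewrite ?oppr0.
have a0 (phi : {linear X -> herm R s}) : positive_map C phi -> tens_pair phi a = 0.
  move=> pphi; apply/eqP; rewrite eq_le (Ta phi pphi) andbT.
  by rewrite -ba linearN oppr_le0 (Tb phi pphi).
have fa (f : {linear X -> R^o}) : (forall c, C c -> 0 <= f c) ->
    forall i j, f (a (i, j)).1 = 0 /\ f (a (i, j)).2 = 0.
  move=> f0; pose N := \matrix_(i, j) Complex (f (a (i, j)).1) (f (a (i, j)).2).
  have hN : N^t* == N.
    apply/eqP/matrixP => i j; rewrite !mxE.
    by have /tens_predP/(_ i j) -> := valP a; apply/eqP; rewrite eq_complex /= linearN opprK !eqxx.
  suff N0 : Herm hN = 0.
    move=> i j; have /(congr1 (fun M : herm R s => (M : 'M_s) i j)) := N0.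
    by rewrite /= !mxE => -[-> ->].
  apply: hpair_nondegenerate => B pB.
  transitivity (tens_pair (scale_map f B) a); last first.
    by apply: a0 => c Cc; have [_ _ h] := psd_cone R s; apply: h => //; exact: f0.
  apply: eq_bigr => i _; apply: eq_bigr => j _; rewrite /= !mxE.
  by case: (B i j) => u v /=; rewrite !mul0r !subr0 !addr0.
apply: val_inj; apply/ffunP => -[i j]; rewrite ffunE /=.
rewrite [LHS]surjective_pairing; congr pair.
  by apply: (proper_cone_separates_points pC) => f /fa/(_ i j)[].
by apply: (proper_cone_separates_points pC) => f /fa/(_ i j)[].
Qed.

(** Closedness holds because the cone is an intersection of half-spaces and every functional is
    continuous in the finest locally convex topology. Stability under compression is checked on pure
    tensors. *)
Lemma bipolar_operator_system : operator_system (bipolar C).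
Proof.
have [e Ce Ce1] := proper_cone_order_unit pC.
split=> [s _|s t V _ _ a Ta phi pphi]; last first.
  have := @bipolar_ge0 s (tens_pair phi \o compress V) a; apply=> // c B Cc pB.
  rewrite /= compress_pure tens_pair_pure; apply: (psd_hpairP _).1; last exact: pphi.
  by move=> v; rewrite -[X in 0 <= X]/(quad _ v) /= quadM; exact: pB.
split; [exact: bipolar_cone|exact: bipolar_pointed| |].
  have -> : @bipolar C s = \bigcap_(phi in [set phi : {linear X -> herm R s} | positive_map C phi])
      ((tens_pair phi : flc (tens X s) -> R^o) @^-1` [set x | 0 <= x]).
    by apply/seteqP; split.
  apply: closed_bigI => phi _; apply: preimage_closed; last exact: closed_ge.
  by move=> x _; exact: (@flc_finest R (tens X s) R^o (tens_pair phi)).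
exists (tens_pure e (herm1 R s)); apply: order_unit_interior.
- exact: bipolar_cone.
- by apply: bipolar_pure => //; exact: psd_herm1.
- exact: bipolar_order_unit.
Qed.

Lemma bipolar_base : has_base_cone (bipolar C) C.
Proof.
apply/seteqP; split=> [a Ta|_ [c Cc <-]]; last first.
  by apply: bipolar_pure => //; exact: psd_herm1.
exists (a (0, 0)).1; last by rewrite -tens1E.
apply: contrapT => /(proper_cone_separation pC)[f f0].
have : 0 <= tens_pair (scale_map f (herm1 R 1)) a.
  apply: Ta => c Cc; have [_ _ h] := psd_cone R 1; apply: h; first exact: f0.
  exact: psd_herm1.
rewrite [X in tens_pair _ X]tens1E tens_pair_pure /hpair !big_ord1 /= !mxE /=.
by rewrite !mul1r !mulr1 !mul0r !subr0 leNgt => /negP.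
Qed.

(** One inclusion is minimality. For the other, a functional separating [a] from [S s] is
    nonnegative on all [c (x) B] with [c] in [C] and [B] psd, hence on the bipolar. *)
Lemma minimal_system_bipolar (S : cone_family X) s :
  minimal_operator_system C S -> (0 < s)%N -> S s = @bipolar C s.
Proof.
move=> [[oS1 oS2] bS mS] s0; apply/seteqP; split.
  by apply: mS => //; [exact: bipolar_operator_system|exact: bipolar_base].
move=> a Ta; apply: contrapT => /(proper_cone_separation (oS1 s s0))[F F0].
apply/negP; rewrite -leNgt; apply: bipolar_ge0 Ta => c B Cc pB.
apply: F0; have [[S0 SD _] _ _ _] := oS1 s s0.
have [b ->] := psd_sum_outer pB.
have -> : tens_pure c (\sum_j outer (b j)) = \sum_j tens_pure c (outer (b j)).
  elim/big_rec2: _ => [|i x y _ <-]; last by rewrite tens_pureDr.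
  by rewrite -(scale0r (0 : herm R s)) tens_pureZr scale0r.
elim/big_ind: _ => // j _.
have Sc : S 1%N (tens_pure c (herm1 R 1)) by rewrite bS; exists c.
(* Compressing [c (x) 1] from level 1 by the row [(b j)^t*] gives [c (x) outer (b j)]. *)
have := oS2 1%N s ((b j)^t*) isT s0 _ Sc; rewrite compress_pure.
by congr (S s (tens_pure c _)); apply: val_inj; rewrite /= trmxCK mulmx1.
Qed.

End Bipolar.

(** * Semialgebraic selection *)

Section LexicographicMinimum.
Variables (R : realType) (N : nat).
Implicit Types (S : set 'rV[R]_N) (g : 'rV[R]_N -> R).

Definition minimizers S g : set 'rV[R]_N :=
  [set u | S u /\ forall u', S u' -> g u <= g u'].

Definition sqnorm (u : 'rV[R]_N) : R := \sum_i u 0 i ^+ 2.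

(** The norm comes first because its minimizers on a closed set are compact; the coordinates then
    single out one point. *)
Definition lex_objectives : seq ('rV[R]_N -> R) :=
  sqnorm :: [seq (fun u : 'rV[R]_N => u 0 i) | i <- enum 'I_N].

Definition lexmin S := foldl minimizers S lex_objectives.

Lemma compact_minimizers S g : compact S -> S !=set0 -> continuous g ->
  compact (minimizers S g) /\ minimizers S g !=set0.
Proof.
move=> cS S0 cg.
have [c /set_mem Sc cmin] := compact_EVT_min S0 cS (continuous_subspaceT cg).
have mE : minimizers S g = S `&` (g @^-1` [set y | y <= g c]).
  apply/seteqP; split=> [u [Su umin]|u [Su /= uc]]; first by split=> //; exact: umin.
  by split=> // u' Su'; apply: le_trans uc _; apply: cmin; exact: mem_set.
split; last first.
  by exists c; split=> // u Su; apply: cmin; exact: mem_set.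
rewrite mE; apply: compact_closedI => //.
by apply: preimage_closed; [move=> x _; exact: cg|exact: closed_le].
Qed.

Lemma continuous_sqnorm : continuous sqnorm.
Proof.
apply: continuous_big => [|i _]; first exact: add_continuous.
by move=> u; apply: continuousM; apply: coord_continuous.
Qed.

Lemma closed_minimizers_sqnorm S : closed S -> S !=set0 ->
  compact (minimizers S sqnorm) /\ minimizers S sqnorm !=set0.
Proof.
move=> clS [u0 Su0]; pose S' := S `&` (sqnorm @^-1` [set y | y <= sqnorm u0]).
have cS' : compact S'.
  (* A bound on the coordinates without square roots: [t^2 <= K] implies [|t| <= 1 + K]. *)
  pose M := 1 + sqnorm u0.
  have cB : compact [set v : 'rV[R]_N | forall i, v ord0 i \in `[- M, M]].
    by apply: (@rV_compact _ _ (fun=> `[- M, M]%classic)) => _; exact: segment_compact.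
  apply: subclosed_compact cB _.
    apply: closedI => //.
    by apply: preimage_closed; [move=> x _; exact: continuous_sqnorm|exact: closed_le].
  move=> v [_ /= vle] i; rewrite in_itv /= -ler_norml.
  have : v ord0 i ^+ 2 <= sqnorm u0.
    apply: le_trans vle; rewrite /sqnorm (bigD1 i)//= lerDl sumr_ge0// => j _.
    exact: sqr_ge0.
  rewrite -real_normK ?num_real// => h; have := sqr_ge0 (`|v ord0 i| - 1); have := normr_ge0 (v ord0 i).
  by move: h; rewrite /M; nra.
have mE : minimizers S sqnorm = minimizers S' sqnorm.
  apply/seteqP; split=> [u [Su umin]|u [[Su uu0] umin]].
    by split; [split=> //; exact: umin|move=> u' [Su' _]; exact: umin].
  split=> // u' Su'; have [h|h] := leP (sqnorm u') (sqnorm u0); first exact: umin.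
  exact: le_trans uu0 (ltW h).
rewrite mE; apply: compact_minimizers => //; last exact: continuous_sqnorm.
by exists u0; split=> //=.
Qed.

Lemma lexmin_subset S gs : foldl minimizers S gs `<=` S.
Proof.
by elim: gs S => [|g gs IH] S u //= /IH[].
Qed.

Lemma lexmin_exists S : closed S -> S !=set0 -> lexmin S !=set0.
Proof.
move=> clS S0; rewrite /lexmin /=.
have [] := closed_minimizers_sqnorm clS S0.
elim: (enum 'I_N) (minimizers S sqnorm) => [|i s IH] T cT T0 //=.
have [cT' T'0] := compact_minimizers cT T0 (@coord_continuous _ _ _ 0 i).
exact: IH.
Qed.

(** Two points that survive all stages agree on every objective, and the coordinates are among the
    objectives. *)
Lemma lexmin_unique S u u' : lexmin S u -> lexmin S u' -> u = u'.
Proof.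
have gen gs T : foldl minimizers T gs u -> foldl minimizers T gs u' ->
    forall i, (i < size gs)%N -> nth (fun=> 0) gs i u = nth (fun=> 0) gs i u'.
  elim: gs T => [|g gs IH] T //= Tu Tu' [_|i]; last by rewrite ltnS; exact: (IH _ Tu Tu').
  have [Su umin] := lexmin_subset Tu; have [Su' u'min] := lexmin_subset Tu'.
  by apply/eqP; rewrite /= eq_le umin//= u'min.
move=> Su Su'; apply/rowP => i.
have := gen lex_objectives S Su Su' i.+1; rewrite /= size_map size_enum_ord ltnS => /(_ (ltn_ord i)).
rewrite (nth_map i) ?size_enum_ord ?ltn_ord//= nth_ord_enum.
exact.
Qed.

End LexicographicMinimum.

(** * Predicates definable by first-order formulas *)

Section Definable.
Variable R : realType.
Local Notation env := (nat -> R).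

Inductive coord_poly : (env -> R) -> Prop :=
| CPconst (k : R) : coord_poly (fun=> k)
| CPvar i : coord_poly (fun e => e i)
| CPadd p q : coord_poly p -> coord_poly q -> coord_poly (fun e => p e + q e)
| CPmul p q : coord_poly p -> coord_poly q -> coord_poly (fun e => p e * q e).

Lemma CPsum (I : Type) (r : seq I) (P : pred I) (F : I -> env -> R) :
  (forall i, coord_poly (F i)) -> coord_poly (fun e => \sum_(i <- r | P i) F i e).
Proof.
move=> hF; elim: r => [|i r IH].
  rewrite (_ : (fun e => _) = fun=> 0); first exact: CPconst.
  by apply/funext => e; rewrite big_nil.
case Pi : (P i); last first.
  rewrite (_ : (fun e => _) = fun e => \sum_(j <- r | P j) F j e)//.
  by apply/funext => e; rewrite big_cons Pi.
rewrite (_ : (fun e => _) = fun e => F i e + \sum_(j <- r | P j) F j e).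
  exact: CPadd.
by apply/funext => e; rewrite big_cons Pi.
Qed.

Lemma coord_poly_continuous N (p : env -> R) (E : 'rV[R]_N -> env) :
  coord_poly p -> (forall i, continuous (fun u => E u i : R)) ->
  continuous (fun u => p (E u) : R).
Proof.
move=> + cE; elim=> [k|i|p1 p2 _ IH1 _ IH2|p1 p2 _ IH1 _ IH2] u.
- exact: cst_continuous.
- exact: cE.
- by apply: (@continuousD _ _ _ (fun u => p1 (E u)) (fun u => p2 (E u))); [exact: IH1|exact: IH2].
- by apply: (@continuousM _ _ (fun u => p1 (E u)) (fun u => p2 (E u))); [exact: IH1|exact: IH2].
Qed.

(** Formulas are evaluated on lists with missing variables read as 0, so agreement is asked for on
    the environments [nth 0 e]. *)
Definition definable (P : env -> Prop) :=
  exists f, forall e : seq R, ord.holds e f <-> P (nth 0 e).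

Lemma coord_poly_term p : coord_poly p ->
  exists t, forall e : seq R, GRing.eval e t = p (nth 0 e).
Proof.
elim=> [k|i|p1 p2 _ [t1 h1] _ [t2 h2]|p1 p2 _ [t1 h1] _ [t2 h2]].
- by exists (GRing.Const k).
- by exists (GRing.Var R i).
- by exists (GRing.Add t1 t2) => e /=; rewrite h1 h2.
- by exists (GRing.Mul t1 t2) => e /=; rewrite h1 h2.
Qed.

Lemma definable_le p q : coord_poly p -> coord_poly q ->
  definable (fun e => p e <= q e).
Proof.
move=> /coord_poly_term[t ht] /coord_poly_term[u hu].
by exists (ord.Le t u) => e /=; rewrite ht hu.
Qed.

Lemma definable_eq p q : coord_poly p -> coord_poly q ->
  definable (fun e => p e = q e).
Proof.
move=> /coord_poly_term[t ht] /coord_poly_term[u hu].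
by exists (ord.Equal t u) => e /=; rewrite ht hu.
Qed.

Lemma definable_and P Q : definable P -> definable Q ->
  definable (fun e => P e /\ Q e).
Proof. by move=> [f hf] [g hg]; exists (ord.And f g) => e /=; rewrite hf hg. Qed.

Lemma definable_imp P Q : definable P -> definable Q ->
  definable (fun e => P e -> Q e).
Proof. by move=> [f hf] [g hg]; exists (ord.Implies f g) => e /=; rewrite hf hg. Qed.

Lemma definable_not P : definable P -> definable (fun e => ~ P e).
Proof. by move=> [f hf]; exists (ord.Not f) => e /=; rewrite hf. Qed.

Lemma definable_ext P Q : (forall e, P e <-> Q e) -> definable P -> definable Q.
Proof. by move=> PQ [f hf]; exists f => e; rewrite hf. Qed.

Definition upd (e : env) i x : env := fun j => if j == i then x else e j.

Lemma definable_exists i P : definable P ->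
  definable (fun e => exists x, P (upd e i x)).
Proof.
move=> [f hf]; exists (ord.Exists i f) => e /=.
have E x : nth 0 (set_nth 0 e i x) = upd (nth 0 e) i x.
  by apply/funext => j; rewrite nth_set_nth.
by split=> -[x]; [rewrite hf E|rewrite -E -hf] => h; exists x.
Qed.

Definition vec (e : env) a n : 'rV[R]_n := \row_(i < n) e (a + i)%N.

Definition blk (e : env) b n (u : 'rV[R]_n) : env :=
  fun j => if (b <= j)%N then oapp (fun k : 'I_n => u 0 k) (e j) (insub (j - b)%N) else e j.

Lemma vec_blk e b n (u : 'rV[R]_n) : vec (blk e b u) b n = u.
Proof. by apply/rowP => i; rewrite mxE /blk leq_addr addKn valK. Qed.

Lemma vec_blk_lt e b n (u : 'rV[R]_n) a m : (a + m <= b)%N ->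
  vec (blk e b u) a m = vec e a m.
Proof.
move=> amb; apply/rowP => i; rewrite !mxE /blk leqNgt.
by rewrite (leq_trans _ amb)// ltn_add2l.
Qed.

Lemma definable_exists_blk b n P : definable P ->
  definable (fun e => exists u : 'rV[R]_n, P (blk e b u)).
Proof.
elim: n P => [|n IH] P dP.
  apply: definable_ext dP => e.
  have E u : blk e b (u : 'rV_0) = e.
    by apply/funext => j; rewrite /blk; case: leqP => // _; case: insubP => // -[].
  by split=> [h|[u]]; [exists 0|]; rewrite E.
(* The last coordinate, variable [b + n], is bound innermost; the induction hypothesis binds the
   rest of the block. *)
apply: definable_ext (IH _ (definable_exists (b + n) dP)) => e.
split=> [[u [x]]|[u]] h.
  exists (\row_i oapp (fun k => u 0 k) x (unlift ord_max i)).
  suff -> : blk e b (\row_i oapp (fun k => u 0 k) x (unlift ord_max i)) =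
    upd (blk e b u) (b + n) x by [].
  apply/funext => j; rewrite /blk /upd; case: leqP => bj; last first.
    by rewrite ltn_eqF// ltn_addr.
  rewrite -[in j == _](subnKC bj) eqn_add2l.
  case: insubP => [k kj kE|]; last first.
    rewrite -leqNgt => nj; rewrite gtn_eqF//; case: insubP => // k kj.
    by move: nj; rewrite ltnNge ltnW.
  rewrite -kE /= mxE; case: unliftP => [l ->|->] /=; last by rewrite eqxx.
  by rewrite /bump leqNgt ltn_ord add0n ltn_eqF ?ltn_ord// (valK l).
exists (\row_i u 0 (widen_ord (leqnSn n) i)), (u 0 ord_max).
suff -> : upd (blk e b (\row_i u 0 (widen_ord (leqnSn n) i))) (b + n) (u 0 ord_max)
  = blk e b u by [].
apply/funext => j; rewrite /blk /upd; case: leqP => bj; last first.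
  by rewrite ltn_eqF// ltn_addr.
rewrite -[in j == _](subnKC bj) eqn_add2l; case: eqP => [->|/eqP jn].
  rewrite (insubT (fun k => k < n.+1)%N (ltnSn n)) /=.
  by congr (u 0 _); apply: val_inj.
case: insubP => [k kj kE|].
  rewrite (insubT (fun k => k < n.+1)%N (ltnW kj : (j - b < n.+1)%N)) /= mxE.
  by congr (u 0 _); apply: val_inj; rewrite /= kE.
rewrite -leqNgt => nj; case: insubP => // k; rewrite ltnS leq_eqVlt (negPf jn) /=.
by rewrite ltnNge nj.
Qed.

Lemma definable_forall_blk b n P : definable P ->
  definable (fun e => forall u : 'rV[R]_n, P (blk e b u)).
Proof.
move=> /definable_not/(definable_exists_blk b n)/definable_not.
apply: definable_ext => e; split=> [h u|h [u]]; last by apply; exact: h.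
by apply: contrapT => nP; apply: h; exists u.
Qed.

(* A polynomial system with parameters can be solved semialgebraically: take
   the lexicographically smallest solution of minimal norm. *)
Lemma definable_selection m N (q : 'rV[R]_m -> 'rV[R]_N -> R) :
  (forall a, coord_poly (fun e => q (vec e 0 m) (vec e a N))) ->
  exists h : 'rV[R]_m -> 'rV[R]_N,
    (forall x, (exists u, q x u = 0) -> q x (h x) = 0) /\
    forall k, definable (fun e => (exists u, q (vec e 0 m) u = 0) /\
                                  e m = h (vec e 0 m) 0 k).
Proof.
move=> pq; pose S x : set 'rV[R]_N := [set u | q x u = 0].
have clS x : closed (S x).
  apply: (@preimage_closed _ _ (q x) [set y | y = 0]); last exact: closed_eq.
  move=> u _; pose E (u : 'rV[R]_N) : env := blk (blk (fun=> 0) 0 x) m u.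
  have qE v : q x v = q (vec (E v) 0 m) (vec (E v) m N).
    by rewrite /E vec_blk vec_blk_lt// vec_blk.
  rewrite (_ : q x = fun v => q (vec (E v) 0 m) (vec (E v) m N)); last exact/funext.
  apply: (coord_poly_continuous (pq m)) => i; rewrite /E /blk.
  case: (leqP m i) => _; last exact: cst_continuous.
  case: (insub (i - m)%N : option 'I_N) => [k|] /=; last exact: cst_continuous.
  exact: coord_continuous.
have reg gs (D : 'rV[R]_m -> set 'rV[R]_N) :
    (forall i a, coord_poly (fun e => nth (fun=> 0) gs i (vec e a N))) ->
    (forall a, definable (fun e => D (vec e 0 m) (vec e a N))) ->
    forall a, definable (fun e => foldl (@minimizers R N) (D (vec e 0 m)) gs (vec e a N)).
  elim: gs D => [|g gs IH] D hg hD a //=.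
  apply: (IH (fun x => minimizers (D x) g)) => [i b|b]; first exact: (hg i.+1 b).
  apply: definable_and; first exact: hD.
  (* The competing point is quantified over a block that starts beyond both the parameters and the
     candidate. *)
  pose c := maxn m (b + N).
  have := definable_forall_blk c N (definable_imp (hD c) (definable_le (hg 0%N b) (hg 0%N c))).
  apply: definable_ext => e; split=> h u.
    by have := h u; rewrite /= vec_blk !vec_blk_lt ?leq_maxr// leq_maxl.
  by rewrite /= vec_blk !vec_blk_lt ?leq_maxr ?leq_maxl//; exact: h.
(* Where the system has no solution the value 0 is a placeholder, excluded from the definable graph
   by its first conjunct. *)
have ex x : exists u, (exists u', q x u' = 0) -> lexmin (S x) u.
  have [[u hu]|nu] := pselect (exists u', q x u' = 0); last by exists 0.
  by have [v Sv] := lexmin_exists (clS x) (ex_intro _ u hu); exists v.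
have [h hP] := choice ex.
exists h; split=> [x xu|k]; first exact: (lexmin_subset (hP x xu)).
have dS a : definable (fun e => S (vec e 0 m) (vec e a N)).
  by apply: definable_eq; [exact: pq|exact: CPconst].
have dL a : definable (fun e => lexmin (S (vec e 0 m)) (vec e a N)).
  apply: reg => // i b; rewrite /lex_objectives; case: i => [|i] /=.
    rewrite /sqnorm; apply: CPsum => i; rewrite (_ : (fun e => _) = fun e : env => e (b + i)%N * e (b + i)%N).
      by apply: CPmul; exact: CPvar.
    by apply/funext => e; rewrite mxE.
  have [iN|iN] := ltnP i N; last first.
    rewrite (_ : (fun e => _) = fun=> 0); first exact: CPconst.
    by apply/funext => e; rewrite nth_default// size_map size_enum_ord.
  rewrite (_ : (fun e => _) = fun e : env => e (b + i)%N); first exact: CPvar.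
  apply/funext => e; rewrite (nth_map (Ordinal iN)) ?size_enum_ord//.
  by rewrite mxE nth_enum_ord.
(* Variables below [m] are the parameters and variable [m] is the claimed value, so the minimizer
   occupies the block from [m.+1] on. *)
have := definable_exists_blk m.+1 N (definable_and (dL m.+1)
  (definable_eq (CPvar m) (CPvar (m.+1 + k)))).
apply: definable_ext => e.
have sl u : (blk e m.+1 u) (m.+1 + k)%N = u 0 k :> R.
  by rewrite -[in RHS](vec_blk e m.+1 u) mxE.
have sm u : (blk e m.+1 (u : 'rV_N)) m = e m by rewrite /blk ltnn.
split=> [[u]|[xu em]].
  rewrite sl sm vec_blk vec_blk_lt// => -[Lu ->].
  have xu : exists u', q (vec e 0 m) u' = 0 by exists u; exact: (lexmin_subset Lu).
  by split=> //; rewrite (lexmin_unique Lu (hP _ xu)).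
by exists (h (vec e 0 m)); rewrite sl sm vec_blk vec_blk_lt//; split=> //; exact: hP.
Qed.

End Definable.

Section QuantifierElimination.
Variables (R : realType) (V : lmodType R).

Lemma semialgebraicT : semialgebraic (setT : set V).
Proof.
have := SemialgPos (@PolyConst R V 1); congr semialgebraic.
by apply/seteqP; split=> // v _ /=; exact: ltr01.
Qed.

(** Quantifier elimination leaves a quantifier-free formula without inverses; its atoms compare
    polynomials in the functionals [l i]. *)
Lemma definable_semialgebraic n (l : 'I_n -> {linear V -> R^o}) P :
  definable P ->
  semialgebraic [set v : V | P (nth 0 [seq l i v : R | i <- enum 'I_n])].
Proof.
move=> [f hf]; pose e v := [seq l i v : R | i <- enum 'I_n].
have polyE (p p' : V -> R) : p =1 p' -> polynomial_fun p -> polynomial_fun p'.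
  by move=> /funext ->.
have poly_t t : GRing.rterm t -> polynomial_fun (fun v => GRing.eval (e v) t).
  elim: t => //= [i _|k _|k _|t IHt u IHu /andP[/IHt pt /IHu pu]|t IHt /IHt pt
                 |t IHt k /IHt pt|t IHt u IHu /andP[/IHt pt /IHu pu]|t IHt k /IHt pt].
  - have [ni|ni] := ltnP i n.
      apply: (polyE _ _ _ (PolyLin (l (Ordinal ni)))) => v.
      rewrite (nth_map (Ordinal ni)) ?size_enum_ord//; congr (l _ v).
      by apply: val_inj; rewrite /= nth_enum_ord.
    apply: (polyE _ _ _ (PolyConst V 0)) => v.
    by rewrite nth_default// size_map size_enum_ord.
  - exact: PolyConst.
  - exact: PolyConst.
  - exact: PolyAdd.
  - by apply: (polyE _ _ _ (PolyMul (PolyConst V (-1)) pt)) => v; rewrite mulN1r.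
  - by apply: (polyE _ _ _ (PolyMul (PolyConst V k%:R) pt)) => v; rewrite mulr_natl.
  - exact: PolyMul.
  - elim: k => [|k IH]; first exact: PolyConst.
    by apply: (polyE _ _ _ (PolyMul pt IH)) => v; rewrite exprS.
have lt_semi t u : GRing.rterm t -> GRing.rterm u ->
    semialgebraic [set v | GRing.eval (e v) t < GRing.eval (e v) u].
  move=> rt ru; have := SemialgPos (PolyAdd (poly_t _ ru) (PolyMul (PolyConst V (-1)) (poly_t _ rt))).
  congr semialgebraic; apply/seteqP; split=> v /=; rewrite mulN1r subr_gt0//.
have le_semi t u : GRing.rterm t -> GRing.rterm u ->
    semialgebraic [set v | GRing.eval (e v) t <= GRing.eval (e v) u].
  move=> rt ru; have := SemialgC (lt_semi _ _ ru rt).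
  by congr semialgebraic; apply/seteqP; split=> v /=; [rewrite leNgt => /negP|rewrite leNgt => /negP].
have qf_semi g : ord.qf_form g && ord.rformula g ->
    semialgebraic [set v | ord.qf_eval (e v) g].
  elim: g => //=.
  - move=> [] _; first by have := semialgebraicT; congr semialgebraic; apply/seteqP; split.
    have := SemialgC semialgebraicT; congr semialgebraic.
    by apply/seteqP; split=> v //= /(_ I).
  - move=> t u /andP[rt ru]; have := SemialgI (le_semi _ _ rt ru) (le_semi _ _ ru rt).
    congr semialgebraic; apply/seteqP; split=> v /=; first by move=> [h1 h2]; rewrite eq_le h1.
    by move=> /eqP ->.
  - by move=> t u /andP[rt ru]; exact: lt_semi.
  - by move=> t u /andP[rt ru]; exact: le_semi.
  - move=> g IHg h IHh /andP[/andP[qg qh] /andP[rg rh]].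
    have := SemialgI (IHg (introT andP (conj qg rg))) (IHh (introT andP (conj qh rh))).
    congr semialgebraic; apply/seteqP; split=> v /=; first by move=> [-> ->].
    by move=> /andP[].
  - move=> g IHg h IHh /andP[/andP[qg qh] /andP[rg rh]].
    have := SemialgC (SemialgI (SemialgC (IHg (introT andP (conj qg rg))))
                               (SemialgC (IHh (introT andP (conj qh rh))))).
    congr semialgebraic; apply/seteqP; split=> v /=.
      by move=> nn; apply/orP; apply: contrapT => no; apply: nn; split=> h'; apply: no; [left|right].
    by move=> /orP[h1|h2] [].
  - move=> g IHg h IHh /andP[/andP[qg qh] /andP[rg rh]].
    have := SemialgC (SemialgI (IHg (introT andP (conj qg rg)))
                               (SemialgC (IHh (introT andP (conj qh rh))))).
    congr semialgebraic; apply/seteqP; split=> v /=.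
      by move=> nn; apply/implyP => h1; apply: contrapT => h2; apply: nn.
    by move=> /implyP h1 [/h1].
  - move=> g IHg /IHg sg; have := SemialgC sg; congr semialgebraic.
    by apply/seteqP; split=> v /= /negP.
have /andP[qf rf] := ord.quantifier_elim_wf (@wf_QE_wproj R) (ord.to_rform_rformula f).
have := qf_semi _ (introT andP (conj qf rf)); congr semialgebraic.
by apply/seteqP; split=> v /=; [move=> /(rcf_satP (e v) f)/hf|move=> /hf/(rcf_satP (e v) f)].
Qed.

End QuantifierElimination.

(** * Kraus representations *)

Section Kraus.
Variables (R : realType).
Local Notation C := R[i].

Lemma herm_sumE n (I : Type) (r : seq I) (P : pred I) (F : I -> herm R n) :
  herm_val (\sum_(i <- r | P i) F i) = \sum_(i <- r | P i) herm_val (F i).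
Proof. by elim/big_rec2: _ => // i x y _ <-. Qed.

Definition kraus d s (V : 'M[C]_(d, s)) (A : herm R d) : herm R s :=
  Herm (conj_herm_subproof V A).

Lemma kraus_linear d s (V : 'M[C]_(d, s)) : linear (kraus V).
Proof.
move=> r A B; apply: val_inj.
by rewrite /= mulmxDr mulmxDl -scalemxAr -scalemxAl.
Qed.

HB.instance Definition _ d s (V : 'M[C]_(d, s)) :=
  GRing.isLinear.Build R (herm R d) (herm R s) _ (kraus V) (kraus_linear V).

Lemma psd_kraus d s (V : 'M[C]_(d, s)) A : psd A -> psd (kraus V A).
Proof.
by move=> pA v; rewrite -[X in 0 <= X]/(quad _ v) /= quadM; exact: pA.
Qed.

Definition unvec d s (y : 'cV[C]_(d * s)) : 'M[C]_(d, s) :=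
  \matrix_(i, k) y (mxtens_index (i, k)) 0.

Lemma unvec_surj d s (V : 'M[C]_(d, s)) : exists y, unvec y = V.
Proof.
exists (\col_p V (mxtens_unindex p).1 (mxtens_unindex p).2).
by apply/matrixP => i k; rewrite !mxE mxtens_indexK.
Qed.

Lemma sum_mxtens (V : nmodType) d s (F : 'I_(d * s) -> V) :
  \sum_p F p = \sum_i \sum_k F (mxtens_index (i, k)).
Proof.
rewrite (pair_big xpredT xpredT (fun i k => F (mxtens_index (i, k))))/=.
rewrite (reindex (@mxtens_index d s)) /=; last first.
  by exists (@mxtens_unindex d s) => p _; rewrite (mxtens_indexK, mxtens_unindexK).
by apply: eq_bigr => -[i k].
Qed.

(** A vector of the tensor product, reshaped as a matrix, is a Kraus operator: quadratic forms on
    level [s] of the psd system are pairings with maps [kraus V]. *)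
Lemma quad_flatten_pure d s (A : herm R d) (B : herm R s) y :
  complex.Re (quad (Defs.flatten (tens_pure A B)) y) = hpair B (kraus (unvec y) A).
Proof.
rewrite quadE /hpair flatten_pure.
have reS (I : finType) (F : I -> C) : complex.Re (\sum_i F i) = \sum_i complex.Re (F i).
  by rewrite raddf_sum.
rewrite sum_mxtens exchange_big reS; apply: eq_bigr => k _.
rewrite [X in complex.Re X](_ : _ = \sum_l B k l * kraus (unvec y) A k l) ?reS//.
rewrite (eq_bigr (fun i => \sum_l \sum_j Num.conj (y (mxtens_index (i, k)) 0) *
   (A i j * B k l) * y (mxtens_index (j, l)) 0)); last first.
  move=> i _; rewrite sum_mxtens exchange_big; apply: eq_bigr => l _; apply: eq_bigr => j _.
  by rewrite tensmxE.
rewrite exchange_big; apply: eq_bigr => l _ /=.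
rewrite mxE mulr_sumr exchange_big; apply: eq_bigr => j _ /=.
rewrite mxE mulr_suml mulr_sumr; apply: eq_bigr => i _; rewrite !mxE; ring.
Qed.

Lemma quad_flatten d s (a : tens (herm R d) s) y :
  complex.Re (quad (Defs.flatten a) y) = tens_pair (kraus (unvec y)) a.
Proof.
have Fl : linear (fun a : tens (herm R d) s => complex.Re (quad (Defs.flatten a) y) : R^o).
  move=> r b c; rewrite linearP /= quadD quadZ.
  by case: (quad _ _) (quad _ _) => u v [w x] /=; rewrite mul0r subr0.
pose F : {linear tens (herm R d) s -> R^o} :=
  HB.pack (fun a : tens (herm R d) s => complex.Re (quad (Defs.flatten a) y) : R^o)
    (GRing.isLinear.Build R _ R^o _ _ Fl).
suff : F =1 tens_pair (kraus (unvec y)) by exact.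
by apply: tens_ext => A B; rewrite [LHS]quad_flatten_pure /= tens_pair_pure.
Qed.

Lemma psd_flatten_pure d s (A : herm R d) (B : herm R s) :
  psd A -> psd B -> psd (Defs.flatten (tens_pure A B)).
Proof.
move=> pA pB; apply/psdP => y; rewrite quad_flatten_pure.
by apply: (psd_hpairP B).1 => //; exact: psd_kraus.
Qed.

Lemma tens_pair_amplify (X Y : lmodType R) s (phi : {linear Y -> herm R s})
    (pi : {linear X -> Y}) a :
  tens_pair phi (amplify pi a) = tens_pair (phi \o pi) a.
Proof. by apply: eq_bigr => i _; apply: eq_bigr => j _; rewrite !ffunE. Qed.

Lemma tens_pair_sum (X : lmodType R) s (I : finType)
    (psi : I -> {linear X -> herm R s}) (phi : {linear X -> herm R s}) a :
  (forall x, phi x = \sum_k psi k x) ->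
  tens_pair phi a = \sum_k tens_pair (psi k) a.
Proof.
move=> E; rewrite exchange_big; apply: eq_bigr => i _.
rewrite exchange_big; apply: eq_bigr => j _ /=.
rewrite !E !herm_sumE !summxE [in RHS]sumrB.
by congr (_ - _); rewrite raddf_sum.
Qed.

Lemma psd_quad0 n (A : herm R n) v : psd A -> quad A v = 0 -> A *m v = 0.
Proof.
move=> /psd_sqrt[B BA].
have -> : quad A v = ((B *m v)^t* *m (B *m v)) 0 0.
  by rewrite /quad -BA -{1}[herm_val B]hermP trmx_mul map_mxM !mulmxA.
by move=> /quad1_eq0 Bv; rewrite -BA -mulmxA Bv mulmx0.
Qed.

Lemma kraus_projE d (P A : herm R d) : P *m A = A :> 'M_d -> kraus P A = A.
Proof.
move=> PA; apply: val_inj; rewrite /= hermP PA.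
by have := congr1 (fun M : 'M_d => M^t*) PA; rewrite trmx_mul map_mxM !hermP.
Qed.

Lemma kraus_tens_pure d s (P : herm R d) (A : herm R d) (B : herm R s) :
  kraus (tensmx P (1%:M : 'M[C]_s)) (Defs.flatten (tens_pure A B)) =
  Defs.flatten (tens_pure (kraus P A) B).
Proof.
apply: val_inj; set T := tensmx P _.
rewrite -[LHS]/(T^t* *m herm_val (Defs.flatten (tens_pure A B)) *m T).
rewrite -[RHS]/(herm_val (Defs.flatten (tens_pure (kraus P A) B))) !flatten_pure.
by rewrite /T trmx_tens map_mxT !tensmx_mul trmx1 map_mx1 mul1mx mulmx1.
Qed.

(** The bound counts the spanning family of all [re_basis] and [im_basis] matrices. Any finite bound
    serves to produce maximal independent families. *)
Lemma herm_indep_leq d n (Z : lmodType R) (gamma : {linear Z -> herm R d})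
    (b : 'I_n -> Z) : injective gamma -> indep b -> (n <= 2 * (d * d))%N.
Proof.
move=> ig ib.
have ib' : indep (gamma \o b).
  move=> k kb; apply: ib; apply: ig; rewrite linear0 -[RHS]kb linear_sum.
  by apply: eq_bigr => i _; rewrite linearZ.
pose u (p : bool * ('I_d * 'I_d)) : herm R d :=
  if p.1 then re_basis R p.2.1 p.2.2 else im_basis R p.2.1 p.2.2.
have <- : #|{: bool * ('I_d * 'I_d)}| = (2 * (d * d))%N.
  by rewrite !card_prod card_bool !card_ord.
apply: (indep_leq (u := fun j : 'I_#|{: bool * ('I_d * 'I_d)}| => u (enum_val j)) ib') => i.
pose a (p : bool * ('I_d * 'I_d)) : R :=
  let z := herm_val (gamma (b i)) p.2.1 p.2.2 in
  if p.1 then complex.Re z else complex.Im z.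
exists (fun j => a (enum_val j)).
rewrite -(big_enum_val (fun p => a p *: u p)) [LHS](herm_decomp (gamma (b i))).
rewrite pair_big /=.
rewrite (eq_bigr (fun p => a (true, p) *: u (true, p) + a (false, p) *: u (false, p)))//.
rewrite big_split /= -(big_bool _ (fun c => \sum_p a (c, p) *: u (c, p))).
rewrite (pair_big xpredT xpredT (fun c p => a (c, p) *: u (c, p))).
by apply: eq_bigr => -[].
Qed.

End Kraus.

Section ArvesonExtension.
Variables (R : realType) (d s : nat).
Local Notation C := R[i].
Local Notation one := (1%:M : 'M[C]_s).

Lemma sum_tens_pure_linear n (X : lmodType R) (b : 'I_n -> X) (r : R)
    (B B' : 'I_n -> herm R s) :
  \sum_i tens_pure (b i) (r *: B i + B' i) =
  r *: \sum_i tens_pure (b i) (B i) + \sum_i tens_pure (b i) (B' i).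
Proof.
rewrite scaler_sumr -big_split; apply: eq_bigr => i _.
by rewrite tens_pureDr tens_pureZr.
Qed.

Lemma sum_tens_purel (I : finType) (X : lmodType R) (x : I -> X) (B : herm R s) :
  \sum_i tens_pure (x i) B = tens_pure (\sum_i x i) B.
Proof.
elim/big_rec2: _ => [|i y a _ ->]; last by rewrite tens_pureDl.
by rewrite -(scale0r (0 : X)) tens_pureZl scale0r.
Qed.

Lemma psd_tensor_order_unit (A : herm R d) (e : R) : 0 < e ->
  psd (A - e *: herm1 R d) ->
  order_unit (@psd R (d * s)) (Defs.flatten (tens_pure A (herm1 R s))).
Proof.
move=> e0 pA M; have [_ pD pZ] := psd_cone R (d * s).
have [r r0 pM] := psd_order_unit M; exists (r / e); first exact: divr_gt0.
have re0 : 0 <= r / e by rewrite divr_ge0// ltW.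
have := pD _ _ (pZ _ _ re0 (psd_flatten_pure pA (@psd_herm1 R s))) pM.
congr psd; rewrite addrA; congr (_ + _).
have -> : herm1 R (d * s) = Defs.flatten (tens_pure (herm1 R d) (herm1 R s)).
  apply: val_inj; rewrite -[RHS]/(herm_val (Defs.flatten _)) flatten_pure.
  apply/matrixP => p q; case: (mxtens_indexP p) (mxtens_indexP q) => [i k] [j l].
  rewrite tensmxE !mxE (inj_eq (can_inj (@mxtens_indexK d s))) xpair_eqE.
  by rewrite -natrM mulnb.
rewrite -!linearZ -linearD -!tens_pureZl -tens_pureDl scalerDr -addrA.
by rewrite scalerN scalerA divfK ?gt_eqF// addNr addr0.
Qed.

(* If [gamma z0] is positive definite this is Arveson's extension theorem; in
   general one compresses to the support [P] of a sum [A0] of psd elements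
   spanning the psd part of the range of [gamma]. *)
Lemma lifted_map_kraus (X Z : lmodType R) (pi : {linear Z -> X})
    (gamma : {linear Z -> herm R d}) (phi : {linear X -> herm R s}) :
  injective gamma ->
  (forall c : tens Z s, psd (Defs.flatten (amplify gamma c)) ->
     0 <= tens_pair phi (amplify pi c)) ->
  exists V : 'I_(d * s) -> 'M[C]_(d, s), forall z, psd (gamma z) ->
    phi (pi z) = \sum_k kraus (V k) (gamma z).
Proof.
move=> ig posl.
have [|n [b [_ pb ib spb]]] := @maximal_indep R Z [set z | psd (gamma z)] (2 * (d * d)).
  by move=> n b _; exact: herm_indep_leq ig.
pose A0 := \sum_i gamma (b i).
have [_ pD pZ] := psd_cone R d.
have pA0 : psd A0.
  rewrite /A0; elim/big_ind: _ => //; last by move=> i _; exact: pb.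
  by have [] := psd_cone R d.
have [P [PP PA0 [e e0 pE] Psup]] := psd_support pA0.
(* If [A0 v = 0], the nonnegative summands of [quad A0 v] all vanish, so the kernel of [A0] lies in
   that of each [gamma (b i)]. *)
have Pb i : P *m gamma (b i) = gamma (b i) :> 'M_d.
  apply: Psup => v A0v; rewrite hermP; apply: psd_quad0; first exact: pb.
  have : quad A0 v = 0 by rewrite /quad -mulmxA A0v mulmx0 mxE.
  have -> : quad A0 v = \sum_i quad (gamma (b i)) v.
    by rewrite /A0 herm_sumE /quad mulmx_sumr mulmx_suml summxE.
  move=> /eqP; rewrite psumr_eq0 => [/allP/(_ i (mem_index_enum _))/eqP//|j _].
  exact: pb.
pose T := tensmx P one.
pose Zt (B : 'I_n -> herm R s) : tens Z s := \sum_i tens_pure (b i) (B i).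
(* The domain consists of all matrices whose compression by [T] comes from [Z], rather than of such
   compressions only; it thereby contains the positive definite [u] below. *)
pose G := [set p : herm R (d * s) * R | exists B : 'I_n -> herm R s,
  kraus T p.1 = Defs.flatten (amplify gamma (Zt B)) /\
  p.2 = tens_pair phi (amplify pi (Zt B))].
have gG : positive_graph (@psd R (d * s)) G.
  split=> [r [M a] [N c] [B [/= MB aB]] [B' [/= NB cB]]|M a [B [/= MB ->]] pM].
    exists (fun i => r *: B i + B' i).
    rewrite /Zt sum_tens_pure_linear -/(Zt B) -/(Zt B') !linearP /=.
    by rewrite MB NB aB cB.
  by apply: posl; rewrite -MB; exact: psd_kraus.
have flatZ B : Defs.flatten (amplify gamma (Zt B)) =
    \sum_i Defs.flatten (tens_pure (gamma (b i)) (B i)).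
  by rewrite /Zt !linear_sum; apply: eq_bigr => i _; rewrite /= amplify_pure.
have [M|f [f0 fG]] := positive_extension (psd_cone R (d * s)) gG.
  pose u := Defs.flatten (tens_pure (A0 + (herm1 R d - P)) (herm1 R s)).
  have [r r0 pu] := psd_tensor_order_unit e0 pE (- M).
  pose B (i : 'I_n) := r *: herm1 R s.
  exists (r *: u), (tens_pair phi (amplify pi (Zt B))); split=> //.
  exists B; split=> //=; rewrite linearZ /= /u kraus_tens_pure.
  have -> : kraus P (A0 + (herm1 R d - P)) = A0.
    rewrite linearD linearB /= (kraus_projE PA0) (kraus_projE PP).
    rewrite (_ : kraus P (herm1 R d) = P) ?subrr ?addr0//.
    by apply: val_inj; rewrite /= mulmx1 hermP PP.
  rewrite flatZ /B /A0 -sum_tens_purel linear_sum scaler_sumr.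
  by apply: eq_bigr => i _; rewrite tens_pureZr linearZ.
have [y fy] := positive_functional_quad f0.
exists (fun k => unvec (y k)) => z pz.
apply/eqP; rewrite -subr_eq0; apply/eqP; apply: hpair_nondegenerate => B _.
rewrite hpairC linearB /=; apply/eqP; rewrite subr_eq0; apply/eqP.
have [k zk] := spb z pz.
(* [gamma z] lies in the span of the [gamma (b i)], so it is fixed by the compression and [f] has
   its prescribed value there. *)
have <- : f (Defs.flatten (tens_pure (gamma z) B)) = hpair B (phi (pi z)).
  rewrite -tens_pair_pure -amplify_pure; apply: fG.
  exists (fun i => k i *: B); rewrite /=.
  have -> : Zt (fun i => k i *: B) = tens_pure z B.
    rewrite [in RHS]zk -sum_tens_purel; apply: eq_bigr => i _.
    by rewrite tens_pureZr tens_pureZl.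
  split=> //; rewrite kraus_tens_pure amplify_pure kraus_projE//.
  rewrite zk linear_sum herm_sumE mulmx_sumr; apply: eq_bigr => i _.
  by rewrite linearZ /= -scalemxAr Pb.
rewrite fy linear_sum; apply: eq_bigr => j _.
by rewrite quad_flatten_pure.
Qed.

End ArvesonExtension.

(** * From lifts to factorizations *)

Section LinearSpan.
Variables (K : pzRingType) (V : lmodType K).
Implicit Types F G : set V.

Lemma lin_span_gen F v : F v -> lin_span F v.
Proof.
move=> Fv; exists 1%N, (fun=> 1), (fun=> v); split=> //.
by rewrite big_ord1 scale1r.
Qed.

Lemma lin_span0 F : lin_span F 0.
Proof.
by exists 0%N, (fun=> 0), (fun=> 0); split=> [[]//|]; rewrite big_ord0.
Qed.

Lemma lin_spanD F u v : lin_span F u -> lin_span F v -> lin_span F (u + v).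
Proof.
move=> [m [k [f [Ff ->]]]] [n [l [g [Fg ->]]]].
exists (m + n)%N, (fun i => match fintype.split i with inl j => k j | inr j => l j end),
  (fun i => match fintype.split i with inl j => f j | inr j => g j end).
split; first by move=> i; case: fintype.split.
rewrite big_split_ord /=; congr (_ + _); apply: eq_bigr => i _.
  by rewrite (unsplitK (inl _ i)).
by rewrite (unsplitK (inr _ i)).
Qed.

Lemma lin_spanZ F a u : lin_span F u -> lin_span F (a *: u).
Proof.
move=> [m [k [f [Ff ->]]]]; exists m, (fun i => a * k i), f; split=> //.
by rewrite scaler_sumr; apply: eq_bigr => i _; rewrite scalerA.
Qed.

Lemma lin_span_sum F (I : Type) (r : seq I) (P : pred I) (f : I -> V) :
  (forall i, lin_span F (f i)) -> lin_span F (\sum_(i <- r | P i) f i).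
Proof.
move=> Ff; elim/big_ind: _ => //; [exact: lin_span0|exact: lin_spanD].
Qed.

Lemma lin_span_sub F G : F `<=` lin_span G -> lin_span F `<=` lin_span G.
Proof.
move=> FG _ [m [k [f [Ff ->]]]]; apply: lin_span_sum => i.
by apply: lin_spanZ; exact/FG/Ff.
Qed.

End LinearSpan.

Lemma lin_span_dim (K : fieldType) (V : lmodType K) (I : finType) (u : I -> V) :
  exists2 n, has_dim (lin_span (range u)) n & (n <= #|I|)%N.
Proof.
have [n b Sb ib|n [b [nI Sb ib spb]]] := @maximal_indep K V (range u) #|I|.
  apply: (indep_leq (u := fun j : 'I_#|I| => u (enum_val j)) ib) => i.
  have [x _ <-] := Sb i.
  exists (fun j => (j == enum_rank x)%:R).
  rewrite (bigD1 (enum_rank x))//= eqxx scale1r enum_rankK big1 ?addr0// => j.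
  by move=> /negPf ->; rewrite scale0r.
exists n => //; exists b; split=> //; apply/seteqP; split.
  apply: lin_span_sub => _ [x _ <-]; have [|k ->] := spb (u x); first by exists x.
  by apply: lin_span_sum => i; apply: lin_spanZ; apply: lin_span_gen; exists i.
apply: lin_span_sub => _ [i _ <-]; apply: lin_span_gen; exact: Sb.
Qed.

Section Coordinates.
Variables (K : fieldType) (V : lmodType K) (N : nat) (u : 'I_N -> V).
Hypothesis spanu : forall v, exists k : 'I_N -> K, v = \sum_(i < N) k i *: u i.

Lemma linear_coordinates : exists n (l : 'I_n -> {linear V -> K^o}),
  forall v w, (forall i, l i v = l i w) -> v = w.
Proof.
have [n b _ ib|n [b [_ _ ib spb]]] := @maximal_indep K V setT N.
  exact: indep_leq ib _.
have /choice[k kE] : forall v, exists k : 'I_n -> K, v = \sum_(i < n) k i *: b i.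
  by move=> v; exact: spb.
have k_lin i : linear (fun v => k v i : K^o).
  move=> r v w; apply/eqP; rewrite -subr_eq0; apply/eqP.
  apply: (ib (fun i => k (r *: v + w) i - (r * k v i + k w i))).
  under eq_bigr do rewrite scalerBl scalerDl -scalerA.
  by rewrite sumrB big_split /= -scaler_sumr -!kE subrr.
pose l i : {linear V -> K^o} :=
  HB.pack (fun v => k v i : K^o) (GRing.isLinear.Build K V K^o _ _ (k_lin i)).
exists n, l.
by move=> v w kvw; rewrite (kE v) (kE w); apply: eq_bigr => i _; congr (_ *: _); exact: kvw.
Qed.

End Coordinates.

Section HermitianParameters.
Variables (R : realType) (d : nat).

(** Real parts are stored on and above the diagonal of [f], imaginary parts below it. A Hermitian
    matrix thus takes exactly [d^2] real parameters, the source of the bound on the dimension of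
    [W]. *)
Definition herm_param_mx (f : 'I_d -> 'I_d -> R) : 'M[R[i]]_d :=
  \matrix_(i, j) if (i < j)%N then Complex (f i j) (f j i)
                 else if (j < i)%N then Complex (f j i) (- f i j)
                 else Complex (f i j) 0.

Fact herm_param_subproof f : (herm_param_mx f)^t* == herm_param_mx f.
Proof.
apply/eqP/matrixP => i j; rewrite !mxE.
by case: ltngtP => [ij|ji|/val_inj ->] /=; apply/eqP;
  rewrite eq_complex /= ?opprK ?oppr0 !eqxx.
Qed.

Definition herm_param f : herm R d := Herm (herm_param_subproof f).

Lemma herm_param_surj (B : herm R d) : exists f, herm_param f = B.
Proof.
exists (fun i j : 'I_d => if (i <= j)%N then complex.Re (B i j) else complex.Im (B j i)).
apply: val_inj; apply/matrixP => i j; rewrite !mxE.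
have hB k l : B k l = Num.conj (B l k) by rewrite -{1}[herm_val B]hermP !mxE.
case: ltngtP => [ij|ji|/val_inj ->] /=.
- by rewrite ?leqnn; case: (B i j).
- by rewrite [RHS]hB; case: (B j i).
- have := hB j j; case: (B j j) => a b /= /eqP; rewrite eq_complex /= => /andP[_ /eqP bb].
  by rewrite ?leqnn; apply/eqP; rewrite eq_complex /= eqxx /=; apply/eqP; lra.
Qed.

End HermitianParameters.

Section SemialgebraicPreimage.
Variables (R : realType) (V W : lmodType R) (g : {linear V -> W}).

Lemma semialgebraic_preimage (A : set W) : semialgebraic A -> semialgebraic (g @^-1` A).
Proof.
elim=> [p pp|B _ IH|B D _ IHB _ IHD].
- apply: (SemialgPos (p := p \o g)).
  elim: pp => [k|l|p1 p2 _ h1 _ h2|p1 p2 _ h1 _ h2].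
  + exact: PolyConst.
  + exact: (PolyLin (l \o g)).
  + exact: (PolyAdd h1 h2).
  + exact: (PolyMul h1 h2).
- exact: SemialgC.
- exact: SemialgI.
Qed.

End SemialgebraicPreimage.

Section ComplexCoordPoly.
Variable R : realType.
Local Notation env := (nat -> R).

Definition ccoord_poly (F : env -> R[i]) :=
  coord_poly (fun e => complex.Re (F e)) /\ coord_poly (fun e => complex.Im (F e)).

Lemma coord_poly_opp (p : env -> R) : coord_poly p -> coord_poly (fun e => - p e).
Proof.
move=> hp; rewrite (_ : (fun e => _) = fun e => -1 * p e).
  by apply: CPmul => //; exact: CPconst.
by apply/funext => e; rewrite mulN1r.
Qed.

Lemma ccoord_poly_mul F G : ccoord_poly F -> ccoord_poly G ->
  ccoord_poly (fun e => F e * G e).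
Proof.
move=> [F1 F2] [G1 G2]; split.
  rewrite (_ : (fun e => _) = fun e => complex.Re (F e) * complex.Re (G e) +
     - (complex.Im (F e) * complex.Im (G e))).
    by apply: CPadd; [exact: CPmul|apply: coord_poly_opp; exact: CPmul].
  by apply/funext => e; case: (F e) (G e) => a b [].
rewrite (_ : (fun e => _) = fun e => complex.Re (F e) * complex.Im (G e) +
    complex.Im (F e) * complex.Re (G e)).
  by apply: CPadd; exact: CPmul.
by apply/funext => e; case: (F e) (G e) => a b [].
Qed.

Lemma ccoord_poly_sum (I : finType) (F : I -> env -> R[i]) :
  (forall i, ccoord_poly (F i)) -> ccoord_poly (fun e => \sum_i F i e).
Proof.
move=> hF; split.
  rewrite (_ : (fun e => _) = fun e => \sum_i complex.Re (F i e)).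
    by apply: CPsum => i; case: (hF i).
  by apply/funext => e; rewrite raddf_sum.
rewrite (_ : (fun e => _) = fun e => \sum_i complex.Im (F i e)).
  by apply: CPsum => i; case: (hF i).
by apply/funext => e; rewrite raddf_sum.
Qed.

Lemma ccoord_poly_sqnorm F G : ccoord_poly F -> ccoord_poly G ->
  coord_poly (fun e => complex.Re (F e - G e) ^+ 2 + complex.Im (F e - G e) ^+ 2).
Proof.
move=> [F1 F2] [G1 G2].
rewrite (_ : (fun e => _) = fun e =>
   (complex.Re (F e) + - complex.Re (G e)) * (complex.Re (F e) + - complex.Re (G e)) +
   (complex.Im (F e) + - complex.Im (G e)) * (complex.Im (F e) + - complex.Im (G e))).
  have Fm := CPadd F1 (coord_poly_opp G1); have Gm := CPadd F2 (coord_poly_opp G2).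
  by apply: CPadd; apply: CPmul.
by apply/funext => e; case: (F e) (G e) => a b [].
Qed.

End ComplexCoordPoly.

Section SemialgebraicRoot.
Variables (R : realType) (X Z : lmodType R) (C : set X) (d : nat).
Variables (pi : {linear Z -> X}) (gamma : {linear Z -> herm R d}).
Hypothesis pC : proper_cone C.
Hypothesis ig : injective gamma.
Hypothesis liftC : forall s, (0 < s)%N -> @bipolar R X C s =
  [set amplify pi c | c in [set c | psd_system R d s (amplify gamma c)]].

Lemma psd_flatten1 (A : herm R d) : psd (Defs.flatten (tens_pure A (herm1 R 1))) -> psd A.
Proof.
move=> /psdP pA; apply/psdP => v; have [y yv] := unvec_surj (v : 'M_(d, 1)).
have := pA y; rewrite quad_flatten_pure yv /hpair !big_ord1 /= mxE eqxx mul1r.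
exact.
Qed.

(** This is level 1 of the lift, where tensors reduce to [c (x) 1]. *)
Lemma base_lift (c : X) : C c <-> exists2 z, psd (gamma z) & pi z = c.
Proof.
split=> [Cc|[z pz <-]].
  have : @bipolar R X C 1 (tens_pure c (herm1 R 1)).
    by apply: bipolar_pure => //; exact: psd_herm1.
  rewrite liftC// => -[a pa /(congr1 (fun b : tens X 1 => (b (0, 0)).1))].
  rewrite /= !ffunE /= mxE eqxx /= scale1r => ac.
  exists (a (0, 0)).1 => //; apply: psd_flatten1.
  by rewrite -amplify_pure -tens1E.
have : @bipolar R X C 1 (amplify pi (tens_pure z (herm1 R 1))).
  rewrite liftC//; exists (tens_pure z (herm1 R 1)) => //=.
  by rewrite /psd_system /= amplify_pure; apply: psd_flatten_pure => //; exact: psd_herm1.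
rewrite amplify_pure (bipolar_base pC) => -[c' Cc'].
move=> /(congr1 (fun b : tens X 1 => (b (0, 0)).1)) /=.
by rewrite !ffunE /= mxE eqxx /= !scale1r => <-.
Qed.

Lemma lift_surj x : exists z, pi z = x.
Proof.
have [e Ce Ce1] := proper_cone_order_unit pC.
have [r r0 Cx] := Ce1 x.
have /base_lift[z1 _ z1E] := Cx; have /base_lift[z2 _ z2E] := Ce.
by exists (z1 - r *: z2); rewrite linearB linearZ /= z1E z2E addrAC subrr add0r.
Qed.

(* The Hermitian square roots of [gamma z], with [pi z = c], are the solutions
   of a polynomial system whose parameters are the coordinates of [c]. *)
Lemma semialgebraic_root : exists f : X -> 'I_d -> 'I_d -> R,
  (forall c, C c -> exists2 z, pi z = c &
     gamma z = herm_param (f c) *m herm_param (f c) :> 'M_d) /\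
  forall i j, semialgebraic [set v : (X * R^o)%type | C v.1 /\ v.2 = f v.1 i j].
Proof.
have [n b' _ ib'|n [b [_ _ _ spb]]] := @maximal_indep R Z setT (2 * (d * d)).
  exact: herm_indep_leq ig ib'.
have [m [l linj]] : exists m (l : 'I_m -> {linear X -> R^o}),
    forall v w, (forall i, l i v = l i w) -> v = w.
  apply: (linear_coordinates (u := pi \o b)) => x.
  have [z <-] := lift_surj x; have [//|k ->] := spb z.
  exists k; rewrite linear_sum; apply: eq_bigr => i _; by rewrite linearZ.
(* The unknowns are the [d^2] parameters of the root and the [n] coefficients of [z] in the family
   [b]. *)
pose N := (d * d + n)%N.
pose beta (u : 'rV[R]_N) (i j : 'I_d) := u 0 (lshift n (mxtens_index (i, j))).
pose zeta (u : 'rV[R]_N) : Z := \sum_k u 0 (rshift (d * d) k) *: b k.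
pose G (u : 'rV[R]_N) : 'M[R[i]]_d := herm_param (beta u) *m herm_param (beta u).
(* A sum of squares merges the equations [gamma z = B^2] and [pi z = c], the latter in coordinates,
   into one. *)
pose q (x : 'rV[R]_m) (u : 'rV[R]_N) : R :=
  (\sum_i \sum_j (complex.Re (gamma (zeta u) i j - G u i j) ^+ 2 +
                  complex.Im (gamma (zeta u) i j - G u i j) ^+ 2)) +
  \sum_k (x 0 k - l k (pi (zeta u))) ^+ 2.
have q0 x u : q x u = 0 <->
    gamma (zeta u) = G u :> 'M_d /\ forall k, x 0 k = l k (pi (zeta u)).
  have sq2 (z : R[i]) : 0 <= complex.Re z ^+ 2 + complex.Im z ^+ 2.
    by rewrite addr_ge0 ?sqr_ge0.
  split=> [/eqP|[E1 E2]]; last first.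
    rewrite /q E1 big1 ?add0r => [|i _]; first by apply: big1 => k _; rewrite E2 subrr expr0n.
    by apply: big1 => j _; rewrite subrr /= expr0n /= addr0.
  rewrite /q paddr_eq0; last 2 first.
  - by apply: sumr_ge0 => i _; apply: sumr_ge0 => j _; exact: sq2.
  - by apply: sumr_ge0 => k _; exact: sqr_ge0.
  rewrite !psumr_eq0 => [|k _|i _]; [|exact: sqr_ge0|by apply: sumr_ge0 => j _; exact: sq2].
  move=> /andP[/allP h1 /allP h2]; split; last first.
    by move=> k; have /= := h2 k (mem_index_enum _); rewrite sqrf_eq0 subr_eq0 => /eqP.
  apply/matrixP => i j; have /= := h1 i (mem_index_enum _).
  rewrite psumr_eq0 => [/allP/(_ j (mem_index_enum _))/=|k _]; last exact: sq2.
  rewrite paddr_eq0 ?sqr_ge0// !sqrf_eq0 => /andP[/eqP re0 /eqP im0].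
  apply/eqP; rewrite -subr_eq0; apply/eqP.
  by case: (_ - _) re0 im0 => u' v' /= -> ->.
pose co x : 'rV[R]_m := \row_k l k x.
(* Since psd matrices are the squares of Hermitian ones, the parameters for which the system is
   solvable are exactly the points of [C]. *)
have Cq c : C c <-> exists u, q (co c) u = 0.
  split=> [/base_lift[z pz zc]|[u /q0[gz lz]]].
    have [B BB] := psd_sqrt pz; have [f fB] := herm_param_surj B.
    have [//|k zk] := spb z.
    exists (row_mx (\row_p f (mxtens_unindex p).1 (mxtens_unindex p).2) (\row_i k i)).
    set u := row_mx _ _.
    have zu : zeta u = z.
      by rewrite zk; apply: eq_bigr => i _; rewrite /u row_mxEr mxE.
    have bu : beta u = f.
      by apply/funext => i; apply/funext => j; rewrite /beta /u row_mxEl mxE mxtens_indexK.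
    apply/q0; split; last by move=> i; rewrite zu zc mxE.
    by rewrite zu /G bu fB BB.
  apply/base_lift; exists (zeta u); last by apply: linj => k; rewrite -lz mxE.
  by apply: (@psd_gram _ _ _ _ (herm_param (beta u))); rewrite hermP gz.
have pq a : coord_poly (fun e => q (vec e 0 m) (vec e a N)).
  have cu i : coord_poly (fun e : nat -> R => vec e a N 0 i).
    rewrite (_ : (fun e => _) = fun e => e (a + i)%N); first exact: CPvar.
    by apply/funext => e; rewrite mxE.
  have cx i : coord_poly (fun e : nat -> R => vec e 0 m 0 i).
    rewrite (_ : (fun e => _) = fun e => e (0 + i)%N); first exact: CPvar.
    by apply/funext => e; rewrite mxE.
  have cgam i j : ccoord_poly (fun e : nat -> R => gamma (zeta (vec e a N)) i j).
    rewrite (_ : (fun e => _) = fun e => \sum_k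
        Complex (vec e a N 0 (rshift (d * d) k)) 0 * gamma (b k) i j).
      apply: ccoord_poly_sum => k; apply: ccoord_poly_mul; last by split; exact: CPconst.
      by split; [exact: cu|exact: CPconst].
    apply/funext => e; rewrite linear_sum herm_sumE summxE; apply: eq_bigr => k _.
    by rewrite linearZ /= mxE.
  have cH i j : ccoord_poly (fun e : nat -> R => herm_param (beta (vec e a N)) i j).
    have [ij|ji|/val_inj ij] := ltngtP i j.
    - rewrite (_ : (fun e => _) = fun e => Complex (beta (vec e a N) i j) (beta (vec e a N) j i)).
        by split; exact: cu.
      by apply/funext => e; rewrite mxE ij.
    - rewrite (_ : (fun e => _) = fun e => Complex (beta (vec e a N) j i) (- beta (vec e a N) i j)).
        by split; [exact: cu|apply: coord_poly_opp; exact: cu].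
      by apply/funext => e; rewrite mxE ltnNge ltnW// ji.
    - rewrite (_ : (fun e => _) = fun e => Complex (beta (vec e a N) i j) 0).
        by split; [exact: cu|exact: CPconst].
      by apply/funext => e; rewrite mxE ij ltnn.
  have cG i j : ccoord_poly (fun e : nat -> R => G (vec e a N) i j).
    rewrite (_ : (fun e => _) = fun e => \sum_k herm_param (beta (vec e a N)) i k *
      herm_param (beta (vec e a N)) k j).
      by apply: ccoord_poly_sum => k; apply: ccoord_poly_mul.
    by apply/funext => e; rewrite mxE.
  apply: CPadd.
    by do 2 (apply: CPsum => ?); apply: ccoord_poly_sqnorm.
  apply: CPsum => k.
  have cl : coord_poly (fun e : nat -> R => l k (pi (zeta (vec e a N))) : R).
    rewrite (_ : (fun e => _) = fun e => \sum_j vec e a N 0 (rshift (d * d) j) * l k (pi (b j))).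
      by apply: CPsum => j; apply: CPmul; [exact: cu|exact: CPconst].
    by apply/funext => e; rewrite !linear_sum; apply: eq_bigr => j _; rewrite !linearZ.
  have cd := CPadd (cx k) (coord_poly_opp cl).
  by apply: (CPmul cd cd).
have [h [hq hd]] := definable_selection pq.
exists (fun c => beta (h (co c))); split.
  move=> c /Cq/hq/q0[gz lz]; exists (zeta (h (co c))) => //.
  by apply: linj => k; rewrite -lz mxE.
(* The first [m] functionals are the coordinates on [X]; the last one reads the value, variable [m]
   of the selected graph. *)
move=> i j; pose L (k : 'I_m.+1) : {linear (X * R^o)%type -> R^o} :=
  oapp (fun k' => (l k' \o fst : {linear (X * R^o)%type -> R^o})) snd (unlift ord_max k).
have := definable_semialgebraic L (hd (lshift n (mxtens_index (i, j)))).
congr semialgebraic.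
have LE (v : X * R^o) (k : 'I_m.+1) : nth 0 [seq L i0 v | i0 <- enum 'I_m.+1] k = L k v.
  by rewrite (nth_map k) ?size_enum_ord// nth_ord_enum.
have vL v : vec (nth 0 [seq L i0 v | i0 <- enum 'I_m.+1]) 0 m = co v.1.
  apply/rowP => k; rewrite !mxE add0n -[k in nth _ _ k]/(nat_of_ord (widen_ord (leqnSn m) k)) LE.
  have -> : widen_ord (leqnSn m) k = lift ord_max k.
    by apply: val_inj; rewrite /= /bump leqNgt ltn_ord.
  by rewrite /L liftK.
have mL v : nth 0 [seq L i0 v | i0 <- enum 'I_m.+1] m = v.2.
  by rewrite -[m in nth _ _ m]/(nat_of_ord (@ord_max m)) LE /L unlift_none.
by apply/seteqP; split=> v /=; rewrite vL mL => -[/Cq ? ?]; split=> //; exact/Cq.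
Qed.

End SemialgebraicRoot.

(** If [chi] is semialgebraic, the graph over [C] is cut down by the preimage of [chi]; otherwise
    [f] is already given as a restriction from [C]. *)
Lemma semialgebraic_on_generatorsI (R : realType) (X : lmodType R) (C chi : set X)
    (f : X -> R) :
  chi `<=` C -> semialgebraic [set v : (X * R^o)%type | C v.1 /\ v.2 = f v.1] ->
  semialgebraic_on_generators C (fun c : chi => f (val c)).
Proof.
move=> chiC sf.
have graphE (A : set X) : [set v : (X * R^o)%type | A v.1 /\ v.2 = f v.1] =
    [set (val c, f (val c) : R^o) | c in [set: A]].
  apply/seteqP; split=> [[x y] /= [Ax ->]|_ [c _ <-] /=].
    by exists (SigSub (mem_set Ax)).
  by split=> //; exact/set_mem/valP.
have [schi|nschi] := pselect (semialgebraic chi); [left|right]; split=> //.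
  rewrite /semialgebraic_fun_on -graphE.
  have := SemialgI (semialgebraic_preimage
    (fst : {linear (X * R^o)%type -> X}) schi) sf.
  congr semialgebraic; apply/seteqP; split=> v /=; first by move=> [? []].
  by move=> [chiv ->]; split=> //; split=> //; exact: chiC.
exists (fun c => f (val c)); split; first by rewrite /semialgebraic_fun_on -graphE.
by move=> c c' ->.
Qed.

Lemma lift_factorization (R : realType) (X : lmodType R) (C chi : set X)
    (d : nat) :
  proper_cone C -> chi `<=` C ->
  (exists (Z : lmodType R) (pi : {linear Z -> X}) (gamma : {linear Z -> herm R d}),
    injective gamma /\ forall s, (0 < s)%N -> @bipolar R X C s =
      [set amplify pi c | c in [set c | psd_system R d s (amplify gamma c)]]) ->
  exists W : set (chi -> R[i]^o),
    [/\ exists2 F : set (chi -> R),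
          (forall f, F f -> semialgebraic_on_generators C f) &
          W = lin_span [set (fun c => (f c)%:C : R[i]^o) | f in F],
        exists2 n, has_dim W n & (n <= d ^ 2)%N &
        factors_through C d W].
Proof.
move=> pC chiC [Z [pi [gamma [ig lev]]]].
have [f [fC fS]] := semialgebraic_root pC ig lev.
pose u (p : 'I_d * 'I_d) : chi -> R := fun c => f (val c) p.1 p.2.
pose uC (p : 'I_d * 'I_d) : chi -> R[i]^o := fun c => (u p c)%:C.
have uCE : [set (fun c => (g c)%:C : R[i]^o) | g in range u] = range uC.
  by rewrite image_comp.
exists (lin_span (range uC)); split.
- exists (range u); last by rewrite uCE.
  by move=> _ [p _ <-]; exact: (semialgebraic_on_generatorsI (f := fun x => f x p.1 p.2) chiC (fS _ _)).
- have [n Wn] := lin_span_dim uC.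
  by rewrite card_prod !card_ord => nd; exists n => //; rewrite expnS expn1.
move=> t t0 phi pphi.
have posl (c : tens Z t) : psd (Defs.flatten (amplify gamma c)) ->
    0 <= tens_pair phi (amplify pi c).
  move=> pc; suff : @bipolar R X C t (amplify pi c) by exact.
  by rewrite lev//; exists c.
have [V VE] := lifted_map_kraus ig posl.
pose B (c : X) : 'M[R[i]]_d := herm_param (f c).
have B_W i j : lin_span (range uC) (fun c : chi => B (val c) i j).
  have uW p : lin_span (range uC) (uC p) by apply: lin_span_gen; exists p.
  have ij (a b : R) : Complex a b = a%:C + 'i * b%:C :> R[i].
    by apply/eqP; rewrite eq_complex /=; apply/andP; split; apply/eqP; ring.
  have ijN (a b : R) : Complex a (- b) = a%:C + (- 'i) * b%:C :> R[i].
    by apply/eqP; rewrite eq_complex /=; apply/andP; split; apply/eqP; ring.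
  have [lt_ij|lt_ji|/val_inj eq_ij] := ltngtP i j.
  - rewrite (_ : (fun c => _) = uC (i, j) + 'i *: uC (j, i)).
      by apply: lin_spanD => //; exact: lin_spanZ.
    by apply/funext => c; rewrite /B /= mxE lt_ij ij.
  - rewrite (_ : (fun c => _) = uC (j, i) + (- 'i) *: uC (i, j)).
      by apply: lin_spanD => //; exact: lin_spanZ.
    by apply/funext => c; rewrite /B /= mxE ltnNge ltnW// lt_ji ijN.
  - rewrite (_ : (fun c => _) = uC (i, j))//.
    by apply/funext => c; rewrite /B /= mxE eq_ij ltnn.
exists (d * t)%N, (fun k => \matrix_(i, l) (fun c : chi => (B (val c) *m V k) i l : R[i]^o)).
split=> [k i l|c].
  rewrite mxE (_ : (fun c => _) = \sum_j V k j l *: (fun c : chi => B (val c) i j : R[i]^o)).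
    by apply: lin_span_sum => j; apply: lin_spanZ; exact: B_W.
  apply/funext => c; rewrite mxE fct_sumE; apply: eq_bigr => j _.
  by rewrite mulrC.
have Cc : C (val c) by apply: chiC; exact/set_mem/valP.
have [z zc zB] := fC _ Cc.
have pz : psd (gamma z) by apply: (@psd_gram _ _ _ _ (B (val c))); rewrite /B hermP.
rewrite -zc VE// herm_sumE; apply: eq_bigr => k _.
have -> : eval_mx (\matrix_(i, l) (fun c : chi => (B (val c) *m V k) i l : R[i]^o)) c =
    B (val c) *m V k by apply/matrixP => i l; rewrite !mxE.
by rewrite /= zB trmx_mul map_mxM -!mulmxA /B hermP.
Qed.

(** * From factorizations to lifts *)

Section TraceForm.
Variables (R : realType) (n : nat).
Local Notation C := R[i].
Implicit Types A B M N D : herm R n.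

Lemma htr_linear : linear (@htr R n).
Proof. by move=> r A B; apply: val_inj; rewrite /= linearD linearZ. Qed.

HB.instance Definition _ :=
  GRing.isLinear.Build R (herm R n) (herm R n) _ (@htr R n) htr_linear.

Lemma hpair_htr A B : hpair A (htr B) = complex.Re (\tr (A *m B)).
Proof.
rewrite /mxtrace raddf_sum; apply: eq_bigr => i _; rewrite mxE raddf_sum.
by apply: eq_bigr => j _; rewrite !mxE.
Qed.

Lemma hpair_outer_htr A v : hpair (outer v) (htr A) = complex.Re (quad A v).
Proof.
by rewrite hpair_htr mxtrace_mulC /= mulmxA mxtrace_mulC mulmxA /mxtrace big_ord1.
Qed.

Lemma psd_htr A : psd A -> psd (htr A).
Proof.
move=> pA; apply/psd_hpairP => B /psd_sum_outer[b ->].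
rewrite linear_sum sumr_ge0// => i _ /=; rewrite hpairC hpair_outer_htr.
exact: (psdP A).1.
Qed.

Lemma hpair_htrC A B : hpair A (htr B) = hpair B (htr A).
Proof. by rewrite !hpair_htr mxtrace_mulC. Qed.

(** Let [p] be the Frobenius projection of [D] to [S]. The transpose of [D - p] annihilates [S],
    hence [D] as well, so [D - p] is orthogonal to itself. *)
Lemma hpair_double_annihilator (S : set (herm R n)) D :
  (forall r u v, S u -> S v -> S (r *: u + v)) -> S 0 ->
  (forall M, (forall l, S l -> hpair M l = 0) -> hpair M D = 0) -> S D.
Proof.
move=> Slin S0 DS.
have [m b _ ib|m [b [_ Sb ib spb]]] := @maximal_indep R (herm R n) S (2 * (n * n)).
  exact: (@herm_indep_leq R n m (herm R n) idfun b) ib.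
have Ssum (k : 'I_m -> R) : S (\sum_i k i *: b i).
  elim/big_rec: _ => // i x _ Sx; exact: Slin.
pose G := \matrix_(i, j) hpair (b i) (htr (b j)).
have uG : G \in unitmx.
  rewrite -row_free_unit -kermx_eq0; apply/eqP/matrixP => i j; rewrite [RHS]mxE.
  apply: (ib (fun j => kermx G i j)).
  set v := \sum_j _.
  have vb l : hpair v (htr (b l)) = (kermx G *m G) i l.
    rewrite hpairC linear_sum mxE; apply: eq_bigr => l' _.
    by rewrite linearZ /= hpairC [G l' l]mxE.
  apply: hpair_self_htr_eq0.
  rewrite {2}/v !linear_sum; apply: big1 => l _.
  by rewrite !linearZ /= vb mulmx_ker [X in _ *: X]mxE scaler0.
pose c : 'rV[R]_m := \row_j hpair D (htr (b j)).
pose k := c *m invmx G; pose p := \sum_i k 0 i *: b i.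
have pb j : hpair (D - p) (htr (b j)) = 0.
  have -> : hpair (D - p) (htr (b j)) = c 0 j - (k *m G) 0 j.
    rewrite hpairC linearB /= hpairC mxE; congr (_ - _).
    rewrite /p linear_sum mxE; apply: eq_bigr => i _.
    by rewrite linearZ /= hpairC [G i j]mxE.
  by rewrite /k mulmxKV// subrr.
have aS l : S l -> hpair (htr (D - p)) l = 0.
  move=> /spb[t ->]; rewrite linear_sum big1// => i _; rewrite linearZ /=.
  by rewrite hpairC hpair_htrC pb scaler0.
have Dp : D - p = 0.
  apply: hpair_self_htr_eq0; rewrite hpairC linearB /= (DS _ aS).
  by rewrite (aS _ (Ssum _)) subr0.
by move/eqP: Dp; rewrite subr_eq0 => /eqP ->; exact: Ssum.
Qed.

Lemma hpair_kraus m (V : 'M[C]_(m, n)) (A : herm R m) B :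
  hpair (kraus V A) (htr B) = complex.Re (\tr (A *m (V *m B *m V^t*))).
Proof. by rewrite hpair_htr /= -!mulmxA mxtrace_mulC !mulmxA. Qed.

End TraceForm.

Section KroneckerPairing.
Variables (R : realType).
Local Notation C := R[i].

(** Real parts are not multiplicative; knowing that the complex sum is itself real lets the pairing
    factor over Kronecker products. *)
Lemma hpair_complex n (A B : herm R n) :
  \sum_i \sum_j A i j * B i j = (hpair A B)%:C :> C.
Proof.
set S := \sum_i _; have SE : complex.Re S = hpair A B.
  by rewrite raddf_sum; apply: eq_bigr => i _; rewrite raddf_sum.
have : Num.conj S = S.
  rewrite rmorph_sum /S exchange_big /=; apply: eq_bigr => i _.
  rewrite rmorph_sum; apply: eq_bigr => j _; rewrite rmorphM /=.
  by rewrite -{1}[herm_val A]hermP -{1}[herm_val B]hermP !mxE !conjCK.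
move: SE; case: S => a b /= <- /eqP; rewrite eq_complex /= => /andP[_ /eqP bb].
by apply/eqP; rewrite eq_complex /= eqxx /=; apply/eqP; lra.
Qed.

Lemma hpair_flatten_pure d s (A A' : herm R d) (B B' : herm R s) :
  hpair (Defs.flatten (tens_pure A B)) (Defs.flatten (tens_pure A' B')) =
  hpair A A' * hpair B B'.
Proof.
suff : (hpair (Defs.flatten (tens_pure A B)) (Defs.flatten (tens_pure A' B')))%:C =
    (hpair A A' * hpair B B')%:C by case.
rewrite rmorphM /= -!hpair_complex !flatten_pure.
rewrite sum_mxtens mulr_suml; apply: eq_bigr => i _.
rewrite mulr_sumr; apply: eq_bigr => k _.
rewrite sum_mxtens mulr_suml; apply: eq_bigr => j _.
rewrite mulr_sumr; apply: eq_bigr => l _.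
rewrite !tensmxE; ring.
Qed.

End KroneckerPairing.

Section FactorizationLift.
Variables (R : realType) (X : lmodType R) (C chi : set X) (d : nat).
Hypothesis pC : proper_cone C.
Hypothesis gC : generating_set C chi.

Definition kraus_factor (A : chi -> herm R d) :=
  forall t, (0 < t)%N -> forall phi : {linear X -> herm R t}, positive_map C phi ->
  exists (I : finType) (M : I -> 'M[R[i]]_(d, t)),
    forall c : chi, phi (val c) = \sum_k kraus (M k) (A c).

(** In the basis [w], row [r] of [P k] at [c] is [(v c)^t* N] for a constant coefficient matrix [N].
    Each pair [(k, r)] thus contributes one Kraus operator. *)
Lemma factors_through_kraus (W : set (chi -> R[i]^o)) :
  has_dim W d -> factors_through C d W ->
  exists2 A : chi -> herm R d, (forall c, psd (A c)) & kraus_factor A.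
Proof.
move=> [w [_ WE]] fW.
pose v c : 'cV[R[i]]_d := \col_i Num.conj (w i c).
exists (fun c => outer (v c)); first by move=> c; exact: psd_outer.
move=> t t0 phi pphi; have [m [P [PW PE]]] := fW t t0 phi pphi.
have spW f : W f -> exists a : 'I_d -> R[i], f = \sum_l a l *: w l.
  rewrite WE => -[n [k [g [gx ->]]]].
  have gx1 i : exists l, g i = w l by case: (gx i) => l _ <-; exists l.
  have /choice[y gy] := gx1.
  exists (fun l => \sum_(i < n | y i == l) k i).
  under [RHS]eq_bigr do rewrite scaler_suml.
  rewrite (exchange_big_dep xpredT)//=; apply: eq_bigr => i _.
  by rewrite (big_pred1 (y i)) ?gy// => l; rewrite eq_sym.
have /choice[a aE] : forall p : 'I_m * 'I_d * 'I_t, exists a : 'I_d -> R[i],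
    P p.1.1 p.1.2 p.2 = \sum_l a l *: w l.
  by move=> p; apply: spW; exact: PW.
exists ('I_m * 'I_d)%type, (fun p => \matrix_(l, j) a (p, j) l) => c.
apply: val_inj.
transitivity (\sum_k \sum_r herm_val (kraus (\matrix_(l, j) a (k, r, j) l) (outer (v c)))); last first.
  rewrite pair_big -[RHS]/(herm_val (\sum_p kraus _ _)) herm_sumE.
  by apply: eq_bigr => -[].
rewrite -[LHS]/(herm_val (phi (val c))) PE.
apply: eq_bigr => k _; apply/matrixP => i j; rewrite mxE summxE.
apply: eq_bigr => r _.
have PwE l : eval_mx (P k) c r l = (((v c)^t*) *m (\matrix_(l, j) a (k, r, j) l)) 0 l.
  rewrite !mxE (aE (k, r, l)) fct_sumE; apply: eq_bigr => l' _.
  by rewrite !mxE conjCK mulrC.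
set N := \matrix_(l, j) a (k, r, j) l in PwE *.
rewrite [RHS](_ : _ = (((v c)^t* *m N)^t* *m ((v c)^t* *m N)) i j); last first.
  by rewrite /= trmx_mul map_mxM trmxCK !mulmxA.
by rewrite [RHS]mxE big_ord1 PwE ![((_)^t*) i _]mxE ![(_^T) i _]mxE PwE.
Qed.

(* Among the psd [Q] for which [c |-> tr (A c Q)] is linear, one of maximal rank
   has the smallest kernel: it kills nothing seen by any positive map. *)
Lemma kraus_factor_support (A : chi -> herm R d) :
  (forall c, psd (A c)) -> kraus_factor A ->
  exists (A' : chi -> herm R d) (P Q : herm R d) (f : {linear X -> R^o}),
    [/\ forall c, psd (A' c), kraus_factor A',
        P *m P = P :> 'M_d, forall c, kraus P (A' c) = A' c &
        (forall c, f (val c) = hpair (A' c) (htr Q)) /\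
        exists2 e : R, 0 < e & psd (Q + (herm1 R d - P) - e *: herm1 R d)].
Proof.
move=> pA fA.
pose lin (Q : herm R d) := exists f : {linear X -> R^o}, forall c, f (val c) = hpair (A c) (htr Q).
pose p r := `[< exists Q : herm R d, [/\ psd Q, lin Q & \rank Q = r] >].
have [p0 pD _] := psd_cone R d.
have exp : exists r, p r.
  exists 0%N; apply/asboolP; exists 0; split=> //; last by rewrite mxrank0.
  by exists (\0 : {linear X -> R^o}) => c; rewrite !linear0.
have pbd r : p r -> (r <= d)%N by move=> /asboolP[Q [_ _ <-]]; exact: rank_leq_row.
have [_ /asboolP[Q [pQ [f fQ] <-]] Qmax] := ex_maxnP exp pbd.
have [P [PP PQ eP Psup]] := psd_support pQ.
(* The kernel of the psd sum [Q + N] lies in that of [Q], and maximality bounds its rank by that of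
   [Q]; so the two row spaces coincide. *)
have ker N (v : 'cV_d) : psd N -> lin N -> Q *m v = 0 -> N *m v = 0.
  move=> pN [g gN] Qv.
  pose S : 'M_d := (Q : 'M_d) + N.
  have sQ : (herm_val Q <= S)%MS.
    rewrite submxE; apply/eqP/matrixP => i j; rewrite [RHS]mxE.
    set K := cokermx _; have QNK : S *m col j K = 0.
      by rewrite colE mulmxA mulmx_coker mul0mx.
    have q0 : quad Q (col j K) + quad N (col j K) = 0.
      by rewrite -quadD /quad -mulmxA QNK mulmx0 mxE.
    have : quad Q (col j K) = 0.
      by move/eqP: q0; rewrite paddr_eq0; [move=> /andP[/eqP]|exact: pQ|exact: pN].
    by move=> /(psd_quad0 pQ) /matrixP/(_ i 0); rewrite colE mulmxA -colE !mxE.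
  have rk : (\rank S <= \rank (herm_val Q))%N.
    apply: Qmax; apply/asboolP; exists (Q + N).
    split; [exact: (pD _ _ pQ pN)| |reflexivity].
    by exists (f \+ g) => c; rewrite /= fQ gN !linearD.
  have : (S <= herm_val Q)%MS by rewrite -(mxrank_leqif_sup sQ) eqn_leq rk mxrankS.
  move=> /submxP[D DE].
  have : S *m v = 0 by rewrite DE -mulmxA Qv mulmx0.
  by rewrite mulmxDl Qv add0r.
exists (fun c => kraus P (A c)), P, Q, f; split; [ | |exact: PP| | ].
- by move=> c; exact: (psd_kraus P (pA c)).
- move=> t t0 phi pphi; have [I [M ME]] := fA t t0 phi pphi.
  exists I, M => c; rewrite ME; apply: eq_bigr => k _.
  suff PM : P *m M k = M k.
    have MP : (M k)^t* *m P = (M k)^t* by rewrite -[in RHS]PM trmx_mul map_mxM hermP.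
    by apply: val_inj; rewrite /= hermP !mulmxA MP -[RHS]mulmxA PM.
  apply: Psup => v Qv.
  (* On the [A c] this functional is the trace of [phi c], linear in [c]. So its representing psd
     matrix satisfies [lin] and vanishes on the kernel of [Q], which forces [(M k)^t* v = 0]. *)
  pose T B : R^o := \sum_k hpair (herm1 R t) (kraus (M k) B).
  have T_lin : linear T.
    move=> r B D; rewrite /T scaler_sumr -big_split; apply: eq_bigr => l _ /=.
    by rewrite !linearP.
  have T_ge0 l B : psd B -> 0 <= hpair (herm1 R t) (kraus (M l) B).
    by move=> pB; apply: (psd_hpairP _).1; [exact: psd_herm1|exact: psd_kraus].
  have [N NE] := hpair_riesz (HB.pack T
    (GRing.isLinear.Build R (herm R d) R^o _ T T_lin) : {linear herm R d -> R^o}).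
  have {}NE B : T B = hpair B N by exact: NE.
  have pN : psd N.
    apply/psd_hpairP => B pB; rewrite hpairC -NE; apply: sumr_ge0 => l _; exact: T_ge0.
  have Nv : htr N *m v = 0.
    apply: (ker _ _ (psd_htr pN) _ Qv).
    exists (hpair (herm1 R t) \o phi) => c'.
    by rewrite htrK -NE /= ME linear_sum.
  have : T (outer v) = 0.
    by rewrite NE -[N]htrK hpair_outer_htr /quad -mulmxA Nv mulmx0 mxE.
  move=> /eqP; rewrite psumr_eq0 => [/allP/(_ k (mem_index_enum _))/eqP /=|l _]; last first.
    by apply: T_ge0; exact: psd_outer.
  have -> : herm1 R t = htr (herm1 R t) by apply: val_inj; rewrite /= trmx1.
  have GE : kraus ((M k)^t*) (herm1 R t) = M k *m herm1 R t *m (M k)^t* :> 'M_d.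
    by rewrite /= trmxCK.
  rewrite hpairC hpair_kraus -GE -hpair_htr hpair_outer_htr => q0.
  have : quad (kraus ((M k)^t*) (herm1 R t)) v = 0 by rewrite quad_real q0.
  by rewrite quadM => /(psd_quad0 (@psd_herm1 R t)); rewrite mul1mx.
- by move=> c; apply: val_inj; rewrite /= hermP -!mulmxA PP !mulmxA PP.
- split; [move=> c|exact: eP]; rewrite hpair_kraus hermP -mulmxA.
  rewrite (_ : Q *m P = Q) ?PQ ?fQ ?hpair_htr//.
  by have := congr1 (fun M : 'M_d => M^t*) PQ; rewrite trmx_mul map_mxM !hermP.
Qed.

End FactorizationLift.

Lemma amplify_surj (R : realType) (X Z : lmodType R) (pi : {linear Z -> X}) s :
  (forall x, exists z, pi z = x) -> forall a : tens X s, exists c, amplify pi c = a.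
Proof.
move=> /choice[g gE] a.
exists (\sum_i \sum_j (tens_pure (g (a (i, j)).1) (re_basis R i j) +
                 tens_pure (g (a (i, j)).2) (im_basis R i j))).
rewrite [RHS]tens_decomp linear_sum; apply: eq_bigr => i _.
rewrite linear_sum; apply: eq_bigr => j _.
by rewrite linearD /= !amplify_pure !gE.
Qed.

Section LiftOfFactorization.
Variables (R : realType) (X : lmodType R) (C chi : set X) (d : nat).
Hypothesis pC : proper_cone C.
Hypothesis gC : generating_set C chi.
Variables (A : chi -> herm R d) (P Q : herm R d) (f : {linear X -> R^o}).
Hypothesis pA : forall c, psd (A c).
Hypothesis fA : kraus_factor C A.
Hypothesis PP : P *m P = P :> 'M_d.
Hypothesis PA : forall c, kraus P (A c) = A c.
Hypothesis fQ : forall c, f (val c) = hpair (A c) (htr Q).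
Variable e : R.
Hypothesis e0 : 0 < e.
Hypothesis pQ : psd (Q + (herm1 R d - P) - e *: herm1 R d).

Lemma kraus_factor_lift :
  exists (Z : lmodType R) (pi : {linear Z -> X}) (gamma : {linear Z -> herm R d}),
    injective gamma /\ forall s, (0 < s)%N -> @bipolar R X C s =
      [set amplify pi c | c in [set c | psd_system R d s (amplify gamma c)]].
Proof.
have [n b _ ib|n [b [_ Sb ib spb]]] := @maximal_indep R (herm R d) (range A) (2 * (d * d)).
  exact: (@herm_indep_leq R d n (herm R d) idfun b) ib.
have /choice[x xE] : forall i, exists c, A c = b i.
  by move=> i; have [c _ cE] := Sb i; exists c.
have comb (V : lmodType R) (v : 'I_n -> V) : exists g : {linear 'rV[R]_n -> V},
    forall z, g z = \sum_i z 0 i *: v i.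
  have g_lin : linear (fun z : 'rV[R]_n => \sum_i z 0 i *: v i).
    move=> r u w; rewrite scaler_sumr -big_split; apply: eq_bigr => i _ /=.
    by rewrite !mxE scalerDl scalerA.
  by exists (HB.pack_for {linear 'rV[R]_n -> V} (fun z : 'rV[R]_n => \sum_i z 0 i *: v i)
    (GRing.isLinear.Build R _ _ _ _ g_lin)).
have [gamma gammaE] := comb _ b; have [pi piE] := comb _ (fun i => val (x i)).
have ig : injective gamma.
  move=> u v uv; apply/rowP => i; apply/eqP; rewrite -subr_eq0; apply/eqP.
  apply: (ib (fun i => u 0 i - v 0 i)); under eq_bigr do rewrite scalerBl.
  by rewrite sumrB -!gammaE uv subrr.
have factor t (phi : {linear X -> herm R t}) (I : finType) (M : I -> 'M[R[i]]_(d, t)) :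
    (forall c, phi (val c) = \sum_k kraus (M k) (A c)) ->
    forall z, phi (pi z) = \sum_k kraus (M k) (gamma z).
  move=> ME z; rewrite piE linear_sum.
  rewrite [RHS](eq_bigr (fun k => \sum_i z 0 i *: kraus (M k) (b i))).
    rewrite exchange_big; apply: eq_bigr => i _.
    by rewrite linearZ /= ME xE scaler_sumr.
  by move=> k _; rewrite gammaE linear_sum; apply: eq_bigr => i _; rewrite linearZ.
(* [pi] is prescribed only on a basis of the span. For any other [c], each functional nonnegative on
   [C] factors through [A] and so takes equal values at [pi z] and [c]; such functionals separate
   points. *)
have lift_gen (c : chi) : exists2 z, gamma z = A c & pi z = val c.
  have [|k kE] := spb (A c); first by exists c.
  exists (\row_i k i) => [|].
    by rewrite gammaE kE; apply: eq_bigr => i _; rewrite mxE.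
  set z := \row_i k i.
  have gz : gamma z = A c by rewrite gammaE kE; apply: eq_bigr => i _; rewrite mxE.
  apply/eqP; rewrite -subr_eq0; apply/eqP.
  apply: (proper_cone_separates_points pC) => l l0.
  pose phi : {linear X -> herm R 1} := scale_map l (herm1 R 1).
  have pphi : positive_map C phi.
    move=> c' Cc'; have [_ _ pZ] := psd_cone R 1.
    by apply: pZ; [exact: l0|exact: psd_herm1].
  have [I [M ME]] := fA (ltn0Sn 0) pphi.
  have : phi (pi z) = phi (val c) by rewrite (factor _ _ _ _ ME) gz ME.
  rewrite /= => /(congr1 (fun B : herm R 1 => complex.Re (B 0 0))).
  by rewrite /= !mxE eqxx /= !mulr1 !mul0r !subr0 linearB => ->; rewrite subrr.
have [chiC hullC] := gC.
have pi_surj y : exists z, pi z = y.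
  have inC c : C c -> exists z, pi z = c.
    rewrite -hullC => -[m [r [a [ra ->]]]].
    have /choice[w wE] : forall j, exists z, pi z = a j.
      move=> j; have [_ chia] := ra j.
      by have [z _ zE] := lift_gen (SigSub (mem_set chia)); exists z.
    exists (\sum_j r j *: w j); rewrite linear_sum.
    by apply: eq_bigr => j _; rewrite linearZ /= wE.
  have [u Cu Cu1] := proper_cone_order_unit pC.
  have [r r0 /inC[z1 z1E]] := Cu1 y; have [z2 z2E] := inC _ Cu.
  by exists (z1 - r *: z2); rewrite linearB linearZ /= z1E z2E addrAC subrr add0r.
have Pg z : kraus P (gamma z) = gamma z.
  by rewrite gammaE linear_sum; apply: eq_bigr => i _; rewrite linearZ /= -xE PA.
have fg z : f (pi z) = hpair (gamma z) (htr Q).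
  rewrite piE linear_sum hpairC gammaE linear_sum; apply: eq_bigr => i _.
  by rewrite !linearZ /= fQ xE hpairC.
exists 'rV[R]_n, pi, gamma; split=> // s s0; apply/seteqP; split; last first.
  move=> _ [c pc <-] phi pphi.
  have [I [M ME]] := fA s0 pphi; have pM := factor _ _ _ _ ME.
  rewrite tens_pair_amplify (tens_pair_sum (psi := fun k => kraus (M k) \o gamma))//.
  apply: sumr_ge0 => k _; rewrite -tens_pair_amplify.
  have [y <-] := unvec_surj (M k); rewrite -quad_flatten.
  exact: (psdP _).1.
move=> a Ta; have [c0 c0a] := amplify_surj pi_surj a.
pose Phi (c : tens 'rV[R]_n s) := Defs.flatten (amplify gamma c).
have PhiP r u v : Phi (r *: u + v) = r *: Phi u + Phi v by rewrite /Phi !linearP.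
pose ann M := forall l, amplify pi l = 0 -> hpair M (Phi l) = 0.
pose G := [set p : herm R (d * s) * R | ann p.1 /\ p.2 = hpair p.1 (Phi c0)].
have gG : positive_graph (@psd R (d * s)) G.
  split=> [r [M u] [N v] [/= aM ->] [/= aN ->]|M u [/= aM ->] pM].
    split=> [l l0 /=|/=]; last by rewrite [RHS]hpairC linearP /= !(hpairC (Phi c0)).
    rewrite hpairC linearP /= !(hpairC (Phi l)) aM// aN//.
    by rewrite scaler0 addr0.
  (* An [M] annihilating the kernel descends along [amplify pi]. For psd [M] the result is
     nonnegative on [c (x) B] with [c] in [chi] and [B] psd, hence at [a]. *)
  have [pre preE] := choice (amplify_surj pi_surj (s := s)).
  pose F (y : tens X s) : R^o := hpair M (Phi (pre y)).
  have FE c : F (amplify pi c) = hpair M (Phi c).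
    apply/eqP; rewrite -subr_eq0 -linearB /=; apply/eqP.
    have -> : Phi (pre (amplify pi c)) - Phi c = Phi (pre (amplify pi c) - c).
      by rewrite /Phi !linearB.
    by apply: aM; rewrite linearB /= preE subrr.
  have F_lin : linear F.
    move=> r y y'; have [c <-] := amplify_surj pi_surj y.
    have [c' <-] := amplify_surj pi_surj y'.
    by rewrite -linearP FE !FE PhiP linearP.
  pose F' : {linear tens X s -> R^o} := HB.pack F (GRing.isLinear.Build R _ R^o _ F F_lin).
  rewrite -FE c0a; apply: (@bipolar_ge0 R X C s F') Ta => y B.
  rewrite -hullC => -[m [r [w [rw ->]]]] pB.
  rewrite -sum_tens_purel linear_sum; apply: sumr_ge0 => j _.
  have [rj chiw] := rw j; rewrite tens_pureZl linearZ /=.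
  apply: mulr_ge0 => //; have [z zA zw] := lift_gen (SigSub (mem_set chiw)).
  rewrite -[w j]zw -amplify_pure FE /Phi amplify_pure zA.
  by apply: (psd_hpairP _).1; [exact: pM|exact: psd_flatten_pure (pA _) pB].
have [M|F [F0 FG]] := positive_extension (psd_cone R (d * s)) gG.
  (* [D] is positive definite. Pairing its transpose with [gamma z] gives [f (pi z)], because
     [1 - P] is orthogonal to the compressed [gamma z]; so [u] annihilates the kernel of
     [amplify pi]. *)
  pose D := Q + (herm1 R d - P).
  have pD : psd (htr D - e *: herm1 R d).
    have -> : htr D - e *: herm1 R d = htr (D - e *: herm1 R d).
      have t1 : htr (herm1 R d) = herm1 R d by apply: val_inj; rewrite /= trmx1.
      by rewrite (linearB (@htr R d)) (linearZ_LR (@htr R d)) /= t1.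
    exact: psd_htr.
  have [r r0 pr] := psd_tensor_order_unit (s := s) e0 pD (- M).
  set u := Defs.flatten _ in pr.
  exists (r *: u), (hpair (r *: u) (Phi c0)); split; last exact: pr.
  split=> //= l l0; rewrite hpairC linearZ /= hpairC.
  pose psi : {linear X -> herm R s} := scale_map f (herm1 R s).
  suff -> : hpair u (Phi l) = tens_pair psi (amplify pi l).
    by rewrite l0 linear0 scaler0.
  have PhiL : linear (hpair u \o Phi : _ -> R^o) by move=> t v w; rewrite /= PhiP linearP.
  pose L : {linear tens 'rV[R]_n s -> R^o} :=
    HB.pack (hpair u \o Phi : _ -> R^o) (GRing.isLinear.Build R _ R^o _ _ PhiL).
  rewrite -[LHS]/(L l) -[RHS]/((tens_pair psi \o amplify pi) l).
  apply: tens_ext => z B; rewrite /= /Phi !amplify_pure /u hpair_flatten_pure.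
  rewrite tens_pair_pure /= linearZ /= hpairC (hpairC B) -[f _]/(f _) fg; congr (_ * _).
  rewrite /D linearD /= linearD /= -[RHS]addr0; congr (_ + _).
  rewrite -[gamma z]Pg hpair_kraus hermP.
  rewrite (_ : P *m _ *m P = 0) ?mulmx0 ?mxtrace0//.
  by rewrite /= mulmxBr mulmxBl mulmx1 !PP subrr.
have [Y FY] := hpair_riesz F.
have pY : psd Y by apply/psd_hpairP => B pB; rewrite hpairC -FY; exact: F0.
(* [Y] and [Phi c0] pair equally with the whole annihilator of the kernel, so they differ by the
   image of a kernel element. *)
have [l l0 lY] : exists2 l, amplify pi l = 0 & Phi l = Y - Phi c0.
  have [] := @hpair_double_annihilator R (d * s)
    [set M | exists2 l, amplify pi l = 0 & Phi l = M] (Y - Phi c0).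
  - move=> r u v [l l0 <-] [l' l'0 <-]; exists (r *: l + l'); last exact: PhiP.
    by rewrite linearP /= l0 l'0 scaler0 addr0.
  - by exists 0; rewrite /Phi !linear0.
  - move=> M aM; rewrite linearB /= -FY; apply/eqP; rewrite subr_eq0; apply/eqP.
    by apply: FG; split=> // l l0; apply: aM; exists l.
  - by move=> l l0 lY; exists l.
exists (l + c0); last by rewrite linearD /= l0 add0r.
rewrite /psd_system /= -/(Phi _) -[l]scale1r PhiP scale1r lY subrK.
exact: pY.
Qed.

End LiftOfFactorization.

Theorem theorem4p1 (R : realType) (X : lmodType R) (C chi : set X)
    (Cmin : cone_family X) (d : nat) :
  proper_cone C ->
  generating_set C chi ->
  minimal_operator_system C Cmin ->
  (has_lift Cmin (psd_system R d) ->
   exists W : set (chi -> R[i]^o),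
     [/\ exists2 F : set (chi -> R),
           (forall f, F f -> semialgebraic_on_generators C f) &
           W = lin_span [set (fun c => (f c)%:C : R[i]^o) | f in F],
         exists2 n, has_dim W n & (n <= d ^ 2)%N &
         factors_through C d W]) /\
  ((exists2 W : set (chi -> R[i]^o), has_dim W d & factors_through C d W) ->
   has_lift Cmin (psd_system R d)).
Proof.
move=> pC gC mC; split=> [[Z [pi [gamma [ig lev]]]]|[W Wd Wf]].
  apply: lift_factorization => //; first by case: gC.
  exists Z, pi, gamma; split=> // s s0.
  by rewrite -(minimal_system_bipolar pC mC s0) lev.
have [A pA fA] := factors_through_kraus Wd Wf.
have [A' [P [Q [f [pA' fA' PP PA [fQ [e e0 pQ]]]]]]] := kraus_factor_support pA fA.
have [Z [pi [gamma [ig lev]]]] := kraus_factor_lift pC gC pA' fA' PP PA fQ e0 pQ.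
exists Z, pi, gamma; split=> // s s0.
by rewrite (minimal_system_bipolar pC mC s0) lev.
Qed.
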